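(* Let $u_i,v_i,\widehat u_i^L,\widehat v_i^L,\widehat u_i^R,\widehat v_i^R$ ($i\in\mathbb N_0$) be the functions defined recursively in the context, and set $\beta=\sqrt{a_{11}(0)}$. Then the functions $\widehat u_i^L,\widehat v_i^L,\widehat u_i^R,\widehat v_i^R$ are entire, and the functions $u_i,v_i$ are analytic in a fixed neighborhood of $I$. Furthermore, there exist positive constants $\gamma,C_u,C_v,C_\ell,K_\ell$, $\ell=1,\dots,4$, independent of $\varepsilon$ and $\mu$ (and of $i,n,z$), such that $\widehat v_0^L=\widehat v_1^L=0$ and, for all $i\in\mathbb N_0$ and $z\in\mathbb C$, $$|\widehat v_{i+2}^L(z)|\le C_1K_1^i\Big(\mu+\frac1{i+1}\Big)^i\frac1{i!}(iC_v+|z|)^{2i}e^{-\beta\operatorname{Re}z},$$ $$|\widehat u_i^L(z)|\le C_2K_2^i\Big(\mu+\frac1{i+1}\Big)^i\frac1{i!}(iC_u+|z|)^{2i}e^{-\beta\operatorname{Re}z},$$ and, for all $i,n\in\mathbb N_0$, $$\|u_i^{(n)}\|_{L^\infty(I)}\le C_3K_3^i\big((i+n)\mu+1\big)^i\frac{i^i}{i!}\gamma^n\max\{n,\mu^{-1}\}^n,$$ $$\|v_i^{(n)}\|_{L^\infty(I)}\le C_4K_4^i\big((i+n)\mu+1\big)^i\frac{i^i}{i!}\gamma^n\max\{n,\mu^{-1}\}^n.$$ Analogous estimates (the first two with superscript $L$ replaced by $R$) hold for $\widehat u_i^R$ and $\widehat v_i^R$ with $\beta$ replaced by $\sqrt{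a_{11}(1)}$.
   Context: $I=(0,1)$. Parameters $0<\varepsilon\le\mu\le1$. Fixed real data: $f,g$ and $\mathbf A(x)=(a_{ij}(x))_{i,j=1,2}$ with $f,g,a_{ij}$ analytic on $[0,1]$: for some constants $C_f,\gamma_f,C_g,\gamma_g,C_a,\gamma_a>0$ and all $n\in\mathbb N_0$, $\|f^{(n)}\|_{L^\infty(I)}\le C_f\gamma_f^n n!$, $\|g^{(n)}\|_{L^\infty(I)}\le C_g\gamma_g^n n!$, $\|a_{ij}^{(n)}\|_{L^\infty(I)}\le C_a\gamma_a^n n!$. For some fixed $\alpha>0$, $\xi^T\mathbf A(x)\xi\ge\alpha^2\xi^T\xi$ for all $\xi\in\mathbb R^2$, $x\in[0,1]$ (hence $a_{11}>0$, $\det\mathbf A>0$). Conventions: functions with a negative subscript are zero; $0^0=1$; $f_0=f$, $g_0=g$, $f_i=g_i=0$ for $i>0$. Recursion: $\widehat v_0^L=\widehat v_1^L=\widehat v_0^R=\widehat v_1^R=0$, and for $i=0,1,2,\dots$, in this order: (1) $v_i$ solves on $I$: $-\mu^2v_i''+\frac{a_{22}a_{11}-a_{12}a_{21}}{a_{11}}v_i=g_i-\frac{a_{21}}{a_{11}}(f_i+\mu^2u_{i-2}'')$, $v_i(0)=-\widehat v_i^L(0)$, $v_i(1)=-\widehat v_i^R(0)$; (2) $u_i=\frac1{a_{11}}(f_i+\mu^2u_{i-2}''-a_{12}v_i)$; (3) $\widehat u_i^L$ solves on $(0,\infty)$: $-(\widehat u_i^L)''+\sum_{k=0}^i\mu^k\widehat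 x^k\big(\frac{a_{11}^{(k)}(0)}{k!}\widehat u_{i-k}^L+\frac{a_{12}^{(k)}(0)}{k!}\widehat v_{i-k}^L\big)=0$, $\widehat u_i^L(0)=-u_i(0)$, $\widehat u_i^L(\widehat x)\to0$ as $\widehat x\to\infty$; (4) $\widehat v_{i+2}^L$ solves on $(0,\infty)$: $-(\widehat v_{i+2}^L)''+\sum_{k=0}^i\mu^k\widehat x^k\big(\frac{a_{21}^{(k)}(0)}{k!}\widehat u_{i-k}^L+\frac{a_{22}^{(k)}(0)}{k!}\widehat v_{i-k}^L\big)=0$, $\widehat v_{i+2}^L(\widehat x)\to0$ as $\widehat x\to\infty$; (5) $\widehat u_i^R,\widehat v_{i+2}^R$ are defined as in (3), (4) with each $a_{pq}^{(k)}(0)$ replaced by $(-1)^ka_{pq}^{(k)}(1)$ (Taylor expansion at $x=1$ in $1-x$) and $u_i(0)$ replaced by $u_i(1)$. *)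

(* Defs.v *)
From Stdlib Require Import Reals Factorial.
From Coquelicot Require Import Coquelicot.
Local Open Scope R_scope.

Definition I_open (x : R) : Prop := 0 < x < 1.
Definition I_closed (x : R) : Prop := 0 <= x <= 1.
Definition halfline_open (x : R) : Prop := 0 < x.
Definition halfline_closed (x : R) : Prop := 0 <= x.

(** Lebesgue-null sets: coverable by open intervals of arbitrarily small total
    length. *)
Definition null_set (E : R -> Prop) : Prop :=
  forall eps : posreal, exists (p q : nat -> R) (l : R),
    (forall n, p n <= q n) /\
    (forall x, E x -> exists n, p n < x < q n) /\
    is_series (fun n => q n - p n) l /\ l <= eps.

(** The norm of L^infinity(0,1), as an essential supremum with values in Rbar
    (it is p_infty when no essential bound exists). *)
Definition Linf_norm (h : R -> R) : Rbar :=
  Glb_Rbar (fun M => null_set (fun x => I_open x /\ M < Rabs (h x))).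

Definition real_analytic_at (h : R -> R) (x : R) : Prop :=
  exists (c : nat -> R) (r : posreal),
    forall y, Rabs (y - x) < r -> is_pseries c (y - x) (h y).

(** Data are total functions on R that are analytic at every point of [0,1],
    endpoints included (hence on a neighbourhood of [0,1]), so that the two-sided
    derivatives at 0 and 1 are the derivatives of the function on [0,1]. *)
Definition analytic_data (h : R -> R) (B gam : R) : Prop :=
  (forall x, I_closed x -> real_analytic_at h x) /\
  forall n : nat,
    Rbar_le (Linf_norm (Derive_n h n)) (B * gam ^ n * INR (fact n)).

Definition coercive (a11 a12 a21 a22 : R -> R) (alpha : R) : Prop :=
  forall x, I_closed x -> forall xi1 xi2 : R,
    xi1 * (a11 x * xi1 + a12 x * xi2) + xi2 * (a21 x * xi1 + a22 x * xi2)
    >= alpha ^ 2 * (xi1 ^ 2 + xi2 ^ 2).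

(** Continuity up to the boundary is relative to [Dc]; the two derivatives are
    required separately because [ex_derive_n w 2] alone does not imply that [w]
    is differentiable. *)
Definition classical (Do Dc : R -> Prop) (w : R -> R) : Prop :=
  continuous_on Dc w /\
  forall x, Do x -> ex_derive w x /\ ex_derive (Derive w) x.

Definition datum (h : R -> R) (i : nat) : R -> R :=
  match i with O => h | S _ => fun _ => 0 end.

(** [u_{i-2}''], zero when i < 2. *)
Definition d2_prev (u : nat -> R -> R) (i : nat) : R -> R :=
  match i with S (S j) => Derive_n (u j) 2 | _ => fun _ => 0 end.

(** The outer functions.  [bL i], [bR i] are the values at 0 of the boundary layer
    functions [vhat_i^L], [vhat_i^R].  The formula for [u_i] is imposed on (0,1)
    and extended to the endpoints by continuity, since values of [u_{i-2}]
    outside [0,1] are irrelevant. *)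
Definition smooth_part (f g a11 a12 a21 a22 : R -> R) (mu : R) (bL bR : nat -> R)
    (u v : nat -> R -> R) : Prop :=
  forall i : nat,
    classical I_open I_closed (v i) /\
    (forall x, I_open x ->
       - mu ^ 2 * Derive_n (v i) 2 x
       + (a22 x * a11 x - a12 x * a21 x) / a11 x * v i x
       = datum g i x
         - a21 x / a11 x * (datum f i x + mu ^ 2 * d2_prev u i x)) /\
    v i 0 = - bL i /\ v i 1 = - bR i /\
    continuous_on I_closed (u i) /\
    (forall x, I_open x ->
       u i x = / a11 x * (datum f i x + mu ^ 2 * d2_prev u i x - a12 x * v i x)).

Definition taylor_left (a : R -> R) (k : nat) : R :=
  Derive_n a k 0 / INR (fact k).
Definition taylor_right (a : R -> R) (k : nat) : R :=
  (-1) ^ k * Derive_n a k 1 / INR (fact k).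

(** The layer functions at one endpoint; [bpq k] are the Taylor coefficients there
    and [w i] is the value of [u_i] there. *)
Definition layer_part (b11 b12 b21 b22 : nat -> R) (mu : R) (w : nat -> R)
    (uh vh : nat -> R -> R) : Prop :=
  (forall x, halfline_closed x -> vh 0%nat x = 0 /\ vh 1%nat x = 0) /\
  forall i : nat,
    (classical halfline_open halfline_closed (uh i) /\
     (forall x, halfline_open x ->
        - Derive_n (uh i) 2 x
        + sum_n (fun k => mu ^ k * x ^ k *
                   (b11 k * uh (i - k)%nat x + b12 k * vh (i - k)%nat x)) i = 0) /\
     uh i 0 = - w i /\
     is_lim (uh i) p_infty 0) /\
    (classical halfline_open halfline_closed (vh (i + 2)%nat) /\
     (forall x, halfline_open x ->
        - Derive_n (vh (i + 2)%nat) 2 x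
        + sum_n (fun k => mu ^ k * x ^ k *
                   (b21 k * uh (i - k)%nat x + b22 k * vh (i - k)%nat x)) i = 0) /\
     is_lim (vh (i + 2)%nat) p_infty 0).

Definition recursion (f g a11 a12 a21 a22 : R -> R) (mu : R)
    (u v uL vL uR vR : nat -> R -> R) : Prop :=
  smooth_part f g a11 a12 a21 a22 mu (fun i => vL i 0) (fun i => vR i 0) u v /\
  layer_part (taylor_left a11) (taylor_left a12) (taylor_left a21)
    (taylor_left a22) mu (fun i => u i 0) uL vL /\
  layer_part (taylor_right a11) (taylor_right a12) (taylor_right a21)
    (taylor_right a22) mu (fun i => u i 1) uR vR.

Definition holomorphic_on (G : C -> Prop) (F : C -> C) : Prop :=
  forall z : C, G z -> ex_derive (K := C_AbsRing) (V := C_NormedModule) F z.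

Definition entire (F : C -> C) : Prop := holomorphic_on (fun _ => True) F.

Definition extends (D : R -> Prop) (F : C -> C) (h : R -> R) : Prop :=
  forall x, D x -> F (RtoC x) = RtoC (h x).

(** Here [0 ^ 0 = 1], which matters for i = 0 or n = 0. *)
Definition layer_bound (A K c beta mu : R) (i : nat) (z : C) : R :=
  A * K ^ i * (mu + / (INR i + 1)) ^ i * / INR (fact i)
  * (INR i * c + Cmod z) ^ (2 * i) * exp (- beta * Re z).

Definition smooth_bound (A K gam mu : R) (i n : nat) : R :=
  A * K ^ i * ((INR i + INR n) * mu + 1) ^ i * (INR i ^ i / INR (fact i))
  * gam ^ n * Rmax (INR n) (/ mu) ^ n.

(* Main.v *)
Require Import Defs.
From Stdlib Require Import Reals Factorial Wf_nat IndefiniteDescription Classical Lra Lia.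
From Coquelicot Require Import Coquelicot.
Local Open Scope R_scope.

(** The four estimates are proved together, by one induction on the order [i]
    ([recursion_bounds]), but with simpler bounds than the stated ones.  Write
    [p(x) = sum p_j x^j / j!].  The induction shows that the layer functions of order [i],
    [uh_i] and [vh_(i+2)], have the form [p(x) e^(-beta x)] with [p] of degree at most [2 i]
    and [|p_j| <= M Lam^i (i mu + 1)^i s^j] (for [vh_(i+2)] with another [M]), where [s] is
    a fixed number, at most [beta / 2], and that the derivatives of [u_i] and [v_i] are
    bounded on the open interval by [M Lam^i ((i+n) mu + 1)^i gam^n max(n, 1/mu)^n].

    In the basis [x^j / j!] differentiation is the shift of the coefficients, hence bounded
    by [s] on sequences of size [s^j], and the operators [2 beta - d/dx] and
    [(beta - d/dx)^2] that the layer equations lead to are inverted by a downward recursion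
    with constants independent of [i] ([resolvent]).  Multiplication by [mu^k x^k] costs
    [(2 i mu / s)^k <= (2/s)^k (i mu + 1)^k], which the weights of the order [i - k] admit up
    to a factor [Lam^-k] ([layer_term_bound]); so a large [Lam] makes all lower orders small
    ([layer_step]).  The given layer functions coincide with the exponential polynomials so
    constructed, because decaying solutions of [w'' = beta^2 w] with [w(0) = 0] and of
    [w'' = 0] vanish.  Finally [sum_(j <= 2 i) y^j / j! <= e^i (1 + y/i)^(2 i)] turns the
    coefficient bounds into the stated pointwise bounds in the complex plane
    ([layer_weight_sum_bound]).

    For the smooth part the maximum principle bounds [v_i], interpolation at the length scale
    [mu] bounds [v_i'], and the equation [mu^2 v'' = c v - G] together with the Leibniz rule
    bounds all further derivatives ([reaction_diffusion_bound]).  The source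
    [mu^2 u_(i-2)''] has two more derivatives and two fewer factors [(i+n) mu + 1], and these
    compensate each other because [mu max(n+2, 1/mu) <= (n+2) mu + 1] ([weight_source]).
    The boundary values of [v_i] are those of layer functions of order [i - 2], so that both
    contributions carry a factor [Lam^-2].

    For fixed [i] and [mu] the derivative bounds are of the form [A (9 gam)^n n!], so the
    Taylor series of [u_i] and [v_i] converge on discs of a fixed radius.  They fit together
    to a holomorphic function near the interval because moving the centre of a Taylor
    polynomial changes its value by a telescoping sum ([taylor_center_independent]).

    The hypotheses on the data are essential bounds.  They hold pointwise, endpoints included,
    because the derivatives are continuous and null sets contain no interval
    ([analytic_data_bound]). *)

(** * Signs *)

Lemma INR_fact_pos (n : nat) : 0 < INR (fact n).
Proof. apply lt_0_INR, lt_O_fact. Qed.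

Ltac sign :=
  lazymatch goal with
  | |- 0 <= _ =>
      first [lra | apply pos_INR | apply Rabs_pos | apply Cmod_ge_0 | apply pow2_ge_0
            | apply pow_le; sign | apply Rmult_le_pos; sign | left; sign]
  | |- 0 < _ =>
      first [lra | apply exp_pos | apply INR_fact_pos | apply pow_lt; sign
            | apply Rmult_lt_0_compat; sign | apply Rinv_0_lt_compat; sign]
  end.

Lemma ex_derive_continuous_R (f : R -> R) (x : R) : ex_derive f x -> continuous f x.
Proof. apply (ex_derive_continuous (K := R_AbsRing) (V := R_NormedModule)). Qed.

Lemma ex_series_le_R (a b : nat -> R) :
  (forall n, Rabs (a n) <= b n) -> ex_series b -> ex_series a.
Proof. apply (ex_series_le (K := R_AbsRing) (V := R_CompleteNormedModule)). Qed.

Lemma is_series_zero : is_series (fun _ : nat => 0) 0.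
Proof.
  change (is_lim_seq (sum_n (fun _ => 0)) 0).
  apply is_lim_seq_ext with (fun _ => 0); [|apply is_lim_seq_const].
  intros n; rewrite sum_n_const; ring.
Qed.

(** * Essential bounds of the data *)

Definition overlap (p q c d : R) : R := Rmax 0 (Rmin d q - Rmax c p).

Lemma overlap_mono (p q c x y : R) : x <= y -> overlap p q c x <= overlap p q c y.
Proof.
  intros H; unfold overlap.
  apply Rmax_lub; [apply Rmax_l|].
  eapply Rle_trans; [|apply Rmax_r].
  apply Rplus_le_compat_r, Rle_min_compat_r, H.
Qed.

Lemma overlap_grow (p q c x y : R) :
  c <= x -> p <= x -> x <= y -> y <= q ->
  overlap p q c x + (y - x) <= overlap p q c y.
Proof.
  intros; unfold overlap.
  rewrite (Rmin_left x q), (Rmin_left y q) by lra.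
  assert (Rmax c p <= x) by (apply Rmax_lub; lra).
  rewrite (Rmax_right 0 (x - _)), (Rmax_right 0 (y - _)) by lra; lra.
Qed.

Lemma sum_overlap_mono (p q : nat -> R) (c x y : R) (N : nat) :
  x <= y ->
  sum_f_R0 (fun n => overlap (p n) (q n) c x) N
  <= sum_f_R0 (fun n => overlap (p n) (q n) c y) N.
Proof. intros; apply sum_Rle; intros; now apply overlap_mono. Qed.

Lemma sum_overlap_more (p q : nat -> R) (c x : R) (N M : nat) :
  (N <= M)%nat ->
  sum_f_R0 (fun n => overlap (p n) (q n) c x) N
  <= sum_f_R0 (fun n => overlap (p n) (q n) c x) M.
Proof.
  induction 1; [lra|]. rewrite tech5.
  assert (0 <= overlap (p (S m)) (q (S m)) c x) by apply Rmax_l. lra.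
Qed.

Lemma sum_overlap_grow (p q : nat -> R) (c x y : R) (m N : nat) :
  (m <= N)%nat -> c <= x -> p m <= x -> x <= y -> y <= q m ->
  sum_f_R0 (fun n => overlap (p n) (q n) c x) N + (y - x)
  <= sum_f_R0 (fun n => overlap (p n) (q n) c y) N.
Proof.
  intros HmN Hc Hp Hxy Hq. induction N as [|N IH].
  - simpl. replace m with 0%nat in * by lia. now apply overlap_grow.
  - rewrite !tech5. destruct (Nat.eq_dec m (S N)) as [->|Hne].
    + pose proof (overlap_grow (p (S N)) (q (S N)) c x y Hc Hp Hxy Hq).
      pose proof (sum_overlap_mono p q c x y N Hxy). lra.
    + assert (m <= N)%nat as H by lia. specialize (IH H).
      pose proof (overlap_mono (p (S N)) (q (S N)) c x y Hxy). lra.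
Qed.

(** The supremum of the points [x] for which finitely many of the covering intervals
    already have total length [x - a] inside [a,x] must be [b]: the interval that covers
    the supremum would carry the property further to the right. *)
Lemma null_set_no_interval (E : R -> Prop) (a b : R) :
  a < b -> (forall x, a <= x <= b -> E x) -> ~ null_set E.
Proof.
  intros Hab HE Hnull.
  assert (He : 0 < (b - a) / 2) by lra.
  destruct (Hnull (mkposreal _ He)) as (p & q & l & Hpq & Hcov & Hser & Hl).
  simpl in Hl.
  set (T := fun x => a <= x <= b /\
    exists N, x - a <= sum_f_R0 (fun n => overlap (p n) (q n) a x) N).
  assert (Ta : T a).
  { split; [lra|]. exists 0%nat. simpl. rewrite Rminus_diag. apply Rmax_l. }
  destruct (completeness T) as [s [Hub Hlub]].
  { exists b. intros x [Hx _]; lra. }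
  { now exists a. }
  assert (Has : a <= s) by now apply Hub.
  assert (Hsb : s <= b) by (apply Hlub; intros x [Hx _]; lra).
  destruct (Hcov s) as [m Hm]; [apply HE; lra|].
  assert (exists x, T x /\ p m < x) as (x & [Hx [N HN]] & Hpx).
  { apply Classical_Prop.NNPP; intros Hno.
    assert (s <= p m); [|lra].
    apply Hlub; intros x Tx. apply Rnot_lt_le; intros Hlt. apply Hno; eauto. }
  assert (Hxs : x <= s) by (apply Hub; split; eauto).
  set (y := Rmin b ((s + q m) / 2)).
  assert (Hy1 : y <= b) by apply Rmin_l.
  assert (Hy2 : y <= (s + q m) / 2) by apply Rmin_r.
  assert (Hy3 : s <= y) by (apply Rmin_glb; lra).
  assert (Ty : T y).
  { split; [lra|]. exists (Nat.max N m).
    pose proof (sum_overlap_more p q a x N (Nat.max N m) ltac:(lia)).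
    pose proof (sum_overlap_grow p q a x y m (Nat.max N m)
      ltac:(lia) ltac:(lra) ltac:(lra) ltac:(lra) ltac:(lra)). lra. }
  assert (Hys : y <= s) by now apply Hub.
  assert (Hyb : y = b).
  { unfold y in *. destruct (Rle_dec b ((s + q m) / 2)).
    - now apply Rmin_left.
    - rewrite Rmin_right in Hys by lra. lra. }
  destruct Ty as [_ [M HM]]. rewrite Hyb in HM.
  assert (sum_f_R0 (fun n => overlap (p n) (q n) a b) M <= l); [|lra].
  apply Rle_trans with (sum_f_R0 (fun n => q n - p n) M).
  - apply sum_Rle; intros n _. unfold overlap.
    pose proof (Rmin_r b (q n)). pose proof (Rmax_r a (p n)).
    specialize (Hpq n). apply Rmax_lub; lra.
  - rewrite <- sum_n_Reals.
    apply (is_lim_seq_incr_compare (sum_n (fun n => q n - p n))); [exact Hser|].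
    intros n. rewrite sum_Sn. unfold plus; simpl. specialize (Hpq (S n)). lra.
Qed.

Lemma null_set_empty (E : R -> Prop) : (forall x, ~ E x) -> null_set E.
Proof.
  intros HE eps. exists (fun _ => 0), (fun _ => 0), 0.
  split; [intros; lra|]. split; [intros x Hx; now elim (HE x)|].
  split; [|left; apply cond_pos].
  apply is_series_ext with (fun _ => 0); [intros; simpl; ring|].
  apply is_series_zero.
Qed.

Lemma Linf_norm_le (h : R -> R) (M : R) :
  (forall x, I_open x -> Rabs (h x) <= M) -> Rbar_le (Linf_norm h) M.
Proof.
  intros H. unfold Linf_norm.
  apply (proj1 (Glb_Rbar_correct _)).
  apply null_set_empty. intros x [Hx Hlt]. specialize (H x Hx). lra.
Qed.

(** A continuous function cannot exceed its essential bound at one point, since it would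
    exceed it on an interval. *)
Lemma Linf_norm_pointwise (h : R -> R) (M : R) :
  (forall x, I_open x -> continuous h x) -> Rbar_le (Linf_norm h) M ->
  forall x, I_open x -> Rabs (h x) <= M.
Proof.
  intros Hc HM x Hx. apply Rnot_lt_le; intros Hlt.
  set (M' := (M + Rabs (h x)) / 2).
  assert (exists m, m <= M' /\ null_set (fun y => I_open y /\ m < Rabs (h y)))
    as (m & Hm & Hnull).
  { apply Classical_Prop.NNPP; intros Hno.
    assert (Hle : Rbar_le M' (Linf_norm h)).
    { apply (proj2 (Glb_Rbar_correct _)). intros m Hm. simpl.
      apply Rnot_lt_le; intros Hmm. apply Hno. exists m; split; [lra|exact Hm]. }
    pose proof (Rbar_le_trans _ _ _ Hle HM) as H; simpl in H.
    unfold M' in H; lra. }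
  assert (Hca : continuous (fun y => Rabs (h y)) x).
  { apply continuous_comp; [now apply Hc|apply continuous_Rabs]. }
  assert (Hd : 0 < Rabs (h x) - M') by (unfold M'; lra).
  destruct (proj1 (filterlim_locally _ _) Hca (mkposreal _ Hd)) as [d Hball].
  set (r := Rmin (d / 2) (Rmin (x / 2) ((1 - x) / 2))).
  pose proof (cond_pos d) as Hdp. destruct Hx as [Hx0 Hx1].
  assert (Hr : 0 < r) by (unfold r; repeat apply Rmin_glb_lt; lra).
  assert (Hr1 : r <= d / 2) by apply Rmin_l.
  assert (Hr2 : r <= x / 2) by (eapply Rle_trans; [apply Rmin_r|apply Rmin_l]).
  assert (Hr3 : r <= (1 - x) / 2) by (eapply Rle_trans; [apply Rmin_r|apply Rmin_r]).
  apply (null_set_no_interval _ (x - r) (x + r)) in Hnull; [exact Hnull|lra|].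
  intros y Hy. split; [split; lra|].
  assert (Hb : ball x d y).
  { change (Rabs (y - x) < d). apply Rabs_def1; lra. }
  specialize (Hball y Hb). change (Rabs (Rabs (h y) - Rabs (h x)) < Rabs (h x) - M') in Hball.
  apply Rabs_def2 in Hball. lra.
Qed.

Lemma real_analytic_smooth (h : R -> R) (x : R) :
  real_analytic_at h x -> forall n, ex_derive (Derive_n h n) x.
Proof.
  intros (c & r & Hc) n.
  assert (Hcv : Rbar_lt 0 (CV_radius c)).
  { apply Rbar_lt_le_trans with (r / 2).
    { simpl. pose proof (cond_pos r); lra. }
    apply CV_radius_bounded.
    assert (Hx : Rabs ((x + r / 2) - x) < r).
    { pose proof (cond_pos r). rewrite Rabs_pos_eq; lra. }
    specialize (Hc _ Hx). replace (x + r / 2 - x) with (r / 2) in Hc by ring.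
    assert (Hl : ex_series (fun n => c n * (r / 2) ^ n)).
    { exists (h (x + r / 2)). eapply is_series_ext; [|exact Hc].
      intros k. rewrite <- pow_n_pow. apply Rmult_comm. }
    apply ex_series_lim_0 in Hl.
    destruct (filterlim_bounded (fun n => c n * (r / 2) ^ n)) as [M HM]; [now exists 0|].
    now exists M. }
  assert (Hloc : forall m, locally x (fun y =>
             Derive_n h m y = Derive_n (PSeries c) m (y - x))).
  { intros m. exists r. intros y Hy.
    rewrite (Derive_n_ext_loc h (fun z => PSeries c (z + - x)) m y).
    - rewrite Derive_n_comp_trans. reflexivity.
    - assert (Hp : 0 < r - Rabs (y - x)).
      { change (Rabs (y - x) < r) in Hy. lra. }
      exists (mkposreal _ Hp). intros z Hz.
      change (Rabs (z - y) < r - Rabs (y - x)) in Hz.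
      symmetry. apply is_pseries_unique. apply Hc.
      replace (z - x) with ((z - y) + (y - x)) by ring.
      eapply Rle_lt_trans; [apply Rabs_triang|]. lra. }
  apply ex_derive_ext_loc with (fun y => Derive_n (PSeries c) n (y - x)).
  - generalize (Hloc n). apply filter_imp. intros; now symmetry.
  - apply (ex_derive_comp (Derive_n (PSeries c) n) (fun y => y - x)).
    + assert (H0 : Rbar_lt (Rabs (x - x)) (CV_radius c)).
      { now rewrite Rminus_diag, Rabs_R0. }
      exact (ex_derive_n_PSeries (S n) c (x - x) H0).
    + auto_derive; auto.
Qed.

Lemma continuous_on_endpoint_bound (h : R -> R) (B : R) (x : R) :
  continuous_on I_closed h -> (forall y, I_open y -> Rabs (h y) <= B) ->
  I_closed x -> Rabs (h x) <= B.
Proof.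
  intros Hc HB Hx. apply Rnot_lt_le; intros Hlt.
  assert (Hd : 0 < Rabs (h x) - B) by lra.
  destruct (proj1 (filterlim_locally _ _) (Hc x Hx) (mkposreal _ Hd)) as [d Hball].
  pose proof (cond_pos d) as Hdp.
  assert (exists y, I_open y /\ Rabs (y - x) < d) as (y & Hy & Hyx).
  { destruct Hx as [Hx0 Hx1].
    set (r := Rmin (d / 2) (1 / 4)).
    assert (0 < r) by (apply Rmin_glb_lt; lra).
    assert (r <= d / 2) by apply Rmin_l. assert (r <= 1 / 4) by apply Rmin_r.
    destruct (Rle_dec x (1 / 2)).
    - exists (x + r). split; [split; lra|]. apply Rabs_def1; lra.
    - exists (x - r). split; [split; lra|]. apply Rabs_def1; lra. }
  assert (Hyc : I_closed y) by (destruct Hy; split; lra).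
  specialize (Hball y Hyx Hyc). specialize (HB y Hy).
  change (Rabs (h y - h x) < Rabs (h x) - B) in Hball.
  pose proof (Rabs_triang_inv (h x) (h y)). rewrite (Rabs_minus_sym (h x)) in H. lra.
Qed.

Lemma continuous_on_of_continuous (D : R -> Prop) (h : R -> R) :
  (forall x, D x -> continuous h x) -> continuous_on D h.
Proof.
  intros H x Hx P HP. apply filter_le_within. now apply (H x Hx).
Qed.

Lemma analytic_data_bound (h : R -> R) (B gam : R) :
  analytic_data h B gam -> forall n x, I_closed x ->
  ex_derive (Derive_n h n) x /\ Rabs (Derive_n h n x) <= B * gam ^ n * INR (fact n).
Proof.
  intros [Han Hb] n.
  assert (Hs : forall x, I_closed x -> ex_derive (Derive_n h n) x).
  { intros x Hx. exact (real_analytic_smooth h x (Han x Hx) n). }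
  assert (Hc : forall x, I_closed x -> continuous (Derive_n h n) x).
  { intros x Hx. apply ex_derive_continuous_R. now apply Hs. }
  intros x Hx. split; [now apply Hs|].
  apply continuous_on_endpoint_bound; [now apply continuous_on_of_continuous| |exact Hx].
  apply Linf_norm_pointwise; [|apply Hb].
  intros y [Hy0 Hy1]. apply Hc. split; lra.
Qed.

(** * Derivatives on the open interval *)

(** The order is kept finite because the smoothness of solutions of the differential
    equation is only obtained step by step. *)
Definition smooth_to (n : nat) (f : R -> R) : Prop :=
  forall m x, (m < n)%nat -> I_open x -> ex_derive (Derive_n f m) x.

Definition derivs_bounded (f : R -> R) (B : nat -> R) : Prop :=
  (forall n, smooth_to n f) /\ forall n x, I_open x -> Rabs (Derive_n f n x) <= B n.

Lemma I_open_locally (x : R) : I_open x -> locally x I_open.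
Proof.
  intros [H0 H1]. assert (Hd : 0 < Rmin x (1 - x)) by (apply Rmin_glb_lt; lra).
  exists (mkposreal _ Hd). intros y Hy. change (Rabs (y - x) < Rmin x (1 - x)) in Hy.
  pose proof (Rmin_l x (1 - x)). pose proof (Rmin_r x (1 - x)).
  apply Rabs_def2 in Hy. split; lra.
Qed.

Lemma I_open_locally_eq (f g : R -> R) (x : R) :
  (forall y, I_open y -> f y = g y) -> I_open x -> locally x (fun y => f y = g y).
Proof. intros H Hx. generalize (I_open_locally x Hx). now apply filter_imp. Qed.

Lemma Derive_n_ext_open (f g : R -> R) (n : nat) (x : R) :
  (forall y, I_open y -> f y = g y) -> I_open x -> Derive_n f n x = Derive_n g n x.
Proof. intros H Hx. apply Derive_n_ext_loc. now apply I_open_locally_eq. Qed.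

Lemma smooth_to_le (m n : nat) (f : R -> R) :
  (m <= n)%nat -> smooth_to n f -> smooth_to m f.
Proof. intros H Hf k x Hk. apply Hf. lia. Qed.

Lemma smooth_to_ext (n : nat) (f g : R -> R) :
  (forall y, I_open y -> f y = g y) -> smooth_to n f -> smooth_to n g.
Proof.
  intros H Hf m x Hm Hx. apply ex_derive_ext_loc with (Derive_n f m); [|now apply Hf].
  apply I_open_locally_eq; [|exact Hx]. intros y Hy. now apply Derive_n_ext_open.
Qed.

Lemma smooth_to_derive_n (n k : nat) (f : R -> R) :
  smooth_to (n + k) f -> smooth_to n (Derive_n f k).
Proof.
  intros Hf m x Hm Hx.
  apply ex_derive_ext with (Derive_n f (m + k)); [|apply Hf; [lia|exact Hx]].
  intros t. now rewrite Derive_n_comp.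
Qed.

Lemma smooth_to_step (n k : nat) (f : R -> R) :
  smooth_to k f -> smooth_to n (Derive_n f k) -> smooth_to (n + k) f.
Proof.
  intros Hk Hn m x Hm Hx. destruct (Nat.lt_ge_cases m k) as [H|H]; [now apply Hk|].
  apply ex_derive_ext with (Derive_n (Derive_n f k) (m - k)).
  - intros t. rewrite Derive_n_comp. f_equal. lia.
  - apply Hn; [lia|exact Hx].
Qed.

Lemma Derive_n_lin (a b : R) (f g : R -> R) (n : nat) :
  smooth_to n f -> smooth_to n g -> forall x, I_open x ->
  Derive_n (fun y => a * f y + b * g y) n x = a * Derive_n f n x + b * Derive_n g n x.
Proof.
  induction n as [|n IH]; intros Hf Hg x Hx; [reflexivity|].
  simpl. rewrite (Derive_ext_loc _ (fun y => a * Derive_n f n y + b * Derive_n g n y)).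
  - rewrite Derive_plus, !Derive_scal; [reflexivity| |];
      apply ex_derive_scal; [apply Hf|apply Hg]; auto.
  - apply I_open_locally_eq; [|exact Hx]. intros y Hy.
    apply IH; [| |exact Hy]; apply smooth_to_le with (S n); auto.
Qed.

Lemma smooth_to_lin (a b : R) (f g : R -> R) (n : nat) :
  smooth_to n f -> smooth_to n g -> smooth_to n (fun y => a * f y + b * g y).
Proof.
  intros Hf Hg m x Hm Hx.
  apply ex_derive_ext_loc with (fun y => a * Derive_n f m y + b * Derive_n g m y).
  - apply I_open_locally_eq; [|exact Hx]. intros y Hy. symmetry.
    apply Derive_n_lin; [| |exact Hy]; apply smooth_to_le with n; auto; lia.
  - apply (ex_derive_plus (fun y => a * Derive_n f m y) (fun y => b * Derive_n g m y));
      apply ex_derive_scal; auto.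
Qed.

(** The right-hand side of the Leibniz rule; dividing each derivative by its factorial
    turns the binomial sum into a Cauchy product. *)
Definition leibniz (F G : nat -> R -> R) (n : nat) (x : R) : R :=
  INR (fact n) *
  sum_f_R0 (fun k => F k x / INR (fact k) * (G (n - k)%nat x / INR (fact (n - k)))) n.

Lemma is_derive_sum_f_R0 (f : nat -> R -> R) (d : nat -> R) (n : nat) (x : R) :
  (forall k, (k <= n)%nat -> is_derive (f k) x (d k)) ->
  is_derive (fun y => sum_f_R0 (fun k => f k y) n) x (sum_f_R0 d n).
Proof.
  induction n as [|n IH]; intros H; simpl; [now apply H|].
  apply (is_derive_plus (fun y => sum_f_R0 (fun k => f k y) n)); [|now apply H].
  apply IH; intros; apply H; lia.
Qed.

Lemma sum_first (u : nat -> R) (n : nat) :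
  sum_f_R0 u (S n) = u 0%nat + sum_f_R0 (fun k => u (S k)) n.
Proof. rewrite decomp_sum by lia. reflexivity. Qed.

Lemma INR_fact_S (n : nat) : INR (fact (S n)) = INR (S n) * INR (fact n).
Proof. now rewrite <- mult_INR. Qed.

(** With the normalized derivatives [f_k = F k / k!], [g_k = G k / k!], differentiating
    the Cauchy product gives [sum ((k+1) f_(k+1) g_(n-k) + (n-k+1) f_k g_(n-k+1))]; after
    an index shift, the term [f_k g_(n+1-k)] has coefficient [k + (n+1-k) = n+1]. *)
Lemma is_derive_leibniz (F G : nat -> R -> R) (n : nat) (x : R) :
  (forall k, (k <= n)%nat -> is_derive (F k) x (F (S k) x)) ->
  (forall k, (k <= n)%nat -> is_derive (G k) x (G (S k) x)) ->
  is_derive (leibniz F G n) x (leibniz F G (S n) x).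
Proof.
  intros HF HG.
  set (f := fun k => F k x / INR (fact k)). set (g := fun k => G k x / INR (fact k)).
  assert (HfS : forall k, F (S k) x / INR (fact k) = INR (S k) * f (S k)).
  { intros k; unfold f. rewrite INR_fact_S. pose proof (INR_fact_pos k).
    pose proof (lt_0_INR (S k) ltac:(lia)). field; lra. }
  assert (HgS : forall k, G (S k) x / INR (fact k) = INR (S k) * g (S k)).
  { intros k; unfold g. rewrite INR_fact_S. pose proof (INR_fact_pos k).
    pose proof (lt_0_INR (S k) ltac:(lia)). field; lra. }
  assert (Hd : is_derive (leibniz F G n) x (INR (fact n) *
    sum_f_R0 (fun k => INR (S k) * f (S k) * g (n - k)%nat
                       + f k * (INR (S (n - k)) * g (S (n - k)))) n)).
  { unfold leibniz. apply is_derive_scal.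
    apply (is_derive_sum_f_R0 (fun k y =>
      F k y / INR (fact k) * (G (n - k)%nat y / INR (fact (n - k))))).
    intros k Hk.
    rewrite <- HfS, <- HgS. unfold f, g.
    specialize (HF k Hk). specialize (HG (n - k)%nat ltac:(lia)).
    apply (is_derive_mult (K := R_AbsRing) (fun y => F k y / INR (fact k))
       (fun y => G (n - k)%nat y / INR (fact (n - k)))); [| |apply Rmult_comm].
    - apply (is_derive_ext (fun y => / INR (fact k) * F k y)); [intros; apply Rmult_comm|].
      unfold Rdiv; rewrite (Rmult_comm (F (S k) x)). now apply is_derive_scal.
    - apply (is_derive_ext (fun y => / INR (fact (n - k)) * G (n - k)%nat y));
        [intros; apply Rmult_comm|].
      unfold Rdiv; rewrite (Rmult_comm (G (S (n - k)) x)). now apply is_derive_scal. }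
  replace (leibniz F G (S n) x) with (INR (fact n) *
    sum_f_R0 (fun k => INR (S k) * f (S k) * g (n - k)%nat
                       + f k * (INR (S (n - k)) * g (S (n - k)))) n); [exact Hd|].
  transitivity (INR (fact n) *
    (INR (S n) * sum_f_R0 (fun k => f k * g (S n - k)%nat) (S n)));
    [f_equal|unfold leibniz; rewrite INR_fact_S, <- Rmult_assoc; f_equal; apply Rmult_comm].
  rewrite scal_sum.
  transitivity (sum_f_R0 (fun k => INR k * f k * g (S n - k)%nat
                      + f k * (INR (S n - k) * g (S n - k)%nat)) (S n)).
  - rewrite !plus_sum. f_equal.
    + rewrite sum_first. simpl (INR 0). rewrite !Rmult_0_l, Rplus_0_l.
      apply sum_eq; intros k Hk. reflexivity.
    + rewrite tech5, Nat.sub_diag. simpl (INR 0). rewrite Rmult_0_l, Rmult_0_r, Rplus_0_r.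
      apply sum_eq; intros k Hk. now rewrite <- Nat.sub_succ_l by lia.
  - apply sum_eq; intros k Hk. rewrite minus_INR by lia. ring.
Qed.

Lemma leibniz_derive (f g : R -> R) (n : nat) (x : R) :
  smooth_to (S n) f -> smooth_to (S n) g -> I_open x ->
  is_derive (leibniz (Derive_n f) (Derive_n g) n) x
            (leibniz (Derive_n f) (Derive_n g) (S n) x).
Proof.
  intros Hf Hg Hx.
  apply is_derive_leibniz; intros k Hk; apply Derive_correct;
    [apply Hf|apply Hg]; auto; lia.
Qed.

Lemma Derive_n_mult (f g : R -> R) (n : nat) :
  smooth_to n f -> smooth_to n g -> forall x, I_open x ->
  Derive_n (fun y => f y * g y) n x = leibniz (Derive_n f) (Derive_n g) n x.
Proof.
  induction n as [|n IH]; intros Hf Hg x Hx.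
  - unfold leibniz; simpl. field.
  - simpl. rewrite (Derive_ext_loc _ (leibniz (Derive_n f) (Derive_n g) n)).
    + now apply is_derive_unique, leibniz_derive.
    + apply I_open_locally_eq; [|exact Hx]. intros y Hy.
      apply IH; [| |exact Hy]; apply smooth_to_le with (S n); auto.
Qed.

Lemma smooth_to_mult (f g : R -> R) (n : nat) :
  smooth_to n f -> smooth_to n g -> smooth_to n (fun y => f y * g y).
Proof.
  intros Hf Hg m x Hm Hx.
  assert (Hf' : smooth_to (S m) f) by (apply smooth_to_le with n; auto).
  assert (Hg' : smooth_to (S m) g) by (apply smooth_to_le with n; auto).
  apply ex_derive_ext_loc with (leibniz (Derive_n f) (Derive_n g) m).
  - apply I_open_locally_eq; [|exact Hx]. intros y Hy. symmetry.
    apply Derive_n_mult; [| |exact Hy]; apply smooth_to_le with n; auto; lia.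
  - eexists. now apply leibniz_derive.
Qed.

Lemma derivs_bounded_le (f : R -> R) (A B : nat -> R) :
  (forall n, A n <= B n) -> derivs_bounded f A -> derivs_bounded f B.
Proof.
  intros H [Hs Hb]; split; [exact Hs|]. intros n x Hx.
  eapply Rle_trans; [now apply Hb|apply H].
Qed.

Lemma derivs_bounded_ext (f g : R -> R) (B : nat -> R) :
  (forall y, I_open y -> f y = g y) -> derivs_bounded f B -> derivs_bounded g B.
Proof.
  intros H [Hs Hb]; split.
  - intros n. now apply smooth_to_ext with f.
  - intros n x Hx. rewrite <- (Derive_n_ext_open f g); auto.
Qed.

Lemma derivs_bounded_lin (a b : R) (f g : R -> R) (A B : nat -> R) :
  derivs_bounded f A -> derivs_bounded g B ->
  derivs_bounded (fun y => a * f y + b * g y) (fun n => Rabs a * A n + Rabs b * B n).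
Proof.
  intros [Hsf Hf] [Hsg Hg]; split.
  - intros n; now apply smooth_to_lin.
  - intros n x Hx. rewrite Derive_n_lin by auto.
    eapply Rle_trans; [apply Rabs_triang|]. rewrite !Rabs_mult.
    apply Rplus_le_compat; apply Rmult_le_compat_l; auto using Rabs_pos.
Qed.

Lemma derivs_bounded_derive2 (f : R -> R) (B : nat -> R) :
  derivs_bounded f B -> derivs_bounded (Derive_n f 2) (fun n => B (n + 2)%nat).
Proof.
  intros [Hs Hb]; split.
  - intros n. now apply smooth_to_derive_n.
  - intros n x Hx. rewrite Derive_n_comp. now apply Hb.
Qed.

Lemma leibniz_bound (F G : nat -> R -> R) (A B : nat -> R) (n : nat) (x : R) :
  (forall k, (k <= n)%nat -> Rabs (F k x) <= A k) ->
  (forall k, (k <= n)%nat -> Rabs (G k x) <= B k) ->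
  Rabs (leibniz F G n x) <=
  INR (fact n) * sum_f_R0 (fun k => A k / INR (fact k)
                                   * (B (n - k)%nat / INR (fact (n - k)))) n.
Proof.
  intros HF HG. unfold leibniz. rewrite Rabs_mult.
  rewrite (Rabs_pos_eq (INR (fact n))) by apply pos_INR.
  apply Rmult_le_compat_l; [sign|].
  eapply Rle_trans; [apply Rsum_abs|]. apply sum_Rle; intros k Hk.
  rewrite Rabs_mult. unfold Rdiv. rewrite !Rabs_mult, !Rabs_inv.
  rewrite !(Rabs_pos_eq (INR _)) by apply pos_INR.
  pose proof (Rinv_0_lt_compat _ (INR_fact_pos k)).
  pose proof (Rinv_0_lt_compat _ (INR_fact_pos (n - k))).
  apply Rmult_le_compat; try (apply Rmult_le_pos; [sign|lra]).
  - apply Rmult_le_compat_r; [lra|now apply HF].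
  - apply Rmult_le_compat_r; [lra|]. apply HG; lia.
Qed.

Lemma derivs_bounded_mult (f g : R -> R) (A B : nat -> R) :
  derivs_bounded f A -> derivs_bounded g B ->
  derivs_bounded (fun y => f y * g y) (fun n => INR (fact n) *
    sum_f_R0 (fun k => A k / INR (fact k) * (B (n - k)%nat / INR (fact (n - k)))) n).
Proof.
  intros [Hsf Hf] [Hsg Hg]; split.
  - intros n; now apply smooth_to_mult.
  - intros n x Hx. rewrite Derive_n_mult by auto.
    apply leibniz_bound; intros; auto.
Qed.

(** * Functions with analytic derivative bounds *)

Definition analytic_bound (C rho : R) (n : nat) : R := C * rho ^ n * INR (fact n).

Definition analytic_bounded (f : R -> R) : Prop :=
  exists C rho, 0 < C /\ 0 < rho /\ derivs_bounded f (analytic_bound C rho).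

Lemma analytic_bound_mono (C rho C' rho' : R) (n : nat) :
  0 < C <= C' -> 0 < rho <= rho' -> analytic_bound C rho n <= analytic_bound C' rho' n.
Proof.
  intros HC Hr. unfold analytic_bound. pose proof (INR_fact_pos n).
  apply Rmult_le_compat_r; [lra|].
  apply Rmult_le_compat; [lra|sign|lra|apply pow_incr; lra].
Qed.

Lemma analytic_bounded_data (h : R -> R) (B gam : R) :
  0 < B -> 0 < gam -> analytic_data h B gam -> analytic_bounded h.
Proof.
  intros HB Hg H. exists B, gam. repeat split; auto.
  - intros n m x _ [H0 H1]. apply (analytic_data_bound h B gam H). split; lra.
  - intros n x [H0 H1]. apply (analytic_data_bound h B gam H). split; lra.
Qed.

Lemma analytic_bounded_ext (f g : R -> R) :
  (forall y, I_open y -> f y = g y) -> analytic_bounded f -> analytic_bounded g.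
Proof.
  intros H (C & r & HC & Hr & Hb). exists C, r. split; [exact HC|split; [exact Hr|]].
  now apply (derivs_bounded_ext f g).
Qed.

Lemma analytic_bounded_lin (a b : R) (f g : R -> R) :
  analytic_bounded f -> analytic_bounded g ->
  analytic_bounded (fun y => a * f y + b * g y).
Proof.
  intros (C1 & r1 & HC1 & Hr1 & H1) (C2 & r2 & HC2 & Hr2 & H2).
  exists (Rabs a * C1 + Rabs b * C2 + 1), (r1 + r2).
  pose proof (Rabs_pos a). pose proof (Rabs_pos b).
  assert (0 <= Rabs a * C1) by sign.
  assert (0 <= Rabs b * C2) by sign.
  split; [lra|split; [lra|]].
  eapply derivs_bounded_le; [|apply derivs_bounded_lin; eassumption].
  intros n. unfold analytic_bound. simpl.
  pose proof (INR_fact_pos n).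
  assert (r1 ^ n <= (r1 + r2) ^ n) by (apply pow_incr; lra).
  assert (r2 ^ n <= (r1 + r2) ^ n) by (apply pow_incr; lra).
  assert (0 < (r1 + r2) ^ n) by sign.
  apply Rle_trans with ((Rabs a * C1 * r1 ^ n + Rabs b * C2 * r2 ^ n) * INR (fact n));
    [right; ring|].
  apply Rmult_le_compat_r; [lra|].
  apply Rle_trans with (Rabs a * C1 * (r1 + r2) ^ n + Rabs b * C2 * (r1 + r2) ^ n).
  - apply Rplus_le_compat; apply Rmult_le_compat_l; auto.
  - rewrite !Rmult_plus_distr_r. lra.
Qed.

Lemma INR_S_le_pow2 (n : nat) : INR (S n) <= 2 ^ n.
Proof.
  induction n as [|n IH]; [simpl; lra|].
  rewrite S_INR. simpl (2 ^ S n). assert (1 <= INR (S n)); [|lra].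
  apply (le_INR 1); lia.
Qed.

Lemma analytic_bounded_mult (f g : R -> R) :
  analytic_bounded f -> analytic_bounded g -> analytic_bounded (fun y => f y * g y).
Proof.
  intros (C1 & r1 & HC1 & Hr1 & H1) (C2 & r2 & HC2 & Hr2 & H2).
  exists (C1 * C2), (2 * (r1 + r2)).
  split; [sign|split; [lra|]].
  eapply derivs_bounded_le; [|apply derivs_bounded_mult; eassumption].
  intros n. simpl. unfold analytic_bound. rewrite (Rmult_comm (INR (fact n))).
  apply Rmult_le_compat_r; [sign|].
  apply Rle_trans with (sum_f_R0 (fun _ => C1 * C2 * (r1 + r2) ^ n) n).
  - apply sum_Rle; intros k Hk. pose proof (INR_fact_pos k).
    pose proof (INR_fact_pos (n - k)).
    replace (_ / _ * _) with (C1 * C2 * (r1 ^ k * r2 ^ (n - k))) by (field; lra).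
    apply Rmult_le_compat_l; [sign|].
    replace n with (k + (n - k))%nat at 2 by lia. rewrite pow_add.
    apply Rmult_le_compat; try sign; apply pow_incr; lra.
  - rewrite sum_cte, Rpow_mult_distr, !Rmult_assoc.
    apply Rmult_le_compat_l; [lra|]. apply Rmult_le_compat_l; [lra|].
    rewrite Rmult_comm. apply Rmult_le_compat_r; [sign|].
    apply INR_S_le_pow2.
Qed.

Lemma geometric_sum_le_2 (t : R) (n : nat) :
  0 <= t <= 1 / 2 -> sum_f_R0 (fun k => t ^ k) n <= 2.
Proof.
  intros Ht. rewrite tech3 by lra.
  assert (0 <= t ^ S n) by sign.
  apply (Rmult_le_reg_r (1 - t)); [lra|]. unfold Rdiv.
  rewrite Rmult_assoc, Rinv_l by lra. lra.
Qed.

(** By [(1 / a)' = - (1 / a)^2 a'], each order of smoothness yields the next one. *)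
Lemma smooth_to_inv (a : R -> R) (n : nat) :
  (forall k, smooth_to k a) -> (forall x, I_open x -> 0 < a x) ->
  smooth_to n (fun y => / a y).
Proof.
  intros Ha Hp. induction n as [|n IH]; [intros m x Hm; lia|].
  assert (Hd : forall x, I_open x -> ex_derive a x)
    by (intros x Hx; apply (Ha 1%nat 0%nat); auto).
  replace (S n) with (n + 1)%nat by lia. apply smooth_to_step.
  - intros m x Hm Hx. replace m with 0%nat by lia. simpl.
    apply ex_derive_inv; [now apply Hd|]. specialize (Hp x Hx). lra.
  - apply smooth_to_ext with (fun y => (-1) * ((/ a y * / a y) * Derive_n a 1 y) + 0 * a y).
    + intros y Hy. simpl. specialize (Hp y Hy).
      rewrite Derive_inv; [|now apply Hd|lra].
      change (Derive (fun x => a x) y) with (Derive a y). field; lra.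
    + apply smooth_to_lin; [|apply Ha]. apply smooth_to_mult.
      * now apply smooth_to_mult.
      * apply smooth_to_derive_n, Ha.
Qed.

(** Differentiating [a * (1 / a) = 1] expresses the [n]-th normalized derivative of
    [1 / a] through the lower ones; the radius [s] is chosen such that the geometric
    series of the lower terms, multiplied by [C / a0], sums to at most one. *)
Lemma analytic_bounded_inv (a : R -> R) (a0 : R) :
  0 < a0 -> (forall x, I_open x -> a0 <= a x) -> analytic_bounded a ->
  analytic_bounded (fun y => / a y).
Proof.
  intros Ha0 Ha (C & r & HC & Hr & Hs & Hb).
  assert (Hp : forall x, I_open x -> 0 < a x) by (intros x Hx; specialize (Ha x Hx); lra).
  assert (Hinv : forall n, smooth_to n (fun y => / a y))
    by (intros n; now apply smooth_to_inv).
  assert (HCa : 0 < C / a0) by sign.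
  set (s := 2 * r * (1 + C / a0)).
  assert (Hs0 : 0 < s) by sign.
  exists (/ a0), s. split; [sign|]. split; [exact Hs0|].
  split; [exact Hinv|].
  intros n x Hx. induction n as [n IH] using lt_wf_ind.
  set (q := Derive_n (fun y => / a y)) in *.
  destruct n as [|n].
  { unfold analytic_bound, q; simpl. rewrite !Rmult_1_r.
    rewrite Rabs_inv, Rabs_pos_eq by (specialize (Hp x Hx); lra).
    apply Rinv_le_contravar; auto. }
  assert (H0 : leibniz (Derive_n a) q (S n) x = 0).
  { unfold q. rewrite <- Derive_n_mult by auto.
    rewrite (Derive_n_ext_open _ (fun _ => 1)) by
      (auto; intros y Hy; specialize (Hp y Hy); apply Rinv_r; lra).
    apply Derive_n_const. }
  unfold leibniz in H0. apply Rmult_integral in H0.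
  destruct H0 as [H0|H0]; [pose proof (INR_fact_pos (S n)); lra|].
  rewrite sum_first in H0. simpl (_ 0%nat x) in H0. rewrite Nat.sub_0_r in H0.
  change (INR (fact 0)) with 1 in H0. rewrite Rdiv_1_r in H0.
  set (S1 := sum_f_R0 _ n) in H0.
  assert (HS1 : Rabs S1 <= s ^ S n).
  { unfold S1. eapply Rle_trans; [apply Rsum_abs|].
    apply Rle_trans with
      (sum_f_R0 (fun k => (r / s) ^ k * (C / a0 * (r / s) * s ^ S n)) n).
    - apply sum_Rle; intros k Hk.
      change (S n - S k)%nat with (n - k)%nat.
      rewrite Rabs_mult. unfold Rdiv at 1 2. rewrite !Rabs_mult, !Rabs_inv.
      rewrite !(Rabs_pos_eq (INR _)) by apply pos_INR.
      pose proof (INR_fact_pos (S k)). pose proof (INR_fact_pos (n - k)).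
      apply Rle_trans with ((C * r ^ S k) * (/ a0 * s ^ (n - k))).
      + apply Rmult_le_compat.
        * sign.
        * sign.
        * apply Rle_div_l; [lra|]. now apply Hb.
        * apply Rle_div_l; [lra|]. apply IH; lia.
      + right. replace (S n) with (S k + (n - k))%nat by lia.
        rewrite pow_add. unfold Rdiv. rewrite Rpow_mult_distr, pow_inv. simpl.
        assert (0 < s ^ k) by sign. field. lra.
    - rewrite <- scal_sum.
      assert (Hrs : r / s = / (2 * (1 + C / a0))) by (unfold s; field; lra).
      assert (0 < r / s <= 1 / 2).
      { rewrite Hrs. split; [sign|].
        unfold Rdiv at 2. rewrite Rmult_1_l. apply Rinv_le_contravar; lra. }
      pose proof (geometric_sum_le_2 (r / s) n ltac:(lra)).
      assert (0 < s ^ S n) by sign.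
      assert (HX : C / a0 * (r / s) <= 1 / 2).
      { rewrite Hrs. apply (Rmult_le_reg_r (2 * (1 + C / a0))); [lra|].
        rewrite Rmult_assoc, Rinv_l by lra. lra. }
      assert (0 <= C / a0 * (r / s)) by sign.
      apply Rle_trans with (1 / 2 * s ^ S n * 2); [|lra].
      apply Rmult_le_compat; auto.
      + sign.
      + apply cond_pos_sum; intros; sign.
      + apply Rmult_le_compat_r; lra. }
  assert (Hq : q (S n) x = - S1 / a x * INR (fact (S n))).
  { specialize (Hp x Hx). pose proof (INR_fact_pos (S n)).
    apply (Rmult_eq_reg_r (a x / INR (fact (S n)))).
    - transitivity (- S1); [|field; lra].
      apply (Rplus_eq_reg_r S1). rewrite Rplus_opp_l, <- H0. field; lra.
    - apply Rgt_not_eq, Rdiv_lt_0_compat; lra. }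
  rewrite Hq. unfold analytic_bound. unfold Rdiv.
  rewrite !Rabs_mult, Rabs_Ropp, Rabs_inv.
  rewrite (Rabs_pos_eq (INR _)) by apply pos_INR.
  apply Rmult_le_compat_r; [sign|].
  rewrite (Rmult_comm (/ a0)).
  apply Rmult_le_compat; auto using Rabs_pos.
  - left; apply Rinv_0_lt_compat. apply Rabs_pos_lt. specialize (Hp x Hx); lra.
  - apply Rinv_le_contravar; [lra|]. rewrite Rabs_pos_eq; [auto|].
    specialize (Hp x Hx); lra.
Qed.

(** * The weights of the smooth part *)

(** The common growth of the derivatives of [u_i] and [v_i]: the factor
    [max n (1/mu) ^ n] combines analytic growth with the length scale [mu] of the equation,
    and the polynomial factor pays for the two derivatives in each source
    [mu^2 u_(i-2)'']. *)
Definition weight (i : nat) (mu gam : R) (n : nat) : R :=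
  ((INR i + INR n) * mu + 1) ^ i * gam ^ n * Rmax (INR n) (/ mu) ^ n.

Lemma weight_base_ge_1 (i n : nat) (mu : R) : 0 < mu -> 1 <= (INR i + INR n) * mu + 1.
Proof.
  intros Hmu. pose proof (pos_INR i). pose proof (pos_INR n).
  assert (0 <= (INR i + INR n) * mu) by sign. lra.
Qed.

Lemma weight_base_mono (i n m : nat) (mu : R) :
  0 < mu -> (n <= m)%nat -> (INR i + INR n) * mu + 1 <= (INR i + INR m) * mu + 1.
Proof.
  intros Hmu Hnm. apply Rplus_le_compat_r, Rmult_le_compat_r; [lra|].
  apply Rplus_le_compat_l, le_INR, Hnm.
Qed.

Lemma weight_max_pos (n : nat) (mu : R) : 0 < mu -> 0 < Rmax (INR n) (/ mu).
Proof.
  intros Hmu. eapply Rlt_le_trans; [apply Rinv_0_lt_compat, Hmu|apply Rmax_r].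
Qed.

Lemma weight_max_mono (n m : nat) (mu : R) :
  (n <= m)%nat -> Rmax (INR n) (/ mu) <= Rmax (INR m) (/ mu).
Proof. intros H. apply Rle_max_compat_r, le_INR, H. Qed.

Lemma weight_pos (i n : nat) (mu gam : R) : 0 < mu -> 0 < gam -> 0 < weight i mu gam n.
Proof.
  intros Hmu Hg. pose proof (weight_base_ge_1 i n mu Hmu).
  unfold weight. repeat apply Rmult_lt_0_compat; apply pow_lt; auto; [lra|].
  now apply weight_max_pos.
Qed.

Lemma weight_0 (i : nat) (mu gam : R) : weight i mu gam 0 = (INR i * mu + 1) ^ i.
Proof. unfold weight; simpl. now rewrite Rplus_0_r, !Rmult_1_r. Qed.

Lemma fact_le_pow_fact (n k : nat) (m : R) :
  (k <= n)%nat -> INR n <= m -> INR (fact n) <= m ^ k * INR (fact (n - k)).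
Proof.
  intros Hk Hm. pose proof (pos_INR n). induction k as [|k IH].
  - rewrite Nat.sub_0_r; simpl; lra.
  - eapply Rle_trans; [apply IH; lia|].
    replace (n - k)%nat with (S (n - S k)) by lia. rewrite INR_fact_S.
    simpl (m ^ S k). rewrite (Rmult_comm m), Rmult_assoc.
    apply Rmult_le_compat_l; [sign|].
    apply Rmult_le_compat_r; [sign|].
    eapply Rle_trans; [|exact Hm]. apply le_INR; lia.
Qed.

Lemma analytic_bound_le_weight (C rho : R) (i : nat) (mu gam : R) (n : nat) :
  0 <= C -> 0 < rho <= gam -> 0 < mu ->
  analytic_bound C rho n <= C * weight i mu gam n.
Proof.
  intros HC Hr Hmu. unfold analytic_bound, weight. rewrite Rmult_assoc.
  apply Rmult_le_compat_l; [exact HC|].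
  pose proof (fact_le_pow_fact n n (Rmax (INR n) (/ mu)) ltac:(lia) (Rmax_l _ _)) as Hf.
  rewrite Nat.sub_diag in Hf; simpl (INR (fact 0)) in Hf. rewrite Rmult_1_r in Hf.
  apply Rmult_le_compat; [sign|sign| |exact Hf].
  apply Rle_trans with (gam ^ n); [apply pow_incr; lra|].
  rewrite <- (Rmult_1_l (gam ^ n)) at 1.
  apply Rmult_le_compat_r; [sign|].
  apply pow_R1_Rle. now apply weight_base_ge_1.
Qed.

(** In the Leibniz sum, [n! / (n-k)! <= n^k] is absorbed by the [k] missing factors
    [max n (1/mu)]; what remains is a geometric series in [rho / gam]. *)
Lemma leibniz_weight (F G : nat -> R -> R) (C rho X : R) (i : nat) (mu gam : R)
    (n : nat) (x : R) :
  0 <= C -> 0 <= X -> 0 < rho -> 2 * rho <= gam -> 0 < mu ->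
  (forall k, (k <= n)%nat -> Rabs (F k x) <= analytic_bound C rho k) ->
  (forall k, (k <= n)%nat -> Rabs (G k x) <= X * weight i mu gam k) ->
  Rabs (leibniz F G n x) <= 2 * C * X * weight i mu gam n.
Proof.
  intros HC HX Hr Hg Hmu HF HG.
  eapply Rle_trans; [apply (leibniz_bound _ _ _ _ _ _ HF HG)|].
  assert (Hrg : 0 <= rho / gam <= 1 / 2).
  { split; [sign|].
    apply (Rmult_le_reg_r gam); [lra|]. unfold Rdiv at 1.
    rewrite Rmult_assoc, Rinv_l by lra. lra. }
  pose proof (weight_pos i n mu gam Hmu ltac:(lra)) as HW.
  rewrite scal_sum.
  apply Rle_trans with
    (sum_f_R0 (fun k => (rho / gam) ^ k * (C * X * weight i mu gam n)) n).
  - apply sum_Rle; intros k Hk. unfold analytic_bound.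
    pose proof (INR_fact_pos k). pose proof (INR_fact_pos (n - k)).
    replace (C * rho ^ k * INR (fact k) / INR (fact k) *
      (X * weight i mu gam (n - k) / INR (fact (n - k))) * INR (fact n))
      with (C * X * rho ^ k * (weight i mu gam (n - k) *
             (INR (fact n) / INR (fact (n - k))))) by (field; lra).
    replace ((rho / gam) ^ k * (C * X * weight i mu gam n))
      with (C * X * rho ^ k * (weight i mu gam n * (/ gam) ^ k))
      by (unfold Rdiv; rewrite Rpow_mult_distr; ring).
    apply Rmult_le_compat_l; [sign|].
    set (m := Rmax (INR n) (/ mu)).
    assert (Hm : 0 < m) by now apply weight_max_pos.
    apply Rle_trans with (weight i mu gam (n - k) * m ^ k).
    + apply Rmult_le_compat_l; [left; apply weight_pos; lra|].
      apply Rle_div_l; [lra|].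
      apply fact_le_pow_fact; [exact Hk|apply Rmax_l].
    + unfold weight. fold m.
      replace (gam ^ n) with (gam ^ (n - k) * gam ^ k) by (rewrite <- pow_add; f_equal; lia).
      replace (m ^ n) with (m ^ (n - k) * m ^ k) by (rewrite <- pow_add; f_equal; lia).
      rewrite pow_inv. assert (0 < gam ^ k) by sign.
      assert (0 < gam ^ (n - k)) by sign.
      assert (0 < m ^ k) by sign.
      replace (((INR i + INR n) * mu + 1) ^ i * (gam ^ (n - k) * gam ^ k) *
               (m ^ (n - k) * m ^ k) * / gam ^ k)
        with (((INR i + INR n) * mu + 1) ^ i * gam ^ (n - k) * m ^ (n - k) * m ^ k)
        by (field; lra).
      apply Rmult_le_compat_r; [lra|].
      assert (0 < Rmax (INR (n - k)) (/ mu)) by now apply weight_max_pos.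
      pose proof (weight_base_ge_1 i (n - k) mu Hmu).
      apply Rmult_le_compat.
      * sign.
      * sign.
      * apply Rmult_le_compat_r; [lra|]. apply pow_incr.
        pose proof (weight_base_mono i (n - k) n mu Hmu ltac:(lia)). lra.
      * apply pow_incr. pose proof (weight_max_mono (n - k) n mu ltac:(lia)).
        fold m in H6. lra.
  - rewrite <- scal_sum.
    replace (2 * C * X * weight i mu gam n) with (C * X * weight i mu gam n * 2) by ring.
    apply Rmult_le_compat_l; [|now apply geometric_sum_le_2].
    sign.
Qed.

Lemma derivs_bounded_weight_mult (f g : R -> R) (C rho X : R) (i : nat) (mu gam : R) :
  0 <= C -> 0 <= X -> 0 < rho -> 2 * rho <= gam -> 0 < mu ->
  derivs_bounded f (analytic_bound C rho) ->
  derivs_bounded g (fun n => X * weight i mu gam n) ->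
  derivs_bounded (fun y => f y * g y) (fun n => 2 * C * X * weight i mu gam n).
Proof.
  intros HC HX Hr Hg Hmu [Hsf Hf] [Hsg Hg']; split.
  - intros n; now apply smooth_to_mult.
  - intros n x Hx. rewrite Derive_n_mult by auto.
    apply leibniz_weight with rho; auto.
Qed.

(** Over two orders the weight grows by at least [(gam / mu)^2]: this pays for the factor
    [mu^-2] with which the equation expresses [v''] by [v], and leaves [gam^2] to absorb
    the constants. *)
Lemma weight_plus_2 (i n : nat) (mu gam : R) :
  0 < mu -> 0 < gam -> gam ^ 2 * weight i mu gam n <= mu ^ 2 * weight i mu gam (n + 2).
Proof.
  intros Hmu Hg. unfold weight.
  set (m := Rmax (INR n) (/ mu)). set (m2 := Rmax (INR (n + 2)) (/ mu)).
  assert (Hm : 0 < m) by now apply weight_max_pos.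
  assert (Hmm : m <= m2) by (apply weight_max_mono; lia).
  assert (Hm2 : 1 <= mu * m2).
  { rewrite <- (Rinv_r mu) by lra. apply Rmult_le_compat_l; [lra|apply Rmax_r]. }
  rewrite !pow_add.
  pose proof (weight_base_ge_1 i n mu Hmu).
  assert (H1 : ((INR i + INR n) * mu + 1) ^ i <= ((INR i + INR (n + 2)) * mu + 1) ^ i).
  { apply pow_incr. pose proof (weight_base_mono i n (n + 2) mu Hmu ltac:(lia)). lra. }
  assert (H2 : m ^ n <= m2 ^ n * (mu * m2) ^ 2).
  { rewrite <- (Rmult_1_r (m ^ n)). apply Rmult_le_compat; [sign|lra| |].
    - apply pow_incr; lra.
    - now apply pow_R1_Rle. }
  replace (gam ^ 2 * (((INR i + INR n) * mu + 1) ^ i * gam ^ n * m ^ n)) with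
    (gam ^ n * gam ^ 2 * (((INR i + INR n) * mu + 1) ^ i * m ^ n)) by ring.
  replace (mu ^ 2 * (((INR i + INR (n + 2)) * mu + 1) ^ i * (gam ^ n * gam ^ 2) *
     (m2 ^ n * m2 ^ 2))) with
    (gam ^ n * gam ^ 2 *
     (((INR i + INR (n + 2)) * mu + 1) ^ i * (m2 ^ n * (mu * m2) ^ 2))) by ring.
  apply Rmult_le_compat_l; [sign|].
  apply Rmult_le_compat; auto; sign.
Qed.

Lemma pow_1_plus_le_exp (x : R) (n : nat) : 0 <= 1 + x -> (1 + x) ^ n <= exp (INR n * x).
Proof.
  intros Hx. induction n as [|n IH].
  - simpl. rewrite Rmult_0_l, exp_0; lra.
  - rewrite S_INR, Rmult_plus_distr_r, Rmult_1_l, exp_plus, Rmult_comm. simpl.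
    rewrite (Rmult_comm (1 + x)). rewrite (Rmult_comm (exp x)).
    apply Rmult_le_compat; auto; [sign|].
    apply exp_ineq1_le.
Qed.

(** The source [mu^2 u_(i-2)''] of order [i]: the two derivatives are paid for by the two
    additional factors [(i+n) mu + 1], and [(1 + 2/n)^n <= e^2 <= 9] compares
    [max (n+2) (1/mu)] with [max n (1/mu)]. *)
Lemma weight_source (i n : nat) (mu gam : R) :
  0 < mu -> 0 < gam ->
  mu ^ 2 * weight i mu gam (n + 2) <= 9 * gam ^ 2 * weight (i + 2) mu gam n.
Proof.
  intros Hmu Hg. unfold weight.
  set (m := Rmax (INR n) (/ mu)). set (m2 := Rmax (INR (n + 2)) (/ mu)).
  assert (Hm : 0 < m) by now apply weight_max_pos.
  assert (Hm2 : 0 < m2) by now apply weight_max_pos.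
  set (b := (INR i + INR (n + 2)) * mu + 1).
  assert (Hb' : (INR (i + 2) + INR n) * mu + 1 = b).
  { unfold b. rewrite !plus_INR. simpl. ring. }
  assert (Hb : 1 <= b) by (unfold b; now apply weight_base_ge_1).
  rewrite Hb'. rewrite !pow_add.
  assert (H1 : mu * m2 <= b).
  { unfold m2. rewrite <- RmaxRmult by lra. rewrite Rinv_r by lra.
    apply Rmax_lub; [|lra]. unfold b. pose proof (pos_INR i).
    assert (0 <= INR i * mu) by sign. lra. }
  assert (H2 : m2 ^ n <= 9 * m ^ n).
  { destruct n as [|n]; [simpl; lra|].
    assert (Hn : 0 < INR (S n)) by (apply lt_0_INR; lia).
    apply Rle_trans with (((1 + 2 / INR (S n)) * m) ^ S n).
    - apply pow_incr. split; [lra|]. unfold m2. apply Rmax_lub.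
      + rewrite plus_INR. simpl (INR 2).
        apply Rle_trans with ((1 + 2 / INR (S n)) * INR (S n)); [right; field; lra|].
        apply Rmult_le_compat_l; [|apply Rmax_l].
        assert (0 < 2 / INR (S n)) by sign. lra.
      + apply Rle_trans with m; [apply Rmax_r|].
        assert (0 < 2 / INR (S n)) by sign.
        rewrite <- (Rmult_1_l m) at 1. apply Rmult_le_compat_r; lra.
    - rewrite Rpow_mult_distr. apply Rmult_le_compat_r; [sign|].
      assert (0 < 2 / INR (S n)) by sign.
      eapply Rle_trans; [apply pow_1_plus_le_exp; lra|].
      replace (INR (S n) * (2 / INR (S n))) with (1 + 1) by (field; lra).
      rewrite exp_plus. pose proof exp_le_3. pose proof (exp_pos 1).
      replace 9 with (3 * 3) by ring. apply Rmult_le_compat; lra. }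
  replace (mu ^ 2 * (b ^ i * (gam ^ n * gam ^ 2) * (m2 ^ n * m2 ^ 2))) with
    (gam ^ 2 * gam ^ n * b ^ i * (m2 ^ n * (mu * m2) ^ 2)) by ring.
  replace (9 * gam ^ 2 * (b ^ i * b ^ 2 * gam ^ n * m ^ n)) with
    (gam ^ 2 * gam ^ n * b ^ i * (9 * m ^ n * b ^ 2)) by ring.
  apply Rmult_le_compat_l;
    [sign|].
  apply Rmult_le_compat; auto.
  - sign.
  - sign.
  - apply pow_incr. split; [sign|exact H1].
Qed.

(** * Maximum principle and the reaction-diffusion problem *)

Definition clamp (a b x : R) : R := Rmax a (Rmin b x).

Lemma clamp_in (a b x : R) : a <= b -> a <= clamp a b x <= b.
Proof.
  intros H; unfold clamp; split; [apply Rmax_l|].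
  apply Rmax_lub; [exact H|apply Rmin_l].
Qed.

Lemma clamp_id (a b x : R) : a <= x <= b -> clamp a b x = x.
Proof. intros H; unfold clamp. rewrite Rmin_right, Rmax_right; lra. Qed.

Lemma clamp_lipschitz (a b x y : R) : Rabs (clamp a b y - clamp a b x) <= Rabs (y - x).
Proof.
  unfold clamp, Rmax, Rmin.
  destruct (Rle_dec b y), (Rle_dec b x); repeat destruct (Rle_dec a _);
    unfold Rabs; repeat destruct (Rcase_abs _); lra.
Qed.

(** Composing with the projection onto [[a,b]] turns relative continuity into continuity
    on the whole line. *)
Lemma continuous_on_clamp (a b : R) (w : R -> R) :
  a <= b -> continuous_on (fun x => a <= x <= b) w ->
  forall x, continuous (fun y => w (clamp a b y)) x.
Proof.
  intros Hab Hc x P HP.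
  destruct (Hc (clamp a b x) (clamp_in a b x Hab) P HP) as [d Hd].
  exists d. intros y Hy. apply Hd; [|now apply clamp_in].
  eapply Rle_lt_trans; [apply clamp_lipschitz|exact Hy].
Qed.

Lemma interior_max_second_derivative (w : R -> R) (a b x : R) :
  a < x < b -> (forall y, a < y < b -> ex_derive w y) -> ex_derive (Derive w) x ->
  (forall y, a < y < b -> w y <= w x) -> Derive_n w 2 x <= 0.
Proof.
  intros Hx Hw Hw2 Hmax. apply Rnot_lt_le; intros Hpos. simpl in Hpos.
  assert (H0 : Derive w x = 0).
  { pose proof (ex_derive_Reals_0 _ _ (Hw x Hx)) as pr.
    rewrite <- (Derive_Reals w x pr).
    apply (deriv_maximum w a b x pr); [lra|lra|]. intros y Hy1 Hy2; apply Hmax; lra. }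
  assert (Hd : derivable_pt_lim (Derive w) x (Derive (Derive w) x)).
  { apply is_derive_Reals. now apply Derive_correct. }
  change (Derive (fun y => Derive (fun z => w z) y) x)
    with (Derive (Derive w) x) in Hpos.
  destruct (Hd (Derive (Derive w) x) Hpos) as [d Hd'].
  pose proof (cond_pos d) as Hdp.
  set (h := Rmin (d / 2) ((b - x) / 2)).
  assert (Hh : 0 < h) by (apply Rmin_glb_lt; lra).
  assert (Hh1 : h <= d / 2) by apply Rmin_l.
  assert (Hh2 : h <= (b - x) / 2) by apply Rmin_r.
  destruct (MVT_cor2 w (Derive w) x (x + h)) as (c & Hc & Hcx); [lra| |].
  { intros c Hc. apply is_derive_Reals, Derive_correct, Hw. lra. }
  assert (Hwc : Derive w c <= 0).
  { apply Rnot_lt_le; intros Hlt.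
    assert (w (x + h) <= w x) by (apply Hmax; lra).
    assert (0 < Derive w c * (x + h - x)) by sign. lra. }
  specialize (Hd' (c - x) ltac:(lra)).
  replace (x + (c - x)) with c in Hd' by ring.
  rewrite H0, Rminus_0_r in Hd'.
  rewrite Rabs_pos_eq in Hd' by lra. specialize (Hd' ltac:(lra)).
  apply Rabs_def2 in Hd'.
  assert (0 < Derive w c / (c - x)) as Hq by lra.
  apply (Rmult_lt_compat_r (c - x)) in Hq; [|lra].
  unfold Rdiv in Hq. rewrite Rmult_assoc, Rinv_l in Hq by lra. lra.
Qed.

(** Convexity wherever [w] exceeds [B] excludes an interior maximum above [B].  The
    differential equations enter only through this condition, so that bounded intervals
    and the half line are treated alike. *)
Lemma maximum_principle (w : R -> R) (a b B : R) :
  a < b -> continuous_on (fun x => a <= x <= b) w ->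
  (forall x, a < x < b -> ex_derive w x /\ ex_derive (Derive w) x) ->
  (forall x, a < x < b -> B < w x -> 0 < Derive_n w 2 x) ->
  w a <= B -> w b <= B -> forall x, a <= x <= b -> w x <= B.
Proof.
  intros Hab Hc Hd Hpos Ha Hb x Hx.
  destruct (continuity_ab_maj (fun y => w (clamp a b y)) a b) as (m & Hm & Hmab).
  - lra.
  - intros c Hcab. apply continuity_pt_filterlim, (continuous_on_clamp a b w); [lra|exact Hc].
  - assert (Hmax : forall y, a <= y <= b -> w y <= w m).
    { intros y Hy. specialize (Hm y Hy). now rewrite !clamp_id in Hm. }
    apply Rle_trans with (w m); [now apply Hmax|].
    apply Rnot_lt_le; intros Hlt.
    assert (Hmi : a < m < b).
    { split; apply Rnot_le_lt; intros Hle.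
      - replace m with a in Hlt by lra. lra.
      - replace m with b in Hlt by lra. lra. }
    pose proof (Hpos m Hmi Hlt).
    pose proof (interior_max_second_derivative w a b m Hmi
      ltac:(intros; now apply Hd) ltac:(now apply Hd)
      ltac:(intros y Hy; apply Hmax; lra)). lra.
Qed.

(** A mean value of [v'] over a distance [h] is at most [2 V0 / h], and [v'] varies by at
    most [h V2] over that distance. *)
Lemma derivative_interpolation (v : R -> R) (V0 V2 h : R) :
  0 < h <= 1 / 4 ->
  (forall x, I_open x -> ex_derive v x /\ ex_derive (Derive v) x) ->
  (forall x, I_open x -> Rabs (v x) <= V0) ->
  (forall x, I_open x -> Rabs (Derive_n v 2 x) <= V2) ->
  forall x, I_open x -> Rabs (Derive v x) <= 2 * V0 / h + h * V2.
Proof.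
  intros Hh Hd H0 H2 x Hx.
  assert (exists y, I_open y /\ (x < y /\ y - x = h \/ y < x /\ x - y = h)) as (y & Hy & Hyx).
  { destruct Hx as [Hx0 Hx1]. destruct (Rle_dec x (1 / 2)).
    - exists (x + h). split; [split; lra|left; lra].
    - exists (x - h). split; [split; lra|right; lra]. }
  assert (Hsub : forall z, Rmin x y <= z <= Rmax x y -> I_open z).
  { intros z Hz. destruct Hx, Hy. unfold Rmin, Rmax in Hz. destruct (Rle_dec x y); split; lra. }
  assert (HV2 : 0 <= V2) by (eapply Rle_trans; [apply Rabs_pos|now apply (H2 x)]).
  destruct (MVT_gen v x y (Derive v)) as (c & Hc & Hvc).
  { intros z Hz. apply Derive_correct, Hd, Hsub; lra. }
  { intros z Hz. apply continuity_pt_filterlim.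
    apply (ex_derive_continuous_R v z), Hd, Hsub; lra. }
  destruct (MVT_gen (Derive v) x c (Derive_n v 2)) as (e & He & Hve).
  { intros z Hz. apply (Derive_correct (Derive v)). apply Hd, Hsub.
    revert Hz Hc. unfold Rmin, Rmax.
    destruct (Rle_dec x c), (Rle_dec x y); lra. }
  { intros z Hz. apply continuity_pt_filterlim.
    apply (ex_derive_continuous_R (Derive v) z), Hd, Hsub.
    revert Hz Hc. unfold Rmin, Rmax.
    destruct (Rle_dec x c), (Rle_dec x y); lra. }
  assert (HeI : I_open e).
  { apply Hsub. revert He Hc. unfold Rmin, Rmax.
    destruct (Rle_dec x c), (Rle_dec x y); lra. }
  assert (Hxc : Rabs (c - x) <= h).
  { revert Hc. unfold Rmin, Rmax, Rabs.
    destruct (Rle_dec x y), (Rcase_abs (c - x)); lra. }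
  assert (Hyx' : Rabs (y - x) = h).
  { unfold Rabs. destruct (Rcase_abs (y - x)); lra. }
  assert (Hm : Rabs (Derive v c) <= 2 * V0 / h).
  { apply (Rmult_le_reg_r h); [lra|].
    unfold Rdiv; rewrite Rmult_assoc, Rinv_l, Rmult_1_r by lra.
    rewrite <- Hyx', <- Rabs_mult, <- Hvc.
    eapply Rle_trans; [apply Rabs_triang|]. rewrite Rabs_Ropp.
    pose proof (H0 x Hx). pose proof (H0 y Hy). lra. }
  replace (Derive v x) with (Derive v c + - (Derive_n v 2 e * (c - x))) by (rewrite <- Hve; ring).
  eapply Rle_trans; [apply Rabs_triang|]. rewrite Rabs_Ropp, Rabs_mult.
  apply Rplus_le_compat; [exact Hm|]. rewrite Rmult_comm.
  apply Rmult_le_compat; auto using Rabs_pos.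
Qed.

(** Where [v] exceeds [B], the reaction term [c v] dominates the source and forces
    [v'' > 0]; the same applies to [- v]. *)
Lemma reaction_diffusion_sup (c v G : R -> R) (c0 mu B : R) :
  0 < mu -> 0 < c0 -> (forall x, I_open x -> c0 <= c x) ->
  classical I_open I_closed v ->
  (forall x, I_open x -> - mu ^ 2 * Derive_n v 2 x + c x * v x = G x) ->
  0 <= B -> (forall x, I_open x -> Rabs (G x) <= c0 * B) ->
  Rabs (v 0) <= B -> Rabs (v 1) <= B ->
  forall x, I_closed x -> Rabs (v x) <= B.
Proof.
  intros Hmu Hc0 Hc [Hcont Hd] Heq HB HG H0 H1 x Hx.
  assert (Hmu2 : 0 < mu ^ 2) by sign.
  apply Rabs_le_between in H0. apply Rabs_le_between in H1.
  apply Rabs_le_between. split.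
  - cut (- v x <= B); [lra|].
    apply (maximum_principle (fun y => - v y) 0 1); try lra; try exact Hx.
    + intros y Hy. apply (filterlim_comp _ _ _ v Ropp _ _ _ (Hcont y Hy)).
      apply (filterlim_opp (V := R_NormedModule)).
    + intros y Hy. destruct (Hd y Hy) as [Hd1 Hd2]. split.
      * now apply (ex_derive_opp v).
      * apply ex_derive_ext with (fun z => - Derive v z).
        -- intros z. symmetry. apply Derive_opp.
        -- now apply (ex_derive_opp (Derive v)).
    + intros y Hy Hlt. rewrite Derive_n_opp.
      specialize (Heq y Hy). specialize (Hc y Hy). specialize (HG y Hy).
      apply Rabs_le_between in HG.
      assert (c0 * B < c y * - v y).
      { apply Rle_lt_trans with (c y * B); [apply Rmult_le_compat_r; lra|].
        apply Rmult_lt_compat_l; lra. }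
      apply (Rmult_lt_reg_l (mu ^ 2)); [lra|]. lra.
  - apply (maximum_principle v 0 1); try lra; try exact Hx; auto.
    intros y Hy Hlt.
    specialize (Heq y Hy). specialize (Hc y Hy). specialize (HG y Hy).
    apply Rabs_le_between in HG.
    assert (c0 * B < c y * v y).
    { apply Rle_lt_trans with (c y * B); [apply Rmult_le_compat_r; lra|].
      apply Rmult_lt_compat_l; lra. }
    apply (Rmult_lt_reg_l (mu ^ 2)); [lra|]. lra.
Qed.

Definition reaction_const (c0 C : R) : R := (8 + C) * (1 + / c0) + 1.

(** The sup norm is controlled by the maximum principle, the first derivative by
    interpolation at the length scale [mu], and all further derivatives by
    differentiating the equation; the condition on [gam] makes the induction close. *)
Lemma reaction_diffusion_bound (c v G : R -> R) (c0 C rho mu gam Y Z : R) (i : nat) :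
  0 < mu <= 1 -> 0 < c0 -> 0 < C -> 0 < rho -> 1 <= gam -> 2 * rho <= gam ->
  2 * C + 1 <= gam ^ 2 -> 0 <= Y -> 0 <= Z ->
  (forall x, I_open x -> c0 <= c x) ->
  derivs_bounded c (analytic_bound C rho) ->
  derivs_bounded G (fun n => Y * weight i mu gam n) ->
  classical I_open I_closed v ->
  (forall x, I_open x -> - mu ^ 2 * Derive_n v 2 x + c x * v x = G x) ->
  Rabs (v 0) <= Z * weight i mu gam 0 -> Rabs (v 1) <= Z * weight i mu gam 0 ->
  derivs_bounded v (fun n => reaction_const c0 C * (Y + Z) * weight i mu gam n).
Proof.
  intros Hmu Hc0 HC Hr Hg1 Hg2 Hg3 HY HZ Hc Hcb HGb Hv Heq Hv0 Hv1.
  set (E0 := weight i mu gam 0) in *.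
  assert (HE0 : 0 < E0) by (apply weight_pos; lra).
  set (V0 := (1 + / c0) * (Y + Z) * E0).
  set (X := reaction_const c0 C * (Y + Z)).
  assert (Hic : 0 < / c0) by now apply Rinv_0_lt_compat.
  assert (HYZ : 0 <= (Y + Z) * E0) by sign.
  assert (HicYZ : 0 <= / c0 * ((Y + Z) * E0)) by sign.
  assert (HYE : 0 <= Y * E0) by sign.
  assert (HZE : 0 <= Z * E0) by sign.
  assert (HV0 : 0 <= V0) by (unfold V0; lra).
  assert (Hsup : forall x, I_open x -> Rabs (v x) <= V0).
  { intros x [Hx0 Hx1]. apply (reaction_diffusion_sup c v G c0 mu V0); auto; try lra.
    - intros y Hy. eapply Rle_trans; [apply (proj2 HGb 0%nat y Hy)|]. fold E0.
      unfold V0. replace (c0 * ((1 + / c0) * (Y + Z) * E0))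
        with ((c0 + 1) * ((Y + Z) * E0)) by (field; lra).
      assert (0 <= c0 * ((Y + Z) * E0)) by sign. lra.
    - unfold V0; lra.
    - unfold V0; lra.
    - split; lra. }
  assert (Hmu2 : 0 < mu ^ 2) by sign.
  assert (H2 : forall x, I_open x -> Derive_n v 2 x = / mu ^ 2 * (c x * v x) + - / mu ^ 2 * G x).
  { intros x Hx. rewrite <- (Heq x Hx). field. lra. }
  set (V2 := / mu ^ 2 * (C * V0 + Y * E0)).
  assert (HV2 : forall x, I_open x -> Rabs (Derive_n v 2 x) <= V2).
  { intros x Hx. rewrite (H2 x Hx).
    replace (/ mu ^ 2 * (c x * v x) + - / mu ^ 2 * G x)
      with (/ mu ^ 2 * (c x * v x + - G x)) by ring.
    pose proof (Rinv_0_lt_compat _ Hmu2) as Hi. unfold V2.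
    rewrite Rabs_mult, (Rabs_pos_eq (/ mu ^ 2)) by lra.
    apply Rmult_le_compat_l; [lra|].
    eapply Rle_trans; [apply Rabs_triang|]. rewrite Rabs_Ropp, Rabs_mult.
    apply Rplus_le_compat; [|apply (proj2 HGb 0%nat x Hx)].
    apply Rmult_le_compat; auto using Rabs_pos.
    pose proof (proj2 Hcb 0%nat x Hx) as H. unfold analytic_bound in H; simpl in H. lra. }
  assert (HX : 0 <= X).
  { unfold X, reaction_const. repeat apply Rmult_le_pos; try lra.
    assert (0 <= (8 + C) * (1 + / c0)) by sign. lra. }
  assert (HV1 : forall x, I_open x -> Rabs (Derive v x) <= X * weight i mu gam 1).
  { intros x Hx.
    eapply Rle_trans; [apply (derivative_interpolation v V0 V2 (mu / 4)); auto; [lra|]|].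
    { exact (proj2 Hv). }
    apply Rle_trans with (X * (E0 * / mu)).
    - replace (2 * V0 / (mu / 4) + mu / 4 * V2)
        with ((8 * V0 + (C * V0 + Y * E0) / 4) * / mu) by (unfold V2; field; lra).
      rewrite <- Rmult_assoc. apply Rmult_le_compat_r; [sign|].
      replace (X * E0) with ((8 + C) * V0 + (Y + Z) * E0)
        by (unfold X, reaction_const, V0; ring).
      assert (0 <= C * V0) by sign. lra.
    - apply Rmult_le_compat_l; [exact HX|].
      unfold E0. rewrite weight_0. unfold weight. rewrite !pow_1.
      pose proof (pos_INR i). assert (0 <= INR i * mu) by sign.
      apply Rmult_le_compat.
      + sign.
      + sign.
      + rewrite <- (Rmult_1_r ((INR i * mu + 1) ^ i)).
        apply Rmult_le_compat; try lra; [sign|].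
        apply pow_incr. split; [lra|]. simpl (INR 1). lra.
      + apply Rmax_r. }
  assert (HXV0 : V0 <= X * E0).
  { unfold X, reaction_const, V0. rewrite !Rmult_assoc.
    apply Rmult_le_compat_r; [lra|].
    assert (0 <= (7 + C) * (1 + / c0)) by sign. lra. }
  assert (HXY : Y <= X).
  { unfold X, reaction_const.
    assert (0 <= (8 + C) * (1 + / c0) * (Y + Z)) by sign. lra. }
  assert (Hind : forall n, smooth_to (n + 2) v /\
     forall m x, (m < n + 2)%nat -> I_open x -> Rabs (Derive_n v m x) <= X * weight i mu gam m).
  { induction n as [|n [IHs IHb]].
    - split.
      + intros m x Hm Hx. destruct m as [|[|m]]; [| |lia]; simpl.
        * now apply (proj2 Hv).
        * exact (proj2 (proj2 Hv x Hx)).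
      + intros m x Hm Hx. destruct m as [|[|m]]; [| |lia].
        * simpl. fold E0. eapply Rle_trans; [now apply Hsup|exact HXV0].
        * now apply HV1.
    - assert (Hcv : smooth_to (n + 2) (fun y => c y * v y))
        by (apply smooth_to_mult; [apply Hcb|exact IHs]).
      split.
      + apply smooth_to_step.
        * apply smooth_to_le with (n + 2)%nat; [lia|exact IHs].
        * apply smooth_to_ext with (fun x => / mu ^ 2 * (c x * v x) + - / mu ^ 2 * G x).
          -- intros y Hy. now rewrite H2.
          -- apply smooth_to_lin; [|apply HGb].
             apply smooth_to_le with (n + 2)%nat; [lia|exact Hcv].
      + intros m x Hm Hx. destruct (Nat.lt_ge_cases m (n + 2)) as [Hlt|Hge]; [now apply IHb|].
        replace m with (n + 2)%nat by lia.
        rewrite <- Derive_n_comp.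
        rewrite (Derive_n_ext_open _ (fun x => / mu ^ 2 * (c x * v x) + - / mu ^ 2 * G x))
          by auto.
        rewrite Derive_n_lin; [|apply smooth_to_le with (n + 2)%nat; [lia|exact Hcv]
                               |apply HGb|exact Hx].
        rewrite Derive_n_mult; [|apply Hcb
                                |apply smooth_to_le with (n + 2)%nat; [lia|exact IHs]|exact Hx].
        set (L := leibniz _ _ n x).
        assert (HL : Rabs L <= 2 * C * X * weight i mu gam n).
        { apply leibniz_weight with rho; try lra.
          - intros k Hk. now apply Hcb.
          - intros k Hk. apply IHb; [lia|exact Hx]. }
        pose proof (proj2 HGb n x Hx) as HGn. simpl in HGn.
        replace (/ mu ^ 2 * L + - / mu ^ 2 * Derive_n G n x)
          with (/ mu ^ 2 * (L + - Derive_n G n x)) by ring.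
        pose proof (Rinv_0_lt_compat _ Hmu2) as Hi.
        rewrite Rabs_mult, (Rabs_pos_eq (/ mu ^ 2)) by lra.
        apply (Rmult_le_reg_l (mu ^ 2)); [lra|].
        rewrite <- Rmult_assoc, Rinv_r, Rmult_1_l by lra.
        eapply Rle_trans; [apply Rabs_triang|]. rewrite Rabs_Ropp.
        pose proof (weight_plus_2 i n mu gam ltac:(lra) ltac:(lra)) as Hw2.
        pose proof (weight_pos i n mu gam ltac:(lra) ltac:(lra)) as Hw.
        apply Rle_trans with (X * (gam ^ 2 * weight i mu gam n)).
        * assert (Y * weight i mu gam n <= X * weight i mu gam n)
            by (apply Rmult_le_compat_r; lra).
          assert ((2 * C + 1) * (X * weight i mu gam n)
                  <= gam ^ 2 * (X * weight i mu gam n)).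
          { apply Rmult_le_compat_r; [sign|exact Hg3]. }
          lra.
        * apply Rle_trans with (X * (mu ^ 2 * weight i mu gam (n + 2)));
            [apply Rmult_le_compat_l; auto|right; ring]. }
  split.
  - intros n. apply smooth_to_le with (n + 2)%nat; [lia|apply Hind].
  - intros n x Hx. apply (proj2 (Hind n)); [lia|exact Hx].
Qed.

(** * Exponential polynomials *)

(** Coefficients are taken with respect to [x^j / j!], so that differentiation is the
    shift of the coefficient sequence and costs nothing in bounds of the form
    [|p j| <= A s^j]. *)
Definition epoly (p : nat -> R) (d : nat) (x : R) : R :=
  sum_f_R0 (fun j => p j * (x ^ j / INR (fact j))) d.

Definition size_le (n : nat) (p : nat -> R) : Prop := forall j, (n <= j)%nat -> p j = 0.

Definition layer (beta : R) (p : nat -> R) (d : nat) (x : R) : R :=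
  epoly p d x * exp (- beta * x).

(** Coefficients of the derivative of an exponential polynomial. *)
Definition layer_shift (beta : R) (p : nat -> R) (j : nat) : R := p (S j) - beta * p j.

Definition mulx (p : nat -> R) (j : nat) : R := INR j * p (pred j).

Lemma size_le_trans (m n : nat) (p : nat -> R) : (m <= n)%nat -> size_le m p -> size_le n p.
Proof. intros H Hp j Hj. apply Hp. lia. Qed.

Lemma epoly_ext (p q : nat -> R) (d : nat) (x : R) :
  (forall j, (j <= d)%nat -> p j = q j) -> epoly p d x = epoly q d x.
Proof. intros H. apply sum_eq. intros j Hj. now rewrite H. Qed.

Lemma epoly_size (p : nat -> R) (d D : nat) (x : R) :
  size_le (S d) p -> (d <= D)%nat -> epoly p D x = epoly p d x.
Proof.
  intros Hp H. induction H as [|D H IH]; [reflexivity|].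
  unfold epoly in *. rewrite tech5, IH, Hp by lia. ring.
Qed.

Lemma epoly_lin (a b : R) (p q : nat -> R) (d : nat) (x : R) :
  epoly (fun j => a * p j + b * q j) d x = a * epoly p d x + b * epoly q d x.
Proof.
  unfold epoly. rewrite !scal_sum, <- plus_sum. apply sum_eq; intros; ring.
Qed.

Lemma epoly_sum (c : nat -> nat -> R) (n d : nat) (x : R) :
  epoly (fun j => sum_f_R0 (fun k => c k j) n) d x
  = sum_f_R0 (fun k => epoly (c k) d x) n.
Proof.
  induction n as [|n IH]; [reflexivity|]. rewrite (tech5 (fun k => epoly (c k) d x)), <- IH.
  transitivity (1 * epoly (fun j => sum_f_R0 (fun k => c k j) n) d x
                + 1 * epoly (c (S n)) d x); [|ring].
  rewrite <- epoly_lin. apply epoly_ext; intros. rewrite tech5; ring.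
Qed.

Lemma epoly_at_0 (p : nat -> R) (d : nat) : epoly p d 0 = p 0%nat.
Proof.
  unfold epoly. induction d as [|d IH]; [simpl; field|].
  rewrite tech5, IH. rewrite pow_ne_zero by lia. unfold Rdiv; ring.
Qed.

Lemma is_derive_epoly (p : nat -> R) (d : nat) (x : R) :
  is_derive (epoly p (S d)) x (epoly (fun j => p (S j)) d x).
Proof.
  induction d as [|d IH].
  - unfold epoly; simpl. auto_derive; [exact I|]. field.
  - apply (is_derive_ext (fun y => epoly p (S d) y
             + p (S (S d)) * (y ^ S (S d) / INR (fact (S (S d)))))).
    { intros t. unfold epoly. now rewrite (tech5 _ (S d)). }
    unfold epoly at 2. rewrite tech5.
    apply (is_derive_plus (epoly p (S d))); [exact IH|].
    apply is_derive_scal.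
    apply (is_derive_ext (fun y => / INR (fact (S (S d))) * y ^ S (S d)));
      [intros; apply Rmult_comm|].
    replace (x ^ S d / INR (fact (S d)))
      with (/ INR (fact (S (S d))) * (INR (S (S d)) * 1 * x ^ pred (S (S d)))).
    + apply is_derive_scal. apply is_derive_pow. apply (is_derive_id (K := R_AbsRing)).
    + rewrite INR_fact_S. pose proof (INR_fact_pos (S d)).
      pose proof (lt_0_INR (S (S d)) ltac:(lia)). simpl pred. field. lra.
Qed.

Lemma is_derive_layer (beta : R) (p : nat -> R) (d : nat) (x : R) :
  size_le (S d) p ->
  is_derive (layer beta p d) x (layer beta (layer_shift beta p) d x).
Proof.
  intros Hp. unfold layer.
  replace (epoly (layer_shift beta p) d x * exp (- beta * x)) with
    (epoly (fun j => p (S j)) d x * exp (- beta * x)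
     + epoly p d x * (- beta * exp (- beta * x))).
  - apply (is_derive_mult (K := R_AbsRing) (epoly p d) (fun y => exp (- beta * y)));
      [| |apply Rmult_comm].
    + apply (is_derive_ext (epoly p (S d))).
      * intros t. apply epoly_size; [exact Hp|lia].
      * apply is_derive_epoly.
    + auto_derive; [exact I|]. ring.
  - rewrite (epoly_ext (layer_shift beta p) (fun j => 1 * p (S j) + (- beta) * p j))
      by (intros; unfold layer_shift; ring).
    rewrite (epoly_lin 1 (- beta) (fun j => p (S j)) p). ring.
Qed.

Lemma size_le_layer_shift (beta : R) (n : nat) (p : nat -> R) :
  size_le n p -> size_le n (layer_shift beta p).
Proof. intros Hp j Hj. unfold layer_shift. rewrite !Hp by lia. ring. Qed.

Lemma Derive_layer (beta : R) (p : nat -> R) (d : nat) (x : R) :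
  size_le (S d) p -> Derive (layer beta p d) x = layer beta (layer_shift beta p) d x.
Proof. intros Hp. now apply is_derive_unique, is_derive_layer. Qed.

Lemma Derive_2_layer (beta : R) (p : nat -> R) (d : nat) (x : R) :
  size_le (S d) p ->
  Derive_n (layer beta p d) 2 x
  = layer beta (layer_shift beta (layer_shift beta p)) d x.
Proof.
  intros Hp. simpl. rewrite (Derive_ext _ (layer beta (layer_shift beta p) d)).
  - now apply Derive_layer, size_le_layer_shift.
  - intros t. now apply Derive_layer.
Qed.

Lemma classical_layer (beta : R) (p : nat -> R) (d : nat) (Do Dc : R -> Prop) :
  size_le (S d) p -> classical Do Dc (layer beta p d).
Proof.
  intros Hp. assert (Hd : forall x, ex_derive (layer beta p d) x)
    by (intros x; eexists; now apply is_derive_layer).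
  split.
  - apply (continuous_on_of_continuous Dc (layer beta p d)). intros x _.
    exact (ex_derive_continuous_R _ x (Hd x)).
  - intros x _. split; [apply Hd|].
    apply ex_derive_ext with (layer beta (layer_shift beta p) d).
    + intros t. now rewrite Derive_layer.
    + eexists. now apply is_derive_layer, size_le_layer_shift.
Qed.

Lemma epoly_mulx (p : nat -> R) (D : nat) (x : R) :
  size_le D p -> x * epoly p D x = epoly (mulx p) D x.
Proof.
  intros Hp. destruct D as [|D].
  - unfold epoly, mulx; simpl. rewrite Hp by lia. ring.
  - rewrite (epoly_size p D) by (auto; lia).
    unfold epoly. rewrite (sum_first (fun j => mulx p j * _)). unfold mulx at 1. simpl (INR 0).
    rewrite !Rmult_0_l, Rplus_0_l, scal_sum. apply sum_eq; intros j Hj.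
    unfold mulx. simpl pred. rewrite INR_fact_S. simpl (x ^ S j).
    pose proof (INR_fact_pos j). pose proof (lt_0_INR (S j) ltac:(lia)). field. lra.
Qed.

Lemma size_le_mulx (n : nat) (p : nat -> R) : size_le n p -> size_le (S n) (mulx p).
Proof. intros Hp j Hj. unfold mulx. rewrite Hp by lia. ring. Qed.

Lemma size_le_mulx_iter (n k : nat) (p : nat -> R) :
  size_le n p -> size_le (n + k) (Nat.iter k mulx p).
Proof.
  intros Hp. induction k as [|k IH]; simpl; [now rewrite Nat.add_0_r|].
  rewrite Nat.add_succ_r. now apply size_le_mulx.
Qed.

Lemma epoly_mulx_iter (p : nat -> R) (n D k : nat) (x : R) :
  size_le n p -> (n + k <= S D)%nat ->
  x ^ k * epoly p D x = epoly (Nat.iter k mulx p) D x.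
Proof.
  intros Hp. induction k as [|k IH]; intros HD; [simpl; ring|].
  simpl. rewrite <- epoly_mulx, <- IH.
  - ring.
  - lia.
  - apply size_le_trans with (n + k)%nat; [lia|]. now apply size_le_mulx_iter.
Qed.

(** The entries of a sequence of size at most [D + 1] have index at most [D], so each of the
    [k] multiplications by [x] contributes at most [D / s]. *)
Lemma mulx_iter_bound (p : nat -> R) (n D k : nat) (A s : R) :
  0 <= A -> 0 < s -> size_le n p -> (n + k <= S D)%nat ->
  (forall j, Rabs (p j) <= A * s ^ j) ->
  forall j, Rabs (Nat.iter k mulx p j) <= (INR D / s) ^ k * A * s ^ j.
Proof.
  intros HA Hs Hp HD Hb. induction k as [|k IH]; intros j.
  - simpl. rewrite Rmult_1_l. apply Hb.
  - specialize (IH ltac:(lia)). simpl. unfold mulx at 1.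
    assert (HDs : 0 <= INR D / s) by sign.
    assert (0 <= (INR D / s) ^ k) by sign.
    assert (Hsj : 0 <= s ^ j) by sign.
    destruct j as [|j'].
    + simpl (INR 0). rewrite Rmult_0_l, Rabs_R0.
      apply Rmult_le_pos; [|exact Hsj]. apply Rmult_le_pos; [|exact HA].
      now apply Rmult_le_pos.
    + simpl pred. destruct (Nat.lt_ge_cases j' (n + k)) as [Hj|Hj].
      * rewrite Rabs_mult, Rabs_pos_eq by apply pos_INR.
        apply Rle_trans with (INR D * ((INR D / s) ^ k * A * s ^ j')).
        -- apply Rmult_le_compat; auto using pos_INR, Rabs_pos. apply le_INR; lia.
        -- right. simpl. field. lra.
      * rewrite (size_le_mulx_iter n k p Hp) by lia.
        rewrite Rmult_0_r, Rabs_R0.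
        apply Rmult_le_pos; [|exact Hsj]. apply Rmult_le_pos; [|exact HA].
      now apply Rmult_le_pos.
Qed.

(** Inverting [lambda - d/dx] on polynomials is a downward recursion in the coefficients;
    no power of [j] is lost, because [lambda > s] makes the recursion a contraction in the
    weights [s^j]. *)
Lemma resolvent (lambda s : R) (n : nat) :
  0 < s < lambda -> forall (rho : nat -> R) (E : R), 0 <= E ->
  size_le n rho -> (forall j, Rabs (rho j) <= E * s ^ j) ->
  exists w, size_le n w /\ (forall j, Rabs (w j) <= E / (lambda - s) * s ^ j) /\
    forall j, lambda * w j - w (S j) = rho j.
Proof.
  intros Hs. assert (Hls : 0 < lambda - s) by lra.
  induction n as [|n IH]; intros rho E HE Hsz Hb.
  - exists (fun _ => 0). split; [intros j _; reflexivity|split].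
    + intros j. rewrite Rabs_R0. apply Rmult_le_pos; [|sign].
      sign.
    + intros j. rewrite Hsz by lia. ring.
  - destruct (IH (fun j => rho (S j)) (E * s)) as (w & Hw1 & Hw2 & Hw3).
    + sign.
    + intros j Hj. apply Hsz; lia.
    + intros j. rewrite Rmult_assoc. apply (Hb (S j)).
    + exists (fun j => match j with O => (w O + rho O) / lambda | S j => w j end).
      split; [|split].
      * intros [|j] Hj; [lia|]. apply Hw1; lia.
      * intros [|j].
        -- specialize (Hw2 O). specialize (Hb O). simpl in *. rewrite Rmult_1_r in *.
           unfold Rdiv at 1. rewrite Rabs_mult, (Rabs_pos_eq (/ lambda)) by sign.
           apply Rle_div_l; [lra|].
           eapply Rle_trans; [apply Rabs_triang|].
           apply Rle_trans with (E * s / (lambda - s) + E); [lra|]. right; field; lra.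
        -- eapply Rle_trans; [apply Hw2|]. right. simpl. field. lra.
      * intros [|j].
        -- field. lra.
        -- apply Hw3.
Qed.

Lemma layer_bound_half_line (beta s A : R) (p : nat -> R) (d : nat) (x : R) :
  0 <= A -> 0 < s -> (forall j, Rabs (p j) <= A * s ^ j) -> 0 <= x ->
  Rabs (layer beta p d x) <= A * exp (- (beta - s) * x).
Proof.
  intros HA Hs Hb Hx. unfold layer.
  rewrite Rabs_mult, (Rabs_pos_eq (exp _)) by sign.
  replace (- (beta - s) * x) with (s * x + - beta * x) by ring.
  rewrite exp_plus, <- Rmult_assoc.
  apply Rmult_le_compat_r; [sign|].
  apply Rle_trans with (A * sum_f_R0 (fun k => (s * x) ^ k / INR (fact k)) d).
  - unfold epoly. eapply Rle_trans; [apply Rsum_abs|]. rewrite scal_sum.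
    apply sum_Rle; intros j Hj. pose proof (INR_fact_pos j).
    assert (Hxj : 0 <= x ^ j / INR (fact j)).
    { sign. }
    rewrite Rabs_mult, (Rabs_pos_eq (_ / _)) by exact Hxj.
    apply Rle_trans with (A * s ^ j * (x ^ j / INR (fact j))).
    + now apply Rmult_le_compat_r.
    + right. rewrite Rpow_mult_distr. field. lra.
  - apply Rmult_le_compat_l; [exact HA|]. apply exp_ge_taylor.
    sign.
Qed.

Lemma is_lim_layer (beta s A : R) (p : nat -> R) (d : nat) :
  0 <= A -> 0 < s < beta -> (forall j, Rabs (p j) <= A * s ^ j) ->
  is_lim (layer beta p d) p_infty 0.
Proof.
  intros HA Hs Hb. apply is_lim_spec. intros eps. simpl.
  pose proof (cond_pos eps) as He.
  exists (A / ((beta - s) * eps)). intros x Hx.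
  assert (H0 : 0 <= A / ((beta - s) * eps)).
  { sign. }
  rewrite Rminus_0_r.
  eapply Rle_lt_trans; [apply (layer_bound_half_line beta s A); auto; lra|].
  rewrite Ropp_mult_distr_l_reverse, exp_Ropp.
  pose proof (exp_ineq1_le ((beta - s) * x)) as Hexp.
  pose proof (exp_pos ((beta - s) * x)) as Hep.
  apply (Rmult_lt_reg_r (exp ((beta - s) * x))); [exact Hep|].
  rewrite Rmult_assoc, Rinv_l, Rmult_1_r by lra.
  apply Rlt_trans with (eps * ((beta - s) * x)).
  - apply (Rmult_lt_compat_r ((beta - s) * eps)) in Hx; [|sign].
    unfold Rdiv in Hx. rewrite Rmult_assoc, Rinv_l, Rmult_1_r in Hx; [lra|].
    apply Rgt_not_eq, Rmult_lt_0_compat; lra.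
  - apply Rmult_lt_compat_l; lra.
Qed.

(** * Uniqueness of decaying solutions *)

Lemma classical_minus (Do Dc : R -> Prop) (w y : R -> R) :
  (forall x, Do x -> locally x Do) ->
  classical Do Dc w -> classical Do Dc y ->
  classical Do Dc (fun x => w x - y x) /\
  forall x, Do x -> Derive_n (fun x => w x - y x) 2 x = Derive_n w 2 x - Derive_n y 2 x.
Proof.
  intros Hop [Hcw Hdw] [Hcy Hdy].
  assert (H1 : forall x, Do x -> locally x (fun t =>
            Derive w t - Derive y t = Derive (fun x => w x - y x) t)).
  { intros x Hx. generalize (Hop x Hx). apply filter_imp. intros t Ht.
    symmetry. apply Derive_minus; [now apply Hdw|now apply Hdy]. }
  split; [split|].
  - intros x Hx. eapply (filterlim_comp_2 w (fun t => - y t) Rplus).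
    + exact (Hcw x Hx).
    + eapply filterlim_comp; [exact (Hcy x Hx)|apply (filterlim_opp (V := R_NormedModule))].
    + apply (filterlim_plus (V := R_NormedModule)).
  - intros x Hx. split.
    + apply (ex_derive_minus w y); [now apply Hdw|now apply Hdy].
    + apply ex_derive_ext_loc with (fun t => Derive w t - Derive y t); [now apply H1|].
      apply (ex_derive_minus (Derive w) (Derive y)); [now apply Hdw|now apply Hdy].
  - intros x Hx. simpl.
    rewrite (Derive_ext_loc _ (fun t => Derive w t - Derive y t)).
    + apply (Derive_minus (Derive w) (Derive y)); [now apply Hdw|now apply Hdy].
    + generalize (H1 x Hx). apply filter_imp. intros; now symmetry.
Qed.

Lemma halfline_open_locally (x : R) : halfline_open x -> locally x halfline_open.
Proof. intros Hx. now apply open_gt. Qed.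

(** A positive value would exceed both boundary values on a long interval, against the
    maximum principle. *)
Lemma decaying_reaction_le (d : R -> R) (beta : R) :
  0 < beta -> classical halfline_open halfline_closed d ->
  (forall x, halfline_open x -> Derive_n d 2 x = beta ^ 2 * d x) ->
  d 0 = 0 -> is_lim d p_infty 0 -> forall x, 0 <= x -> d x <= 0.
Proof.
  intros Hb [Hc Hd] Heq H0 Hlim x Hx.
  apply Rnot_lt_le; intros Hpos.
  apply is_lim_spec in Hlim.
  destruct (Hlim (mkposreal _ Hpos)) as [M HM]. simpl in HM.
  set (X := Rmax x M + 1).
  assert (x <= Rmax x M) by apply Rmax_l. assert (M <= Rmax x M) by apply Rmax_r.
  (* [B] bounds [d] at both ends of [[0,X]] and lies below [d x] *)
  set (B := Rmax 0 (d X)).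
  assert (HX : d X < d x).
  { specialize (HM X ltac:(unfold X; lra)). apply Rabs_def2 in HM. lra. }
  assert (d x <= B).
  { apply (maximum_principle d 0 X).
    - unfold X; lra.
    - intros t Ht P HP. destruct (Hc t (proj1 Ht) P HP) as [e He].
      exists e. intros y Hy Hy2. apply He; [exact Hy|apply Hy2].
    - intros t Ht. apply Hd, Ht.
    - intros t Ht Hlt. rewrite Heq by apply Ht.
      apply Rmult_lt_0_compat; [sign|].
      eapply Rle_lt_trans; [apply Rmax_l|exact Hlt].
    - rewrite H0. apply Rmax_l.
    - apply Rmax_r.
    - unfold X; lra. }
  unfold B, Rmax in *. destruct (Rle_dec 0 (d X)); lra.
Qed.

Lemma decaying_reaction_unique (w y : R -> R) (beta : R) :
  0 < beta -> classical halfline_open halfline_closed w ->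
  classical halfline_open halfline_closed y ->
  (forall x, halfline_open x ->
     Derive_n w 2 x - Derive_n y 2 x = beta ^ 2 * (w x - y x)) ->
  w 0 = y 0 -> is_lim w p_infty 0 -> is_lim y p_infty 0 ->
  forall x, 0 <= x -> w x = y x.
Proof.
  intros Hb Hw Hy Heq H0 Hlw Hly x Hx.
  assert (Hgen : forall w y, classical halfline_open halfline_closed w ->
     classical halfline_open halfline_closed y ->
     (forall x, halfline_open x ->
        Derive_n w 2 x - Derive_n y 2 x = beta ^ 2 * (w x - y x)) ->
     w 0 = y 0 -> is_lim w p_infty 0 -> is_lim y p_infty 0 -> w x - y x <= 0).
  { clear - Hb Hx. intros w y Hw Hy Heq H0 Hlw Hly.
    destruct (classical_minus _ _ w y halfline_open_locally Hw Hy) as [Hc Hd2].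
    apply (decaying_reaction_le (fun x => w x - y x) beta); auto.
    - intros t Ht. rewrite Hd2 by exact Ht. now apply Heq.
    - rewrite H0. ring.
    - rewrite <- (Rminus_diag 0). now apply is_lim_minus'. }
  pose proof (Hgen w y Hw Hy Heq H0 Hlw Hly).
  assert (y x - w x <= 0); [|lra].
  apply Hgen; auto. intros t Ht. specialize (Heq t Ht). lra.
Qed.

(** A function with vanishing second derivative is affine, and an affine function that
    tends to zero at infinity is zero. *)
Lemma decaying_free_unique (w y : R -> R) :
  classical halfline_open halfline_closed w ->
  classical halfline_open halfline_closed y ->
  (forall x, halfline_open x -> Derive_n w 2 x = Derive_n y 2 x) ->
  is_lim w p_infty 0 -> is_lim y p_infty 0 ->
  forall x, 0 <= x -> w x = y x.
Proof.
  intros Hw Hy Heq Hlw Hly.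
  destruct (classical_minus _ _ w y halfline_open_locally Hw Hy) as [[Hc Hd] Hd2].
  set (d := fun x => w x - y x) in *.
  assert (Hlim : is_lim d p_infty 0).
  { rewrite <- (Rminus_diag 0). now apply is_lim_minus'. }
  apply is_lim_spec in Hlim.
  assert (Hcont : forall t, 0 < t -> continuity_pt d t).
  { intros t Ht. apply continuity_pt_filterlim.
    apply (ex_derive_continuous_R d t), Hd, Ht. }
  assert (Haff : forall t, 0 < t -> d t - d 1 = Derive d 1 * (t - 1)).
  { intros t Ht.
    assert (Hmin : 0 < Rmin 1 t) by (apply Rmin_glb_lt; lra).
    destruct (MVT_gen d 1 t (Derive d)) as (c & Hcc & Hdc).
    { intros z Hz. apply Derive_correct, Hd. unfold halfline_open; lra. }
    { intros z Hz. apply Hcont; lra. }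
    destruct (MVT_gen (Derive d) 1 c (Derive_n d 2)) as (e & He & Hde).
    { intros z Hz. apply (Derive_correct (Derive d)), Hd. unfold halfline_open.
      revert Hz Hcc. unfold Rmin, Rmax in *. destruct (Rle_dec 1 c), (Rle_dec 1 t); lra. }
    { intros z Hz. apply continuity_pt_filterlim.
      apply (ex_derive_continuous_R (Derive d) z), Hd.
      unfold halfline_open.
      revert Hz Hcc. unfold Rmin, Rmax in *. destruct (Rle_dec 1 c), (Rle_dec 1 t); lra. }
    assert (He0 : halfline_open e).
    { unfold halfline_open. revert He Hcc. unfold Rmin, Rmax in *.
      destruct (Rle_dec 1 c), (Rle_dec 1 t); lra. }
    rewrite Hd2, Heq in Hde by exact He0.
    rewrite Hdc. f_equal. lra. }
  assert (Hslope : Derive d 1 = 0).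
  { apply NNPP; intros Hne.
    destruct (Hlim (mkposreal 1 Rlt_0_1)) as [M HM]. simpl in HM.
    assert (Ha : 0 < Rabs (Derive d 1)) by now apply Rabs_pos_lt.
    set (q := (Rabs (d 1) + 1) / Rabs (Derive d 1)).
    assert (0 < q).
    { apply Rdiv_lt_0_compat; [|exact Ha]. pose proof (Rabs_pos (d 1)); lra. }
    set (t := Rmax M 1 + 1 + q).
    assert (M <= Rmax M 1) by apply Rmax_l. assert (1 <= Rmax M 1) by apply Rmax_r.
    specialize (HM t ltac:(unfold t; lra)). rewrite Rminus_0_r in HM.
    specialize (Haff t ltac:(unfold t; lra)).
    assert (Hge : Rabs (Derive d 1 * (t - 1)) >= Rabs (d 1) + 1).
    { rewrite Rabs_mult, (Rabs_pos_eq (t - 1)) by (unfold t; lra).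
      apply Rle_ge, Rle_trans with (Rabs (Derive d 1) * q).
      - right. unfold q. field. lra.
      - apply Rmult_le_compat_l; unfold t; lra. }
    rewrite <- Haff in Hge.
    pose proof (Rabs_triang (d t) (- d 1)). rewrite Rabs_Ropp in H2.
    unfold Rminus in Hge. lra. }
  assert (H1 : d 1 = 0).
  { apply NNPP; intros Hne. pose proof (Rabs_pos_lt _ Hne) as Ha.
    destruct (Hlim (mkposreal _ Ha)) as [M HM]. simpl in HM.
    set (t := Rmax M 1 + 1).
    assert (M <= Rmax M 1) by apply Rmax_l. assert (1 <= Rmax M 1) by apply Rmax_r.
    specialize (HM t ltac:(unfold t; lra)). rewrite Rminus_0_r in HM.
    specialize (Haff t ltac:(unfold t; lra)). rewrite Hslope, Rmult_0_l in Haff.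
    replace (d t) with (d 1) in HM by lra. lra. }
  assert (Hopen : forall t, 0 < t -> d t = 0).
  { intros t Ht. specialize (Haff t Ht). rewrite Hslope, H1 in Haff. lra. }
  intros x Hx. cut (d x = 0); [unfold d; lra|].
  destruct Hx as [Hx|<-]; [now apply Hopen|].
  apply NNPP; intros Hne. pose proof (Rabs_pos_lt _ Hne) as Ha.
  destruct (proj1 (filterlim_locally _ _) (Hc 0 (Rle_refl 0)) (mkposreal _ Ha)) as [e He].
  pose proof (cond_pos e) as Hep.
  assert (Hball : ball 0 e (e / 2)).
  { change (Rabs (e / 2 - 0) < e). rewrite Rabs_pos_eq; lra. }
  specialize (He (e / 2) Hball ltac:(unfold halfline_closed; lra)).
  change (Rabs (d (e / 2) - d 0) < Rabs (d 0)) in He.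
  rewrite Hopen, Rminus_0_l, Rabs_Ropp in He by lra. lra.
Qed.

(** * The layer recursion *)

Definition layer_source (mu : R) (b1 b2 : nat -> R) (P Q : nat -> nat -> R) (i j : nat) : R :=
  sum_f_R0 (fun k => mu ^ k * (b1 k * Nat.iter k mulx (P (i - k)%nat) j
                               + b2 k * Nat.iter k mulx (Q (i - k)%nat) j)) i.

(** The value at zero of the final bound, which is of order [(i mu + 1)^i] up to geometric
    factors because [i^(2 i) / i!] is of order [i^i]. *)
Definition layer_weight (Lam mu : R) (i : nat) : R := Lam ^ i * (INR i * mu + 1) ^ i.

Lemma layer_source_correct (beta mu : R) (b1 b2 : nat -> R) (P Q : nat -> nat -> R)
    (U V : nat -> R -> R) (i D : nat) (x : R) :
  (i <= D)%nat ->
  (forall k, (k <= i)%nat -> size_le (S D - k) (P (i - k)%nat)) ->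
  (forall k, (k <= i)%nat -> size_le (S D - k) (Q (i - k)%nat)) ->
  (forall k, (k <= i)%nat -> U (i - k)%nat x = layer beta (P (i - k)%nat) D x) ->
  (forall k, (k <= i)%nat -> V (i - k)%nat x = layer beta (Q (i - k)%nat) D x) ->
  sum_n (fun k => mu ^ k * x ^ k *
           (b1 k * U (i - k)%nat x + b2 k * V (i - k)%nat x)) i
  = layer beta (layer_source mu b1 b2 P Q i) D x.
Proof.
  intros HiD HP HQ HU HV. rewrite sum_n_Reals. unfold layer, layer_source.
  rewrite (epoly_sum (fun k j => mu ^ k * (b1 k * Nat.iter k mulx (P (i - k)%nat) j
                               + b2 k * Nat.iter k mulx (Q (i - k)%nat) j))).
  rewrite (Rmult_comm (sum_f_R0 _ _)), scal_sum. apply sum_eq; intros k Hk.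
  rewrite HU, HV by exact Hk.
  rewrite (epoly_ext _ (fun j => (mu ^ k * b1 k) * Nat.iter k mulx (P (i - k)%nat) j
     + (mu ^ k * b2 k) * Nat.iter k mulx (Q (i - k)%nat) j)) by (intros; ring).
  rewrite epoly_lin.
  rewrite <- (epoly_mulx_iter (P (i - k)%nat) (S D - k)) by (auto; lia).
  rewrite <- (epoly_mulx_iter (Q (i - k)%nat) (S D - k)) by (auto; lia).
  unfold layer. ring.
Qed.

Lemma size_le_layer_source (mu : R) (b1 b2 : nat -> R) (P Q : nat -> nat -> R) (i n : nat) :
  (i <= n)%nat ->
  (forall k, (k <= i)%nat -> size_le (n - k) (P (i - k)%nat)) ->
  (forall k, (k <= i)%nat -> size_le (n - k) (Q (i - k)%nat)) ->
  size_le n (layer_source mu b1 b2 P Q i).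
Proof.
  intros Hin HP HQ j Hj. unfold layer_source.
  rewrite (sum_eq _ (fun _ => 0)).
  - rewrite sum_cte. ring.
  - intros k Hk.
    rewrite (size_le_mulx_iter (n - k) k (P (i - k)%nat) (HP k Hk)) by lia.
    rewrite (size_le_mulx_iter (n - k) k (Q (i - k)%nat) (HQ k Hk)) by lia.
    ring.
Qed.

Lemma layer_weight_pos (Lam mu : R) (i : nat) :
  0 < Lam -> 0 < mu -> 0 < layer_weight Lam mu i.
Proof.
  intros HL Hmu. unfold layer_weight.
  assert (0 <= INR i * mu) by sign.
  apply Rmult_lt_0_compat; sign.
Qed.

(** Multiplying by [x^k] costs [(2 i / s)^k]; the factor [mu^k] turns this into
    [(i mu + 1)^k], and the lower order [i - k] leaves the small factor [Lam^-k]. *)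
Lemma layer_term_bound (p : nat -> R) (b : R) (i k n : nat) (mu s Lam Gam rho A : R) :
  0 < mu -> 0 < s -> 0 < Lam -> 0 < Gam -> 0 < rho -> 0 <= A -> (k <= i)%nat ->
  Rabs b <= Gam * rho ^ k -> size_le n p -> (n + k <= S (2 * i))%nat ->
  (forall j, Rabs (p j) <= A * layer_weight Lam mu (i - k) * s ^ j) ->
  forall j, Rabs (mu ^ k * (b * Nat.iter k mulx p j))
    <= (2 * rho / (s * Lam)) ^ k * (Gam * A * layer_weight Lam mu i * s ^ j).
Proof.
  intros Hmu Hs HL HG Hr HA Hk Hb Hn Hnk Hp j.
  pose proof (layer_weight_pos Lam mu (i - k) HL Hmu) as HW.
  assert (Hit := mulx_iter_bound p n (2 * i) k (A * layer_weight Lam mu (i - k)) s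
    ltac:(sign) Hs Hn Hnk Hp j).
  assert (Hmuk : 0 < mu ^ k) by sign.
  assert (Hrk : 0 < rho ^ k) by sign.
  assert (Hsj : 0 < s ^ j) by sign.
  rewrite !Rabs_mult, (Rabs_pos_eq (mu ^ k)) by lra.
  apply Rle_trans with (mu ^ k * (Gam * rho ^ k *
    ((INR (2 * i) / s) ^ k * (A * layer_weight Lam mu (i - k)) * s ^ j))).
  { apply Rmult_le_compat_l; [lra|]. apply Rmult_le_compat; auto using Rabs_pos. }
  rewrite mult_INR. simpl (INR 2).
  assert (Hi : 0 <= INR i * mu) by sign.
  replace (mu ^ k * (Gam * rho ^ k *
    (((1 + 1) * INR i / s) ^ k * (A * layer_weight Lam mu (i - k)) * s ^ j)))
    with (Gam * A * s ^ j * ((mu * rho * ((1 + 1) * INR i / s)) ^ k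
            * layer_weight Lam mu (i - k))) by (rewrite !Rpow_mult_distr; ring).
  replace ((2 * rho / (s * Lam)) ^ k * (Gam * A * layer_weight Lam mu i * s ^ j))
    with (Gam * A * s ^ j * ((2 * rho / (s * Lam)) ^ k * layer_weight Lam mu i)) by ring.
  apply Rmult_le_compat_l.
  { sign. }
  replace (mu * rho * ((1 + 1) * INR i / s))
    with (2 * rho / (s * Lam) * (Lam * (INR i * mu))) by (field; lra).
  rewrite Rpow_mult_distr, Rmult_assoc.
  apply Rmult_le_compat_l.
  { sign. }
  unfold layer_weight. rewrite Rpow_mult_distr.
  replace (Lam ^ i) with (Lam ^ k * Lam ^ (i - k)) by (rewrite <- pow_add; f_equal; lia).
  replace ((INR i * mu + 1) ^ i) with ((INR i * mu + 1) ^ k * (INR i * mu + 1) ^ (i - k))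
    by (rewrite <- pow_add; f_equal; lia).
  replace (Lam ^ k * (INR i * mu) ^ k * (Lam ^ (i - k) * (INR (i - k) * mu + 1) ^ (i - k)))
    with (Lam ^ k * Lam ^ (i - k) * ((INR i * mu) ^ k * (INR (i - k) * mu + 1) ^ (i - k)))
    by ring.
  assert (0 <= INR (i - k) * mu) by sign.
  assert (INR (i - k) * mu <= INR i * mu)
    by (apply Rmult_le_compat_r; [lra|apply le_INR; lia]).
  apply Rmult_le_compat_l; [sign|].
  apply Rmult_le_compat; try sign; apply pow_incr; lra.
Qed.

Definition geometric (C rho : R) (b : nat -> R) : Prop :=
  forall k, Rabs (b k) <= C * rho ^ k.

(** The coefficients of lower order contribute geometric series in
    [theta = 2 rho / (s Lam)]; the order [i] of [P], with constant [M0], is kept apart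
    because it enters the first equation only through its left-hand side. *)
Lemma layer_source_bound (b1 b2 : nat -> R) (P Q : nat -> nat -> R) (i : nat)
    (mu s Lam Gam rho M0 M1 M2 theta : R) :
  theta = 2 * rho / (s * Lam) -> theta <= 1 / 2 ->
  0 < mu -> 0 < s -> 0 < Lam -> 0 < Gam -> 0 < rho ->
  0 <= M0 -> 0 <= M1 -> 0 <= M2 ->
  geometric Gam rho b1 -> geometric Gam rho b2 ->
  (forall k, (k <= i)%nat -> size_le (S (2 * i) - k) (P (i - k)%nat)) ->
  (forall k, (k <= i)%nat -> size_le (S (2 * i) - k) (Q (i - k)%nat)) ->
  (forall j, Rabs (P i j) <= M0 * layer_weight Lam mu i * s ^ j) ->
  (forall l j, (l < i)%nat -> Rabs (P l j) <= M1 * layer_weight Lam mu l * s ^ j) ->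
  (forall l j, (l <= i)%nat -> Rabs (Q l j) <= M2 * layer_weight Lam mu l * s ^ j) ->
  forall j, Rabs (layer_source mu b1 b2 P Q i j)
    <= Gam * (M0 + 2 * theta * M1 + 2 * M2) * layer_weight Lam mu i * s ^ j.
Proof.
  intros Ht Ht2 Hmu Hs HL HG Hr HM0 HM1 HM2 Hb1 Hb2 HPs HQs HP0 HP HQ j.
  assert (Ht0 : 0 < theta).
  { rewrite Ht. apply Rdiv_lt_0_compat; [lra|sign]. }
  set (B := Gam * layer_weight Lam mu i * s ^ j).
  assert (HB : 0 <= B).
  { unfold B. pose proof (layer_weight_pos Lam mu i HL Hmu).
    sign. }
  set (c := fun k => match k with O => M0 | S k' => theta ^ k * M1 end).
  unfold layer_source. eapply Rle_trans; [apply Rsum_abs|].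
  apply Rle_trans with (sum_f_R0 (fun k => (c k + theta ^ k * M2) * B) i).
  - apply sum_Rle; intros k Hk. rewrite Rmult_plus_distr_l, Rmult_plus_distr_r.
    eapply Rle_trans; [apply Rabs_triang|]. apply Rplus_le_compat.
    + destruct k as [|k]; simpl c.
      * eapply Rle_trans; [apply (layer_term_bound (P (i - 0)%nat) (b1 0%nat) i 0
          (S (2 * i)) mu s Lam Gam rho M0); auto; try lia|].
        -- specialize (HPs 0%nat Hk). now rewrite Nat.sub_0_r in HPs.
        -- now rewrite Nat.sub_0_r.
        -- right. unfold B. simpl. ring.
      * eapply Rle_trans; [apply (layer_term_bound (P (i - S k)%nat) (b1 (S k)) i (S k)
          (S (2 * i) - S k) mu s Lam Gam rho M1); auto; try lia|].
        -- intros j'. apply HP. lia.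
        -- right. unfold B. rewrite <- Ht. simpl. ring.
    + eapply Rle_trans; [apply (layer_term_bound (Q (i - k)%nat) (b2 k) i k
          (S (2 * i) - k) mu s Lam Gam rho M2); auto; try lia|].
      * intros j'. apply HQ. lia.
      * right. unfold B. rewrite <- Ht. ring.
  - rewrite <- scal_sum, plus_sum.
    replace (Gam * (M0 + 2 * theta * M1 + 2 * M2) * layer_weight Lam mu i * s ^ j)
      with (B * (M0 + 2 * theta * M1 + 2 * M2)) by (unfold B; ring).
    apply Rmult_le_compat_l; [exact HB|].
    assert (H2 : sum_f_R0 (fun k => theta ^ k * M2) i <= 2 * M2).
    { rewrite <- scal_sum, Rmult_comm. apply Rmult_le_compat_r; [exact HM2|].
      apply geometric_sum_le_2; lra. }
    assert (H1 : sum_f_R0 c i <= M0 + 2 * theta * M1); [|lra].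
    assert (0 <= theta * M1) by sign.
    destruct i as [|i]; [simpl; lra|].
    rewrite sum_first. unfold c at 1. apply Rplus_le_compat_l.
    rewrite (sum_eq _ (fun k => theta ^ k * (theta * M1))) by (intros; simpl; ring).
    rewrite <- scal_sum.
    apply Rle_trans with (theta * M1 * 2); [|lra].
    apply Rmult_le_compat_l; [lra|]. apply geometric_sum_le_2; lra.
Qed.

(** [w] equals [p(x) e^(-beta x)] on the closed half line, with a polynomial [p] of degree
    at most [2 l]; the entire extension of [w] is read off from this form. *)
Definition layer_rep (beta s A : R) (l : nat) (w : R -> R) : Prop :=
  exists p, size_le (S (2 * l)) p /\ (forall j, Rabs (p j) <= A * s ^ j) /\
    forall x, 0 <= x -> w x = layer beta p (2 * l) x.

Lemma choice_up_to {A : Type} (n : nat) (R : nat -> A -> Prop) (a : A) :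
  (forall l, (l < n)%nat -> exists p, R l p) ->
  exists P, forall l, (l < n)%nat -> R l (P l).
Proof.
  intros H. apply (functional_choice (fun l p => (l < n)%nat -> R l p)). intros l.
  destruct (Nat.lt_ge_cases l n) as [Hl|Hl].
  - destruct (H l Hl) as [p Hp]. now exists p.
  - exists a. lia.
Qed.

(** Both equations have an exponential polynomial as right-hand side once the preceding
    functions are known.  For [uh i = p e^(-beta x)] the equation reads
    [(2 beta - d/dx) p' = - source], where the source has degree at most [2 i - 1]; the free
    constant [p(0)] is the boundary value.  For [vh (i + 2) = q e^(-beta x)] it reads
    [(beta - d/dx)^2 q = source], which has a unique polynomial solution.  Decaying solutions
    are unique, so these are the given functions.  Lower orders are smaller by
    [theta = 2 rho / (s Lam)] per order, and [vh] enters with two orders less, hence with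
    [N / Lam^2]; for large [Lam] the source of [uh i] is therefore dominated by its boundary value. *)
Lemma layer_step (b11 b12 b21 b22 : nat -> R) (mu beta s Lam Gam rho M N : R)
    (w : nat -> R) (uh vh : nat -> R -> R) (i : nat) :
  0 < mu -> 0 < s -> 2 * s <= beta -> 1 <= Lam -> 0 < Gam -> 0 < rho -> 0 < M ->
  beta ^ 2 = b11 0%nat ->
  2 * rho / (s * Lam) <= 1 / 2 ->
  Gam * (2 * (2 * rho / (s * Lam)) + 2 * (N / Lam ^ 2)) <= s ^ 2 ->
  2 * (2 * rho / (s * Lam)) + 2 * (N / Lam ^ 2) <= 3 ->
  N = 4 * Gam / s ^ 2 ->
  geometric Gam rho b11 -> geometric Gam rho b12 ->
  geometric Gam rho b21 -> geometric Gam rho b22 ->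
  layer_part b11 b12 b21 b22 mu w uh vh ->
  (forall l, (l < i)%nat ->
     layer_rep beta s (M * layer_weight Lam mu l) l (uh l) /\
     layer_rep beta s (N * M * layer_weight Lam mu l) l (vh (l + 2)%nat)) ->
  Rabs (w i) <= M * layer_weight Lam mu i ->
  layer_rep beta s (M * layer_weight Lam mu i) i (uh i) /\
  layer_rep beta s (N * M * layer_weight Lam mu i) i (vh (i + 2)%nat).
Proof.
  intros Hmu Hs Hbeta HL HG Hr HM Hb0 Ht Hc1 Hc2 HN Hb11 Hb12 Hb21 Hb22 [Hv01 Hlp] IH Hw.
  set (theta := 2 * rho / (s * Lam)) in *.
  assert (HN0 : 0 < N) by (rewrite HN; apply Rdiv_lt_0_compat; [lra|sign]).
  assert (HL2 : 0 < Lam ^ 2) by sign.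
  set (M2 := N * M / Lam ^ 2).
  assert (HM2 : 0 <= M2).
  { sign. }
  pose proof (layer_weight_pos Lam mu i ltac:(lra) Hmu) as HWi.
  set (W := layer_weight Lam mu i) in *.
  assert (Hs2 : 0 < s ^ 2) by sign.
  destruct (choice_up_to i (fun l p => size_le (S (2 * l)) p /\
     (forall j, Rabs (p j) <= M * layer_weight Lam mu l * s ^ j) /\
     forall x, 0 <= x -> uh l x = layer beta p (2 * l) x) (fun _ => 0)) as [P HP].
  { intros l Hl. exact (proj1 (IH l Hl)). }
  destruct (choice_up_to (S i) (fun l q => size_le (2 * l) q /\
     (forall j, Rabs (q j) <= M2 * layer_weight Lam mu l * s ^ j) /\
     forall x, 0 <= x -> vh l x = layer beta q (2 * l) x) (fun _ => 0)) as [Q HQ].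
  { assert (Hz : forall l, (forall x, 0 <= x -> vh l x = 0) -> exists q, size_le (2 * l) q /\
     (forall j, Rabs (q j) <= M2 * layer_weight Lam mu l * s ^ j) /\
     forall x, 0 <= x -> vh l x = layer beta q (2 * l) x).
    { intros l Hl. exists (fun _ => 0). split; [|split].
      - intros j _; reflexivity.
      - intros j. rewrite Rabs_R0.
        pose proof (layer_weight_pos Lam mu l ltac:(lra) Hmu).
        sign.
      - intros x Hx. rewrite Hl by exact Hx. unfold layer, epoly.
        rewrite (sum_eq _ (fun _ => 0)) by (intros; ring). rewrite sum_cte. ring. }
    intros [|[|l]] Hl.
    - apply Hz. intros x Hx. now apply Hv01.
    - apply Hz. intros x Hx. now apply Hv01.
    - destruct (proj2 (IH l ltac:(lia))) as (q & Hq1 & Hq2 & Hq3).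
      exists q. split; [|split].
      + apply size_le_trans with (S (2 * l)); [lia|exact Hq1].
      + intros j. eapply Rle_trans; [apply Hq2|].
        apply Rmult_le_compat_r; [sign|].
        unfold M2, layer_weight.
        replace (S (S l)) with (l + 2)%nat by lia. rewrite plus_INR. simpl (INR 2).
        assert (0 <= INR l * mu) by sign.
        rewrite (pow_add Lam).
        replace (N * M / Lam ^ 2 * (Lam ^ l * Lam ^ 2 * ((INR l + (1 + 1)) * mu + 1) ^ (l + 2)))
          with (N * M * (Lam ^ l * ((INR l + (1 + 1)) * mu + 1) ^ (l + 2))) by (field; lra).
        apply Rmult_le_compat_l; [sign|].
        apply Rmult_le_compat_l; [sign|].
        apply Rle_trans with (((INR l + (1 + 1)) * mu + 1) ^ l).
        * apply pow_incr. lra.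
        * apply Rle_pow; [lra|lia].
      + intros x Hx. replace (S (S l)) with (l + 2)%nat by lia. rewrite Hq3 by exact Hx.
        unfold layer. f_equal. symmetry. apply epoly_size; [exact Hq1|lia]. }
  assert (HQlay : forall k x, (k <= i)%nat -> 0 <= x ->
            vh (i - k)%nat x = layer beta (Q (i - k)%nat) (2 * i) x).
  { intros k x Hk Hx. destruct (HQ (i - k)%nat ltac:(lia)) as (Hq1 & _ & Hq3).
    rewrite Hq3 by exact Hx. unfold layer. f_equal. symmetry.
    apply epoly_size; [|lia]. apply size_le_trans with (2 * (i - k))%nat; [lia|exact Hq1]. }
  assert (HQsize : forall k, (k <= i)%nat -> size_le (2 * i - k) (Q (i - k)%nat)).
  { intros k Hk. apply size_le_trans with (2 * (i - k))%nat; [lia|]. apply HQ; lia. }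
  destruct (Hlp i) as [(Hcu & Hequ & Hu0 & Hulim) (Hcv & Heqv & Hvlim)].
  (* in the first equation the term [k = 0] belongs to the left-hand side *)
  set (P' := fun l => if Nat.ltb l i then P l else fun _ => 0).
  assert (HP'lt : forall l, (l < i)%nat -> P' l = P l).
  { intros l Hl. unfold P'. now apply Nat.ltb_lt in Hl as ->. }
  assert (HP'i : P' i = fun _ => 0) by (unfold P'; now rewrite Nat.ltb_irrefl).
  assert (HP'size : forall k, (k <= i)%nat -> size_le (2 * i - k) (P' (i - k)%nat)).
  { intros [|k] Hk.
    - rewrite !Nat.sub_0_r, HP'i. intros j _; reflexivity.
    - rewrite HP'lt by lia. apply size_le_trans with (S (2 * (i - S k))); [lia|].
      apply HP; lia. }
  set (R1 := layer_source mu b11 b12 P' Q i).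
  set (E := s ^ 2 * (M * W)).
  assert (HR1s : size_le (2 * i) R1) by (apply size_le_layer_source; auto; lia).
  assert (HR1b : forall j, Rabs (R1 j) <= E * s ^ j).
  { intros j. eapply Rle_trans.
    - apply (layer_source_bound b11 b12 P' Q i mu s Lam Gam rho 0 M M2 theta); auto; try lra.
      + intros k Hk. apply size_le_trans with (2 * i - k)%nat; [lia|auto].
      + intros k Hk. apply size_le_trans with (2 * i - k)%nat; [lia|auto].
      + intros j'. rewrite HP'i, Rabs_R0, !Rmult_0_l. lra.
      + intros l j' Hl. rewrite HP'lt by exact Hl. now apply HP.
      + intros l j' Hl. apply HQ; lia.
    - apply Rmult_le_compat_r; [sign|]. unfold E. fold W.
      replace (Gam * (0 + 2 * theta * M + 2 * M2) * W)
        with (Gam * (2 * theta + 2 * (N / Lam ^ 2)) * (M * W))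
        by (unfold M2; field; lra).
      apply Rmult_le_compat_r; [sign|exact Hc1]. }
  assert (HE : 0 <= E) by sign.
  destruct (resolvent (2 * beta) s (2 * i) ltac:(lra) (fun j => - R1 j) E HE)
    as (q & Hq1 & Hq2 & Hq3).
  { intros j Hj. rewrite HR1s by exact Hj. ring. }
  { intros j. rewrite Rabs_Ropp. apply HR1b. }
  set (p := fun j => match j with O => - w i | S j' => q j' end).
  assert (Hps : size_le (S (2 * i)) p).
  { intros [|j] Hj; [lia|]. apply Hq1; lia. }
  assert (Hpb : forall j, Rabs (p j) <= M * W * s ^ j).
  { intros [|j]; simpl p.
    - rewrite Rabs_Ropp. simpl. lra.
    - eapply Rle_trans; [apply Hq2|].
      replace (M * W * s ^ S j) with (M * W * s * s ^ j) by (simpl; ring).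
      apply Rmult_le_compat_r; [sign|].
      apply Rle_div_l; [lra|]. unfold E.
      replace (s ^ 2 * (M * W)) with (M * W * s * s) by ring.
      apply Rmult_le_compat_l; [|lra].
      apply Rmult_le_pos; [sign|]; lra. }
  assert (HMW : 0 <= M * W) by sign.
  assert (Hu : forall x, 0 <= x -> uh i x = layer beta p (2 * i) x).
  { apply decaying_reaction_unique with beta; auto; try lra.
    - now apply classical_layer.
    - intros x Hx. assert (Hx0 : 0 <= x) by (unfold halfline_open in Hx; lra).
      rewrite Derive_2_layer by exact Hps.
      assert (Hsrc : Derive_n (uh i) 2 x
                     = beta ^ 2 * uh i x + layer beta R1 (2 * i) x).
      { specialize (Hequ x Hx).
        set (U' := fun l y => if Nat.ltb l i then uh l y else 0).
        assert (Hsum : sum_n (fun k => mu ^ k * x ^ k *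
                   (b11 k * U' (i - k)%nat x + b12 k * vh (i - k)%nat x)) i
                   = layer beta R1 (2 * i) x).
        { apply layer_source_correct; [lia| | | |].
          - intros k Hk. apply size_le_trans with (2 * i - k)%nat; [lia|auto].
          - intros k Hk. apply size_le_trans with (2 * i - k)%nat; [lia|auto].
          - intros k Hk. unfold U', P'. destruct (Nat.ltb (i - k) i) eqn:Hlt.
            + apply Nat.ltb_lt in Hlt. destruct (HP _ Hlt) as (Hp1 & _ & Hp3).
              rewrite Hp3 by exact Hx0. unfold layer. f_equal. symmetry.
              apply epoly_size; [exact Hp1|lia].
            + unfold layer, epoly.
              rewrite (sum_eq _ (fun _ => 0)) by (intros; ring). rewrite sum_cte. ring.
          - intros k Hk. now apply HQlay. }
        assert (Hdiff : sum_n (fun k => mu ^ k * x ^ k *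
                   (b11 k * uh (i - k)%nat x + b12 k * vh (i - k)%nat x)) i
                 = beta ^ 2 * uh i x + layer beta R1 (2 * i) x).
        { rewrite <- Hsum, !sum_n_Reals.
          destruct i as [|i'].
          - unfold U'. simpl. rewrite <- Hb0. ring.
          - rewrite !sum_first. rewrite Nat.sub_0_r. unfold U' at 1.
            rewrite Nat.ltb_irrefl.
            rewrite (sum_eq _ (fun k => mu ^ S k * x ^ S k *
              (b11 (S k) * U' (S i' - S k)%nat x + b12 (S k) * vh (S i' - S k)%nat x))).
            + rewrite !pow_O, <- Hb0. lra.
            + intros k Hk. unfold U'.
              assert ((S i' - S k < S i')%nat) as ->%Nat.ltb_lt by lia. reflexivity. }
        rewrite Hdiff in Hequ. lra. }
      rewrite Hsrc. unfold layer.
      rewrite (epoly_ext (layer_shift beta (layer_shift beta p))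
        (fun j => 1 * R1 j + beta ^ 2 * p j)).
      + rewrite epoly_lin. ring.
      + intros j _. unfold layer_shift.
        specialize (Hq3 j). simpl p. destruct j; simpl p; lra.
    - rewrite Hu0. unfold layer. rewrite epoly_at_0. simpl p.
      rewrite Rmult_0_r, exp_0. ring.
    - apply is_lim_layer with s (M * W); auto. lra. }
  split; [exists p; auto|].
  set (P2 := fun l => if Nat.eqb l i then p else P l).
  assert (HP2i : P2 i = p) by (unfold P2; now rewrite Nat.eqb_refl).
  assert (HP2lt : forall l, (l < i)%nat -> P2 l = P l).
  { intros l Hl. unfold P2. assert (l <> i) as ->%Nat.eqb_neq by lia. reflexivity. }
  assert (HP2 : forall l, (l <= i)%nat -> size_le (S (2 * l)) (P2 l) /\
     forall x, 0 <= x -> uh l x = layer beta (P2 l) (2 * l) x).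
  { intros l Hl. destruct (Nat.eq_dec l i) as [->|Hne].
    - rewrite HP2i. auto.
    - rewrite HP2lt by lia. split; apply HP; lia. }
  set (R2 := layer_source mu b21 b22 P2 Q i).
  assert (HP2size : forall k, (k <= i)%nat -> size_le (S (2 * i) - k) (P2 (i - k)%nat)).
  { intros k Hk. apply size_le_trans with (S (2 * (i - k))); [lia|]. apply HP2; lia. }
  assert (HQsize2 : forall k, (k <= i)%nat -> size_le (S (2 * i) - k) (Q (i - k)%nat)).
  { intros k Hk. apply size_le_trans with (2 * i - k)%nat; [lia|auto]. }
  assert (HR2s : size_le (S (2 * i)) R2) by (apply size_le_layer_source; auto; lia).
  set (E2 := 4 * Gam * (M * W)).
  assert (HE2 : 0 <= E2) by sign.
  assert (HR2b : forall j, Rabs (R2 j) <= E2 * s ^ j).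
  { intros j. eapply Rle_trans.
    - apply (layer_source_bound b21 b22 P2 Q i mu s Lam Gam rho M M M2 theta); auto; try lra.
      + intros j'. rewrite HP2i. apply Hpb.
      + intros l j' Hl. rewrite HP2lt by exact Hl. now apply HP.
      + intros l j' Hl. apply HQ; lia.
    - apply Rmult_le_compat_r; [sign|]. unfold E2. fold W.
      replace (Gam * (M + 2 * theta * M + 2 * M2) * W)
        with (Gam * (1 + (2 * theta + 2 * (N / Lam ^ 2))) * (M * W))
        by (unfold M2; field; lra).
      apply Rmult_le_compat_r; [exact HMW|]. rewrite Rmult_comm.
      apply Rmult_le_compat_r; lra. }

  destruct (resolvent beta s (S (2 * i)) ltac:(lra) R2 E2 HE2 HR2s HR2b)
    as (q1 & Hq11 & Hq12 & Hq13).
  assert (HE3 : 0 <= E2 / (beta - s)).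
  { sign. }
  destruct (resolvent beta s (S (2 * i)) ltac:(lra) q1 _ HE3 Hq11 Hq12)
    as (q2 & Hq21 & Hq22 & Hq23).
  assert (Hq2b : forall j, Rabs (q2 j) <= N * M * W * s ^ j).
  { intros j. eapply Rle_trans; [apply Hq22|].
    apply Rmult_le_compat_r; [sign|].
    apply Rle_div_l; [lra|].
    apply Rle_div_l; [lra|].
    apply Rle_trans with (N * M * W * s * s).
    - right. rewrite HN. unfold E2. field. lra.
    - assert (0 <= N * M * W) by (rewrite Rmult_assoc; sign).
      apply Rmult_le_compat; try lra; [sign|].
      apply Rmult_le_compat_l; lra. }
  exists q2. split; [exact Hq21|split; [exact Hq2b|]].
  apply decaying_free_unique; auto.
  - now apply classical_layer.
  - intros x Hx. assert (Hx0 : 0 <= x) by (unfold halfline_open in Hx; lra).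
    specialize (Heqv x Hx).
    rewrite (layer_source_correct beta mu b21 b22 P2 Q uh vh i (2 * i)) in Heqv; auto; try lia.
    + rewrite Derive_2_layer by exact Hq21. fold R2 in Heqv.
      replace (layer beta (layer_shift beta (layer_shift beta q2)) (2 * i) x)
        with (layer beta R2 (2 * i) x); [lra|].
      unfold layer. f_equal. apply epoly_ext. intros j _.
      pose proof (Hq13 j). pose proof (Hq23 j). pose proof (Hq23 (S j)).
      unfold layer_shift. rewrite <- H, <- H0, <- H1. ring.
    + intros k Hk. rewrite (proj2 (HP2 (i - k)%nat ltac:(lia))) by exact Hx0.
      unfold layer. f_equal. symmetry. apply epoly_size; [|lia]. apply HP2; lia.
  - apply is_lim_layer with s (N * M * W); auto; try lra.
    rewrite Rmult_assoc. sign.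
Qed.

(** * Complex extension of the layer functions *)

Notation ex_derive_C := (ex_derive (K := C_AbsRing) (V := C_NormedModule)).

Lemma ex_derive_C_quadratic (F : C -> C) (z L : C) (B r : R) :
  0 < r ->
  (forall h, Cmod h <= r -> Cmod (F (z + h) - F z - L * h)%C <= B * Cmod h ^ 2) ->
  ex_derive_C F z.
Proof.
  intros Hr HB. exists L. split; [apply is_linear_scal_l|].
  intros y Hy.
  apply (is_filter_lim_locally_unique (K := C_AbsRing) (V := AbsRing_NormedModule C_AbsRing))
    in Hy. subst y.
  intros eps. pose proof (cond_pos eps) as Heps.
  pose proof (Rabs_pos B) as HB0.
  set (d := Rmin r (eps / (Rabs B + 1))).
  assert (Hd : 0 < d) by (apply Rmin_glb_lt; [lra|sign]).
  exists (mkposreal _ Hd). intros y Hy. change (Cmod (y - z) < d) in Hy.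
  change (Cmod (F y - F z - (y - z) * L)%C <= eps * Cmod (y - z)%C).
  set (h := (y - z)%C) in *.
  assert (Hyz : y = (z + h)%C).
  { assert (Hring : forall a b : C, a = (b + (a - b))%C) by (intros; ring). apply Hring. }
  rewrite Hyz, (Cmult_comm h).
  assert (d <= r) by apply Rmin_l. assert (d <= eps / (Rabs B + 1)) by apply Rmin_r.
  eapply Rle_trans; [apply HB; lra|].
  pose proof (Cmod_ge_0 h).
  replace (B * Cmod h ^ 2) with (B * Cmod h * Cmod h) by ring.
  apply Rmult_le_compat_r; [lra|].
  apply Rle_trans with ((Rabs B + 1) * Cmod h).
  - apply Rmult_le_compat_r; [lra|]. pose proof (Rle_abs B). lra.
  - apply Rle_trans with ((Rabs B + 1) * (eps / (Rabs B + 1))).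
    + apply Rmult_le_compat_l; lra.
    + right; field; lra.
Qed.

(** The two normed-module structures on the complex numbers have the same norm and
    operations, hence the same derivatives. *)
Lemma is_derive_C_regular (F : C -> C) (z l : C) :
  is_derive (K := C_AbsRing) (V := C_NormedModule) F z l <->
  is_derive (K := C_AbsRing) (V := AbsRing_NormedModule C_AbsRing) F z l.
Proof.
  split; intros [_ H]; (split; [apply is_linear_scal_l|exact H]).
Qed.

Lemma ex_derive_C_mult (F G : C -> C) (z : C) :
  ex_derive_C F z -> ex_derive_C G z -> ex_derive_C (fun y => (F y * G y)%C) z.
Proof.
  intros [df Hf] [dg Hg].
  apply is_derive_C_regular in Hf. apply is_derive_C_regular in Hg.
  eexists. apply is_derive_C_regular.
  apply (is_derive_mult (K := C_AbsRing) F G z df dg Hf Hg). apply Cmult_comm.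
Qed.

Lemma ex_derive_C_pow (n : nat) (z : C) : ex_derive_C (fun y => (y ^ n)%C) z.
Proof.
  induction n as [|n IH].
  - apply (ex_derive_const (K := C_AbsRing) (V := C_NormedModule) (RtoC 1)).
  - apply (ex_derive_C_mult (fun y => y) (fun y => (y ^ n)%C)); [|exact IH].
    eexists. apply is_derive_C_regular. apply (is_derive_id (K := C_AbsRing)).
Qed.

Definition Cepoly (p : nat -> R) (d : nat) (z : C) : C :=
  sum_n (fun j => (RtoC (p j / INR (fact j)) * z ^ j)%C) d.

Lemma ex_derive_Cepoly (p : nat -> R) (d : nat) (z : C) : ex_derive_C (Cepoly p d) z.
Proof.
  assert (Hterm : forall j, ex_derive_C (fun y => (RtoC (p j / INR (fact j)) * y ^ j)%C) z).
  { intros j. apply ex_derive_C_mult; [|apply ex_derive_C_pow].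
    apply (ex_derive_const (K := C_AbsRing) (V := C_NormedModule)). }
  induction d as [|d IH].
  - apply (ex_derive_ext (K := C_AbsRing) (V := C_NormedModule)
      (fun y => (RtoC (p 0%nat / INR (fact 0)) * y ^ 0)%C)); [|apply Hterm].
    intros t. unfold Cepoly. now rewrite sum_O.
  - apply (ex_derive_ext (K := C_AbsRing) (V := C_NormedModule)
      (fun y => plus (Cepoly p d y) (RtoC (p (S d) / INR (fact (S d))) * y ^ S d)%C)).
    + intros t. unfold Cepoly. now rewrite sum_Sn.
    + apply (ex_derive_plus (K := C_AbsRing) (V := C_NormedModule)); [exact IH|apply Hterm].
Qed.

Lemma Cepoly_real (p : nat -> R) (d : nat) (x : R) :
  Cepoly p d (RtoC x) = RtoC (epoly p d x).
Proof.
  unfold Cepoly, epoly. induction d as [|d IH].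
  - rewrite sum_O. simpl. rewrite <- RtoC_mult. f_equal. field.
  - rewrite sum_Sn, IH, tech5. change (plus ?a ?b) with (a + b)%C.
    rewrite RtoC_plus. f_equal. rewrite <- RtoC_pow, <- RtoC_mult. f_equal.
    unfold Rdiv; ring.
Qed.

Lemma Cmod_Cepoly (p : nat -> R) (d : nat) (z : C) (A s : R) :
  (forall j, Rabs (p j) <= A * s ^ j) ->
  Cmod (Cepoly p d z) <= A * sum_f_R0 (fun j => (s * Cmod z) ^ j / INR (fact j)) d.
Proof.
  intros Hb.
  assert (Hterm : forall j, Cmod (RtoC (p j / INR (fact j)) * z ^ j)%C
                            <= A * ((s * Cmod z) ^ j / INR (fact j))).
  { intros j. rewrite Cmod_mult, Cmod_R, Cmod_pow, Rpow_mult_distr.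
    pose proof (INR_fact_pos j). pose proof (Cmod_ge_0 z).
    unfold Rdiv at 1. rewrite Rabs_mult, (Rabs_pos_eq (/ _)) by sign.
    apply Rle_trans with (A * s ^ j * / INR (fact j) * Cmod z ^ j).
    - apply Rmult_le_compat_r; [sign|].
      apply Rmult_le_compat_r; [sign|apply Hb].
    - right. field. lra. }
  unfold Cepoly. induction d as [|d IH].
  - rewrite sum_O. apply Hterm.
  - rewrite sum_Sn, tech5, Rmult_plus_distr_l.
    eapply Rle_trans; [apply Cmod_triangle|]. now apply Rplus_le_compat.
Qed.

(** The complex exponential [e^(-beta z)]. *)
Definition Cexp_decay (beta : R) (z : C) : C :=
  (exp (- beta * Re z) * cos (- beta * Im z), exp (- beta * Re z) * sin (- beta * Im z)).

Lemma Cexp_decay_plus (beta : R) (z h : C) :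
  Cexp_decay beta (z + h) = (Cexp_decay beta z * Cexp_decay beta h)%C.
Proof.
  unfold Cexp_decay, Cmult, Cplus, Re, Im; simpl.
  rewrite !Rmult_plus_distr_l, exp_plus, cos_plus, sin_plus. f_equal; ring.
Qed.

Lemma Cmod_Cexp_decay (beta : R) (z : C) : Cmod (Cexp_decay beta z) = exp (- beta * Re z).
Proof.
  unfold Cexp_decay, Cmod; simpl.
  transitivity (sqrt (Rsqr (exp (- beta * Re z))));
    [f_equal|apply sqrt_Rsqr; left; apply exp_pos].
  transitivity (Rsqr (exp (- beta * Re z)) *
    (Rsqr (sin (- beta * Im z)) + Rsqr (cos (- beta * Im z)))).
  - unfold Rsqr; ring.
  - rewrite sin2_cos2. ring.
Qed.

Lemma exp_quadratic (x : R) : Rabs x <= 1 / 2 -> Rabs (exp x - 1 - x) <= 2 * x ^ 2.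
Proof.
  intros Hx. apply Rabs_le_between in Hx.
  pose proof (exp_ineq1_le x). pose proof (exp_ineq1_le (- x)). rewrite exp_Ropp in H0.
  pose proof (exp_pos x).
  assert (Hup : exp x * (1 - x) <= 1).
  { apply Rle_trans with (exp x * / exp x); [|right; field; lra].
    apply Rmult_le_compat_l; lra. }
  rewrite Rabs_pos_eq by lra.
  apply (Rmult_le_reg_r (1 - x)); [lra|].
  assert (0 <= x ^ 2) by apply pow2_ge_0.
  assert (0 <= x ^ 2 * (1 - 2 * x)) by sign.
  simpl in *. lra.
Qed.

Lemma Rabs_sin_le (y : R) : Rabs (sin y) <= Rabs y.
Proof.
  destruct (MVT_gen sin 0 y cos) as (c & _ & Hc).
  - intros x _. apply is_derive_Reals, derivable_pt_lim_sin.
  - intros x _. apply continuity_sin.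
  - rewrite sin_0, !Rminus_0_r in Hc. rewrite Hc, Rabs_mult.
    rewrite <- (Rmult_1_l (Rabs y)) at 2. apply Rmult_le_compat_r; [sign|].
    apply Rabs_le. pose proof (COS_bound c). lra.
Qed.

Lemma cos_quadratic (y : R) : Rabs (cos y - 1) <= y ^ 2.
Proof.
  replace y with (2 * (y / 2)) at 1 by field. rewrite cos_2a_sin.
  replace (1 - 2 * sin (y / 2) * sin (y / 2) - 1) with (- (2 * sin (y / 2) ^ 2)) by ring.
  rewrite Rabs_Ropp, Rabs_pos_eq by (pose proof (pow2_ge_0 (sin (y / 2))); lra).

  assert (H2 : sin (y / 2) ^ 2 <= (y / 2) ^ 2).
  { rewrite <- (pow2_abs (sin (y / 2))), <- (pow2_abs (y / 2)).
    apply pow_incr. split; [sign|apply Rabs_sin_le]. }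
  pose proof (pow2_ge_0 y). simpl in *. lra.
Qed.

Lemma sin_quadratic (y : R) : Rabs y <= 1 -> Rabs (sin y - y) <= y ^ 2.
Proof.
  intros Hy.
  destruct (MVT_gen (fun t => sin t - t) 0 y (fun t => cos t - 1)) as (c & Hc1 & Hc).
  - intros x _. auto_derive; [exact I|ring].
  - intros x _. apply continuity_pt_minus; [apply continuity_sin|apply continuity_pt_id].
  - cbv beta in Hc. rewrite sin_0, !Rminus_0_r in Hc. rewrite Hc, Rabs_mult.
    rewrite <- (pow2_abs y). simpl. rewrite Rmult_1_r.
    apply Rmult_le_compat_r; [sign|].
    eapply Rle_trans; [apply cos_quadratic|].
    assert (Hcy : Rabs c <= Rabs y).
    { revert Hc1. unfold Rmin, Rmax, Rabs.
      destruct (Rle_dec 0 y), (Rcase_abs c), (Rcase_abs y); lra. }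
    rewrite <- (pow2_abs c). simpl. rewrite Rmult_1_r.
    rewrite <- (Rmult_1_r (Rabs y)). apply Rmult_le_compat; auto using Rabs_pos; lra.
Qed.

Lemma Cmod_le_abs_sum (a b : R) : Cmod (a, b) <= Rabs a + Rabs b.
Proof.
  replace ((a, b) : C) with (RtoC a + (0, b))%C by (unfold Cplus, RtoC; simpl; f_equal; ring).
  eapply Rle_trans; [apply Cmod_triangle|]. rewrite Cmod_R. apply Rplus_le_compat_l.
  right. unfold Cmod; simpl. rewrite <- sqrt_Rsqr_abs. f_equal. unfold Rsqr; ring.
Qed.

Lemma Rabs_Im_le_Cmod (z : C) : Rabs (Im z) <= Cmod z.
Proof. eapply Rle_trans; [apply Rmax_r|apply Rmax_Cmod]. Qed.

Lemma Cexp_decay_quadratic (beta : R) (h : C) :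
  0 < beta -> beta * Cmod h <= 1 / 2 ->
  Cmod (Cexp_decay beta h - 1 - (- RtoC beta) * h)%C <= 20 * beta ^ 2 * Cmod h ^ 2.
Proof.
  intros Hb Hh.
  set (x := - beta * Re h). set (y := - beta * Im h).
  assert (Hx : Rabs x <= beta * Cmod h).
  { unfold x. rewrite Rabs_mult, Rabs_Ropp, (Rabs_pos_eq beta) by lra.
    apply Rmult_le_compat_l; [lra|apply re_le_Cmod]. }
  assert (Hy : Rabs y <= beta * Cmod h).
  { unfold y. rewrite Rabs_mult, Rabs_Ropp, (Rabs_pos_eq beta) by lra.
    apply Rmult_le_compat_l; [lra|apply Rabs_Im_le_Cmod]. }
  replace (Cexp_decay beta h - 1 - (- RtoC beta) * h)%C
    with ((exp x - 1 - x + exp x * (cos y - 1), (exp x - 1) * sin y + (sin y - y)) : C).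
  2: { assert (Hbh : (- RtoC beta * h)%C = (x, y)).
       { unfold x, y, Cmult, Copp, RtoC, Re, Im; simpl. f_equal; ring. }
       rewrite Hbh. unfold Cexp_decay. fold x y.
       unfold Cminus, Cplus, Copp, RtoC; simpl. f_equal; ring. }
  set (t := beta * Cmod h) in *.
  assert (Ht : 0 <= t) by sign.
  replace (20 * beta ^ 2 * Cmod h ^ 2) with (20 * t ^ 2) by (unfold t; ring).
  assert (Hsq : forall u, Rabs u <= t -> u ^ 2 <= t ^ 2).
  { intros u Hu. rewrite <- (pow2_abs u). apply pow_incr. split; [sign|exact Hu]. }
  pose proof (exp_quadratic x ltac:(lra)) as He. pose proof (Hsq x Hx) as Hx2.
  pose proof (cos_quadratic y) as Hcos. pose proof (Hsq y Hy) as Hy2.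
  pose proof (sin_quadratic y ltac:(lra)) as Hsin.
  assert (He1 : Rabs (exp x - 1) <= 2 * t).
  { replace (exp x - 1) with ((exp x - 1 - x) + x) by ring.
    eapply Rle_trans; [apply Rabs_triang|].
    assert (t ^ 2 <= t * (1 / 2)) by (simpl; rewrite Rmult_1_r; apply Rmult_le_compat_l; lra).
    lra. }
  assert (Hex : Rabs (exp x) <= 2).
  { replace (exp x) with ((exp x - 1) + 1) by ring.
    eapply Rle_trans; [apply Rabs_triang|]. rewrite Rabs_R1. lra. }
  eapply Rle_trans; [apply Cmod_le_abs_sum|].
  assert (H1 : Rabs (exp x - 1 - x + exp x * (cos y - 1)) <= 4 * t ^ 2).
  { eapply Rle_trans; [apply Rabs_triang|]. rewrite (Rabs_mult (exp x)).
    assert (Rabs (exp x) * Rabs (cos y - 1) <= 2 * t ^ 2)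
      by (apply Rmult_le_compat; auto using Rabs_pos; lra). lra. }
  assert (H2 : Rabs ((exp x - 1) * sin y + (sin y - y)) <= 4 * t ^ 2).
  { eapply Rle_trans; [apply Rabs_triang|]. rewrite (Rabs_mult (exp x - 1)).
    assert (Rabs (exp x - 1) * Rabs (sin y) <= 2 * t * t).
    { apply Rmult_le_compat; auto using Rabs_pos. pose proof (Rabs_sin_le y); lra. }
    assert (0 <= t ^ 2) by apply pow2_ge_0. simpl in *. lra. }
  assert (0 <= t ^ 2) by apply pow2_ge_0. lra.
Qed.

Lemma ex_derive_Cexp_decay (beta : R) (z : C) : 0 < beta -> ex_derive_C (Cexp_decay beta) z.
Proof.
  intros Hb.
  apply (ex_derive_C_quadratic _ z (Cexp_decay beta z * (- RtoC beta))%C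
           (Cmod (Cexp_decay beta z) * (20 * beta ^ 2)) (/ (2 * beta))).
  - sign.
  - intros h Hh. rewrite Cexp_decay_plus.
    replace (Cexp_decay beta z * Cexp_decay beta h - Cexp_decay beta z
             - Cexp_decay beta z * - RtoC beta * h)%C
      with (Cexp_decay beta z * (Cexp_decay beta h - 1 - (- RtoC beta) * h))%C by ring.
    rewrite Cmod_mult, Rmult_assoc. apply Rmult_le_compat_l; [sign|].
    apply Cexp_decay_quadratic; [exact Hb|].
    apply Rle_trans with (beta * / (2 * beta)); [apply Rmult_le_compat_l; lra|].
    right. field. lra.
Qed.

Lemma exp_INR_le_pow3 (i : nat) : exp (INR i) <= 3 ^ i.
Proof.
  induction i as [|i IH]; [simpl; rewrite exp_0; lra|].
  rewrite S_INR, exp_plus. simpl. rewrite Rmult_comm.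
  apply Rmult_le_compat; auto using exp_le_3; left; apply exp_pos.
Qed.

(** Bounding [r^j] by [i^j (1 + r/i)^(2 i)] for [j <= 2 i] bounds the truncated exponential
    sum by [e^i (1 + r/i)^(2 i)].  The rest is [(i mu + 1)^i i! <= (mu + 1/i)^i i^(2 i)] and
    [1/i <= 2/(i + 1)]; with [e <= 3] this costs the factor [6^i]. *)
Lemma layer_weight_sum_bound (A Lam mu y r : R) (i : nat) :
  0 <= A -> 0 < Lam -> 0 < mu -> 0 <= y <= r ->
  A * layer_weight Lam mu i * sum_f_R0 (fun j => y ^ j / INR (fact j)) (2 * i)
  <= A * (6 * Lam) ^ i * (mu + / (INR i + 1)) ^ i * / INR (fact i)
     * (INR i * 1 + r) ^ (2 * i).
Proof.
  intros HA HL Hmu Hy. rewrite Rmult_1_r.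
  destruct i as [|i'].
  { unfold layer_weight; simpl. lra. }
  set (i := S i'). set (x := INR i).
  assert (Hx : 1 <= x) by (apply (le_INR 1); unfold i; lia).
  unfold layer_weight. fold x.
  set (Q := (1 + r / x) ^ (2 * i)).
  assert (Hrx : 0 <= r / x) by sign.
  assert (HQ : 0 < Q) by sign.
  assert (HT : sum_f_R0 (fun j => y ^ j / INR (fact j)) (2 * i) <= 3 ^ i * Q).
  { apply Rle_trans with (sum_f_R0 (fun j => x ^ j / INR (fact j) * Q) (2 * i)).
    - apply sum_Rle; intros j Hj. pose proof (INR_fact_pos j).
      unfold Rdiv. rewrite Rmult_assoc, (Rmult_comm (/ _)), <- Rmult_assoc.
      apply Rmult_le_compat_r; [sign|].
      apply Rle_trans with ((x * (r / x)) ^ j).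
      + apply pow_incr. replace (x * (r / x)) with r by (field; lra). exact Hy.
      + rewrite Rpow_mult_distr. apply Rmult_le_compat_l; [sign|].
        apply Rle_trans with ((1 + r / x) ^ j); [apply pow_incr; lra|].
        apply Rle_pow; [lra|exact Hj].
    - rewrite <- scal_sum, Rmult_comm. apply Rmult_le_compat_r; [lra|].
      eapply Rle_trans; [apply exp_ge_taylor; lra|apply exp_INR_le_pow3]. }
  assert (Hxm : 0 <= x * mu) by sign.
  pose proof (INR_fact_pos i) as Hf.
  assert (Hff : INR (fact i) <= x ^ i).
  { pose proof (fact_le_pow_fact i i x ltac:(lia) (Rle_refl _)) as H.
    rewrite Nat.sub_diag in H. simpl (INR (fact 0)) in H. lra. }
  assert (Hxi : 0 < x ^ i) by sign.
  apply Rle_trans with (A * (Lam ^ i * (x * mu + 1) ^ i) * (3 ^ i * Q)).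
  { apply Rmult_le_compat_l; [|exact HT]. apply Rmult_le_pos; [exact HA|].
    apply Rmult_le_pos; sign. }
  replace ((x + r) ^ (2 * i)) with (Q * (x ^ i * x ^ i)).
  2: { unfold Q. replace (x + r) with ((1 + r / x) * x) by (field; lra).
       rewrite Rpow_mult_distr, <- pow_add. do 2 f_equal. lia. }
  replace 6 with (3 * 2) by ring. rewrite !Rpow_mult_distr.
  replace (A * (Lam ^ i * (x * mu + 1) ^ i) * (3 ^ i * Q))
    with (A * Lam ^ i * 3 ^ i * Q * (x * mu + 1) ^ i) by ring.
  replace (A * (3 ^ i * 2 ^ i * Lam ^ i) * (mu + / (x + 1)) ^ i * / INR (fact i) *
           (Q * (x ^ i * x ^ i)))
    with (A * Lam ^ i * 3 ^ i * Q *
          ((2 * (mu + / (x + 1)) * x) ^ i * (x ^ i * / INR (fact i))))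
    by (rewrite !Rpow_mult_distr; ring).
  apply Rmult_le_compat_l.
  { sign. }
  rewrite <- (Rmult_1_r ((x * mu + 1) ^ i)).
  apply Rmult_le_compat; [sign|lra| |].
  - apply pow_incr. split; [lra|].
    assert (1 <= 2 * / (x + 1) * x).
    { apply (Rmult_le_reg_r (x + 1)); [lra|].
      replace (2 * / (x + 1) * x * (x + 1)) with (2 * x) by (field; lra). lra. }
    lra.
  - apply (Rmult_le_reg_r (INR (fact i))); [lra|].
    rewrite Rmult_assoc, Rinv_l by lra. lra.
Qed.

Lemma layer_rep_entire (beta s A Lam mu : R) (l : nat) (w : R -> R) :
  0 < beta -> 0 < s <= 1 -> 0 <= A -> 0 < Lam -> 0 < mu ->
  layer_rep beta s (A * layer_weight Lam mu l) l w ->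
  exists F : C -> C, entire F /\ extends halfline_closed F w /\
    forall z, Cmod (F z) <= layer_bound A (6 * Lam) 1 beta mu l z.
Proof.
  intros Hb Hs HA HL Hmu (p & _ & Hp & Hw).
  exists (fun z => (Cepoly p (2 * l) z * Cexp_decay beta z)%C). split; [|split].
  - intros z _. apply ex_derive_C_mult; [apply ex_derive_Cepoly|now apply ex_derive_Cexp_decay].
  - intros x Hx. rewrite Hw by exact Hx. rewrite Cepoly_real. unfold layer.
    rewrite RtoC_mult. f_equal. unfold Cexp_decay, RtoC; simpl.
    rewrite Rmult_0_r, cos_0, sin_0. f_equal; ring.
  - intros z. rewrite Cmod_mult, Cmod_Cexp_decay. unfold layer_bound.
    apply Rmult_le_compat_r; [sign|].
    eapply Rle_trans; [apply Cmod_Cepoly, Hp|].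
    apply layer_weight_sum_bound; auto.
    pose proof (Cmod_ge_0 z). split; [sign|].
    rewrite <- (Rmult_1_l (Cmod z)) at 2. apply Rmult_le_compat_r; lra.
Qed.

(** * Holomorphic extension of the smooth part *)

Definition Cseries (u : nat -> C) : C :=
  (Series (fun n => Re (u n)), Series (fun n => Im (u n))).

Definition Csummable (u : nat -> C) : Prop := ex_series (fun n => Cmod (u n)).

Lemma Csummable_Re (u : nat -> C) : Csummable u -> ex_series (fun n => Re (u n)).
Proof.
  intros H. apply (ex_series_le_R _ _
    (fun n => re_le_Cmod (u n)) H).
Qed.

Lemma Csummable_Im (u : nat -> C) : Csummable u -> ex_series (fun n => Im (u n)).
Proof.
  intros H. apply (ex_series_le_R _ _
    (fun n => Rabs_Im_le_Cmod (u n)) H).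
Qed.

Lemma Cseries_ext (u v : nat -> C) : (forall n, u n = v n) -> Cseries u = Cseries v.
Proof.
  intros H. unfold Cseries. f_equal; apply Series_ext; intros n; now rewrite H.
Qed.

Lemma Cseries_minus (u v : nat -> C) :
  Csummable u -> Csummable v ->
  Cseries (fun n => (u n - v n)%C) = (Cseries u - Cseries v)%C.
Proof.
  intros Hu Hv. unfold Cseries, Cminus, Cplus, Copp, Re, Im; simpl. f_equal.
  - rewrite (Series_ext _ (fun n => fst (u n) - fst (v n))) by (intros; simpl; ring).
    rewrite Series_minus; [ring|now apply Csummable_Re|now apply Csummable_Re].
  - rewrite (Series_ext _ (fun n => snd (u n) - snd (v n))) by (intros; simpl; ring).
    rewrite Series_minus; [ring|now apply Csummable_Im|now apply Csummable_Im].
Qed.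

Lemma ex_series_scal_R (a : R) (u : nat -> R) :
  ex_series u -> ex_series (fun n => a * u n).
Proof. intros H. exact (ex_series_scal_l (K := R_AbsRing) a u H). Qed.

Lemma Cseries_mult (k : C) (u : nat -> C) :
  Csummable u -> Cseries (fun n => (u n * k)%C) = (Cseries u * k)%C.
Proof.
  intros Hu. pose proof (Csummable_Re u Hu) as Hr. pose proof (Csummable_Im u Hu) as Hi.
  unfold Cseries, Cmult, Re, Im in *; simpl. f_equal.
  - rewrite (Series_ext _ (fun n => fst k * fst (u n) - snd k * snd (u n)))
      by (intros; simpl; ring).
    rewrite Series_minus, !Series_scal_l by auto using ex_series_scal_R. ring.
  - rewrite (Series_ext _ (fun n => snd k * fst (u n) + fst k * snd (u n)))
      by (intros; simpl; ring).
    rewrite Series_plus, !Series_scal_l by auto using ex_series_scal_R. ring.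
Qed.

Lemma geometric_series (t : R) : 0 <= t <= 1 / 2 ->
  ex_series (fun n => t ^ n) /\ Series (fun n => t ^ n) <= 2.
Proof.
  intros Ht. assert (Ha : Rabs t < 1) by (rewrite Rabs_pos_eq; lra).
  split; [eexists; now apply is_series_geom|].
  rewrite (is_series_unique _ _ (is_series_geom t Ha)).
  apply (Rmult_le_reg_r (1 - t)); [lra|]. rewrite Rinv_l; lra.
Qed.

Lemma Csummable_geometric (u : nat -> C) (B t : R) :
  0 <= t <= 1 / 2 -> (forall n, Cmod (u n) <= B * t ^ n) -> Csummable u.
Proof.
  intros Ht Hu.
  apply (ex_series_le_R _ (fun n => B * t ^ n)).
  - intros n. change (Rabs (Cmod (u n)) <= B * t ^ n).
    rewrite Rabs_pos_eq; [apply Hu|sign].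
  - apply ex_series_scal_R. now apply geometric_series.
Qed.

Lemma Cmod_Cseries_geometric (u : nat -> C) (B t : R) :
  0 <= B -> 0 <= t <= 1 / 2 -> (forall n, Cmod (u n) <= B * t ^ n) ->
  Cmod (Cseries u) <= 4 * B.
Proof.
  intros HB Ht Hu. destruct (geometric_series t Ht) as [Hex H2].
  assert (Hreal : forall a : nat -> R, (forall n, Rabs (a n) <= B * t ^ n) ->
             Rabs (Series a) <= 2 * B).
  { intros a Ha. assert (Hexa : ex_series (fun n => B * t ^ n))
      by (apply ex_series_scal_R; exact Hex).
    assert (Habs : ex_series (fun n => Rabs (a n))).
    { apply (ex_series_le_R _ (fun n => B * t ^ n));
        [|exact Hexa].
      intros n. change (Rabs (Rabs (a n)) <= B * t ^ n). rewrite Rabs_Rabsolu. apply Ha. }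
    eapply Rle_trans; [now apply Series_Rabs|].
    apply Rle_trans with (Series (fun n => B * t ^ n)).
    - apply Series_le; [|exact Hexa]. intros n; split; [sign|apply Ha].
    - rewrite Series_scal_l, (Rmult_comm 2). now apply Rmult_le_compat_l. }
  eapply Rle_trans; [apply Cmod_le_abs_sum|].
  replace (4 * B) with (2 * B + 2 * B) by ring.
  apply Rplus_le_compat; apply Hreal; intros n.
  - eapply Rle_trans; [apply re_le_Cmod|apply Hu].
  - eapply Rle_trans; [apply Rabs_Im_le_Cmod|apply Hu].
Qed.

Definition Cpseries (c : nat -> R) (w : C) : C := Cseries (fun n => (RtoC (c n) * w ^ n)%C).

(** The remainders satisfy [e_(n+1) = (w + k) e_n + n w^(n-1) k^2], whence the bound by
    induction. *)
Lemma Cpow_quadratic_remainder (w k : C) (r : R) (n : nat) :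
  0 < r -> Cmod w <= r -> Cmod k <= r ->
  Cmod ((w + k) ^ n - w ^ n - INR n * w ^ (pred n) * k)%C
  <= Cmod k ^ 2 / r ^ 2 * (4 * r) ^ n.
Proof.
  intros Hr Hw Hk.
  assert (Hr2 : 0 < r ^ 2) by sign.
  set (B := Cmod k ^ 2 / r ^ 2).
  assert (HB : 0 <= B).
  { sign. }
  induction n as [|n IH].
  - simpl pred. simpl (_ ^ 0)%C. simpl INR.
    replace (1 - 1 - 0 * 1 * k)%C with (RtoC 0) by ring. rewrite Cmod_0. simpl. lra.
  - replace ((w + k) ^ S n - w ^ S n - INR (S n) * w ^ pred (S n) * k)%C
      with ((w + k) * ((w + k) ^ n - w ^ n - INR n * w ^ pred n * k)
            + INR n * w ^ pred n * k ^ 2)%C.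
    2: { simpl pred. rewrite S_INR, RtoC_plus, !Cpow_S.
         destruct n as [|n]; [simpl; ring|]. simpl pred. rewrite !Cpow_S. ring. }
    assert (Hn : Cmod (INR n * w ^ pred n * k ^ 2)%C <= 2 * r * (B * (4 * r) ^ n)).
    { rewrite !Cmod_mult, Cmod_R, !Cmod_pow, Rabs_pos_eq by apply pos_INR.
      destruct n as [|n].
      { simpl (INR 0). rewrite !Rmult_0_l. simpl.
        apply Rmult_le_pos; [lra|]. rewrite Rmult_1_r. exact HB. }
      simpl pred. replace (Cmod k ^ 2) with (B * r ^ 2) by (unfold B; field; lra).
      pose proof (Cmod_ge_0 w).
      assert (H1 : INR (S n) * Cmod w ^ n <= 4 ^ n * r ^ n).
      { apply Rmult_le_compat; [sign|sign| |now apply pow_incr].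
        eapply Rle_trans; [apply INR_S_le_pow2|]. apply pow_incr; lra. }
      rewrite Rpow_mult_distr.
      apply Rle_trans with (4 ^ n * r ^ n * (B * r ^ 2)).
      - apply Rmult_le_compat_r; [sign|exact H1].
      - assert (0 <= 4 ^ n * r ^ n) by sign.
        assert (0 <= 4 ^ n * r ^ n * (B * r ^ 2)) by sign.
        simpl in *. lra. }
    eapply Rle_trans; [apply Cmod_triangle|]. rewrite Cmod_mult.
    assert (Hwk : Cmod (w + k) <= 2 * r) by (eapply Rle_trans; [apply Cmod_triangle|lra]).
    apply Rle_trans with (2 * r * (B * (4 * r) ^ n) + 2 * r * (B * (4 * r) ^ n)).
    + apply Rplus_le_compat; [|exact Hn].
      apply Rmult_le_compat; auto using Cmod_ge_0.
    + right. simpl. ring.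
Qed.

Lemma Cpseries_summable (c : nat -> R) (M g : R) (w : C) :
  0 <= M -> (forall n, Rabs (c n) <= M * g ^ n) -> 0 <= g -> g * Cmod w <= 1 / 2 ->
  Csummable (fun n => (RtoC (c n) * w ^ n)%C).
Proof.
  intros HM Hc Hg Hw. pose proof (Cmod_ge_0 w) as H0.
  apply (Csummable_geometric _ M (g * Cmod w)).
  - split; [sign|exact Hw].
  - intros n. rewrite Cmod_mult, Cmod_R, Cmod_pow, Rpow_mult_distr, <- Rmult_assoc.
    apply Rmult_le_compat_r; [sign|apply Hc].
Qed.

(** The termwise derivative of a power series well inside its disc of convergence leaves a
    quadratic remainder. *)
Lemma Cpseries_quadratic (c : nat -> R) (M g r : R) (w : C) :
  0 <= M -> (forall n, Rabs (c n) <= M * g ^ n) -> 0 <= g -> 0 < r ->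
  8 * (g * r) <= 1 -> Cmod w <= r ->
  exists L, forall k, Cmod k <= r ->
    Cmod (Cpseries c (w + k) - Cpseries c w - L * k)%C <= 4 * (M / r ^ 2) * Cmod k ^ 2.
Proof.
  intros HM Hc Hg Hr Hgr Hw.
  assert (Hr2 : 0 < r ^ 2) by sign.
  assert (Hgr0 : 0 <= g * r) by sign.
  assert (Hsum : forall v, Cmod v <= 2 * r -> Csummable (fun n => (RtoC (c n) * v ^ n)%C)).
  { intros v Hv. apply (Cpseries_summable c M g v); auto.
    apply Rle_trans with (g * (2 * r)); [now apply Rmult_le_compat_l|lra]. }
  set (D := fun n => (RtoC (c n) * (INR n * w ^ pred n))%C).
  assert (HD : Csummable D).
  { apply (Csummable_geometric D (M / r) (2 * (g * r))); [lra|].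
    intros n. unfold D. rewrite !Cmod_mult, !Cmod_R, Cmod_pow.
    rewrite (Rabs_pos_eq (INR n)) by apply pos_INR.
    pose proof (Cmod_ge_0 w).
    assert (H1 : INR n * Cmod w ^ pred n <= 2 ^ n * r ^ n / r).
    { destruct n as [|n].
      - simpl. rewrite Rmult_0_l. unfold Rdiv. rewrite !Rmult_1_l.
        sign.
      - simpl pred. replace (2 ^ S n * r ^ S n / r) with (2 * 2 ^ n * r ^ n) by (simpl; field; lra).
        apply Rmult_le_compat; [sign|sign| |now apply pow_incr].
        pose proof (INR_S_le_pow2 n). pose proof (pow_lt 2 n ltac:(lra)). lra. }
    apply Rle_trans with (M * g ^ n * (2 ^ n * r ^ n / r)).
    - apply Rmult_le_compat; auto using Rabs_pos.
      sign.
    - right. rewrite !Rpow_mult_distr. field. lra. }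
  exists (Cseries D). intros k Hk.
  assert (Hwk : Cmod (w + k) <= 2 * r) by (eapply Rle_trans; [apply Cmod_triangle|lra]).
  assert (HDk : Csummable (fun n => (D n * k)%C)).
  { unfold Csummable. apply (ex_series_ext (fun n => Cmod k * Cmod (D n))).
    - intros n. rewrite Cmod_mult. apply Rmult_comm.
    - now apply ex_series_scal_R. }
  assert (HS : (Cpseries c (w + k) - Cpseries c w - Cseries D * k)%C
     = Cseries (fun n => (RtoC (c n) * ((w + k) ^ n - w ^ n - INR n * w ^ pred n * k))%C)).
  { unfold Cpseries. rewrite <- Cseries_mult by exact HD.
    rewrite <- Cseries_minus by (apply Hsum; lra).
    rewrite <- Cseries_minus; [|unfold Csummable|exact HDk].
    - apply Cseries_ext. intros n. unfold D. ring.
    - apply (ex_series_le_R _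
        (fun n => Cmod (RtoC (c n) * (w + k) ^ n)%C + Cmod (RtoC (c n) * w ^ n)%C)).
      + intros n. change (Rabs (Cmod (RtoC (c n) * (w + k) ^ n - RtoC (c n) * w ^ n)%C)
          <= Cmod (RtoC (c n) * (w + k) ^ n)%C + Cmod (RtoC (c n) * w ^ n)%C).
        rewrite Rabs_pos_eq by apply Cmod_ge_0.
        eapply Rle_trans; [apply Cmod_triangle|]. rewrite Cmod_opp. lra.
      + apply (ex_series_plus (K := R_AbsRing) (V := R_NormedModule)); apply Hsum; lra. }
  rewrite HS.
  replace (4 * (M / r ^ 2) * Cmod k ^ 2) with (4 * (M * (Cmod k ^ 2 / r ^ 2))) by (field; lra).
  apply (Cmod_Cseries_geometric _ _ (4 * (g * r))).
  - apply Rmult_le_pos; [exact HM|].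
    apply Rmult_le_pos; [apply pow2_ge_0|sign].
  - lra.
  - intros n. rewrite Cmod_mult, Cmod_R.
    apply Rle_trans with (M * g ^ n * (Cmod k ^ 2 / r ^ 2 * (4 * r) ^ n)).
    + apply Rmult_le_compat; auto using Rabs_pos, Cmod_ge_0.
      now apply Cpow_quadratic_remainder.
    + right. rewrite !Rpow_mult_distr. ring.
Qed.

(** Differentiating the Taylor polynomial with respect to its centre telescopes. *)
Lemma is_derive_Taylor_center (H A : nat -> R -> R) (N : nat) (t : R) :
  (forall n, is_derive (H n) t (H (S n) t)) ->
  (forall n, is_derive (A n) t (- (INR n * A (pred n) t))) ->
  is_derive (fun s => sum_f_R0 (fun n => H n s / INR (fact n) * A n s) N) t
            (H (S N) t / INR (fact N) * A N t).
Proof.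
  intros HH HA.
  assert (Hterm : forall n, is_derive (fun s => H n s / INR (fact n) * A n s) t
     (H (S n) t / INR (fact n) * A n t + H n t / INR (fact n) * - (INR n * A (pred n) t))).
  { intros n.
    apply (is_derive_mult (K := R_AbsRing) (fun s => H n s / INR (fact n)) (A n));
      [|apply HA|apply Rmult_comm].
    apply (is_derive_ext (fun s => / INR (fact n) * H n s)); [intros; apply Rmult_comm|].
    unfold Rdiv; rewrite (Rmult_comm (H (S n) t)). apply is_derive_scal, HH. }
  induction N as [|N IH].
  - simpl sum_f_R0. replace (H 1%nat t / INR (fact 0) * A 0%nat t) with
      (H 1%nat t / INR (fact 0) * A 0%nat t
       + H 0%nat t / INR (fact 0) * - (INR 0 * A (pred 0) t)) by (simpl; field).
    apply Hterm.
  - apply (is_derive_ext (fun s => sum_f_R0 (fun n => H n s / INR (fact n) * A n s) N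
        + H (S N) s / INR (fact (S N)) * A (S N) s)); [intros; now rewrite tech5|].
    replace (H (S (S N)) t / INR (fact (S N)) * A (S N) t) with
      (H (S N) t / INR (fact N) * A N t +
       (H (S (S N)) t / INR (fact (S N)) * A (S N) t
        + H (S N) t / INR (fact (S N)) * - (INR (S N) * A (pred (S N)) t))).
    + apply (is_derive_plus _ _ t _ _ IH (Hterm (S N))).
    + rewrite INR_fact_S. simpl pred. pose proof (INR_fact_pos N).
      pose proof (lt_0_INR (S N) ltac:(lia)). field. lra.
Qed.

Lemma is_derive_Cpow_center (z : C) (n : nat) (t : R) :
  is_derive (fun s => Re ((z - RtoC s) ^ n)%C) t
    (- (INR n * Re ((z - RtoC t) ^ pred n)%C)) /\
  is_derive (fun s => Im ((z - RtoC s) ^ n)%C) t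
    (- (INR n * Im ((z - RtoC t) ^ pred n)%C)).
Proof.
  destruct z as [a b].
  assert (Hre : forall n s, Re (((a, b) - RtoC s) ^ S n)%C
     = (a - s) * Re (((a, b) - RtoC s) ^ n)%C - b * Im (((a, b) - RtoC s) ^ n)%C).
  { intros m s. rewrite Cpow_S. unfold Re, Im, Cmult; simpl. ring. }
  assert (Him : forall n s, Im (((a, b) - RtoC s) ^ S n)%C
     = (a - s) * Im (((a, b) - RtoC s) ^ n)%C + b * Re (((a, b) - RtoC s) ^ n)%C).
  { intros m s. rewrite Cpow_S. unfold Re, Im, Cmult; simpl. ring. }
  induction n as [|n [IHr IHi]].
  - simpl (INR 0). rewrite !Rmult_0_l, Ropp_0. simpl.
    split; apply (is_derive_const (K := R_AbsRing) (V := R_NormedModule)).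
  - simpl pred.
    set (A := fun s => Re (((a, b) - RtoC s) ^ n)%C) in *.
    set (B := fun s => Im (((a, b) - RtoC s) ^ n)%C) in *.
    assert (Hlin : is_derive (fun s => a - s) t (-1)) by (auto_derive; [exact I|ring]).
    split.
    + apply (is_derive_ext (fun s => (a - s) * A s - b * B s)); [intros s; now rewrite Hre|].
      replace (- (INR (S n) * Re (((a, b) - RtoC t) ^ n)%C)) with
        ((-1 * A t + (a - t) * - (INR n * Re (((a, b) - RtoC t) ^ pred n)%C))
         - b * - (INR n * Im (((a, b) - RtoC t) ^ pred n)%C)).
      * apply (is_derive_minus (fun s => (a - s) * A s) (fun s => b * B s)).
        -- apply (is_derive_mult (K := R_AbsRing) (fun s => a - s) A); auto. apply Rmult_comm.
        -- now apply is_derive_scal.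
      * unfold A. rewrite S_INR. destruct n as [|n]; [simpl; ring|]. rewrite Hre.
        simpl pred. ring.
    + apply (is_derive_ext (fun s => (a - s) * B s + b * A s)); [intros s; now rewrite Him|].
      replace (- (INR (S n) * Im (((a, b) - RtoC t) ^ n)%C)) with
        ((-1 * B t + (a - t) * - (INR n * Im (((a, b) - RtoC t) ^ pred n)%C))
         + b * - (INR n * Re (((a, b) - RtoC t) ^ pred n)%C)).
      * apply (is_derive_plus (fun s => (a - s) * B s) (fun s => b * A s)).
        -- apply (is_derive_mult (K := R_AbsRing) (fun s => a - s) B); auto. apply Rmult_comm.
        -- now apply is_derive_scal.
      * unfold B. rewrite S_INR. destruct n as [|n]; [simpl; ring|]. rewrite Him.
        simpl pred. ring.
Qed.

Definition taylor_coef (h : R -> R) (x : R) (n : nat) : R := Derive_n h n x / INR (fact n).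

Lemma taylor_coef_bound (h : R -> R) (M g x : R) (n : nat) :
  derivs_bounded h (analytic_bound M g) -> I_open x ->
  Rabs (taylor_coef h x n) <= M * g ^ n.
Proof.
  intros [_ Hb] Hx. unfold taylor_coef, Rdiv. pose proof (INR_fact_pos n).
  rewrite Rabs_mult, (Rabs_pos_eq (/ _)) by sign.
  apply Rle_div_l; [lra|]. now apply Hb.
Qed.

Lemma sum_limit_eq (a b : nat -> R) (B : R) :
  ex_series a -> ex_series b ->
  (forall N, Rabs (sum_f_R0 b N - sum_f_R0 a N) <= B * (1 / 2) ^ N) ->
  Series a = Series b.
Proof.
  intros Ha Hb HN.
  apply Series_correct in Ha. apply Series_correct in Hb.
  set (la := Series a) in *. set (lb := Series b) in *.
  assert (Hlim : is_lim_seq (fun N => sum_n b N - sum_n a N) (lb - la)).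
  { apply is_lim_seq_minus'; assumption. }
  assert (H0 : is_lim_seq (fun N => sum_n b N - sum_n a N) 0).
  { apply is_lim_seq_abs_0.
    apply (is_lim_seq_le_le (fun _ => 0) _ (fun N => B * (1 / 2) ^ N)).
    - intros N. split; [sign|]. rewrite !sum_n_Reals. apply HN.
    - apply is_lim_seq_const.
    - replace (Finite 0) with (Rbar_mult B 0) by (simpl; f_equal; ring).
      apply is_lim_seq_scal_l. apply is_lim_seq_geom. rewrite Rabs_pos_eq; lra. }
  apply is_lim_seq_unique in Hlim. apply is_lim_seq_unique in H0.
  rewrite Hlim in H0. injection H0. lra.
Qed.

(** The Taylor series of [h] at two nearby centres have the same value at [z]: moving the
    centre changes the partial sum by a term that tends to zero.  This replaces an
    identity theorem when the local extensions are glued. *)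
Lemma taylor_center_independent (h : R -> R) (M g x0 x1 : R) (z : C) :
  0 <= M -> 0 < g -> derivs_bounded h (analytic_bound M g) ->
  I_open x0 -> I_open x1 ->
  4 * (g * (Cmod (z - RtoC x0)%C + Rabs (x1 - x0))) <= 1 ->
  Cpseries (taylor_coef h x0) (z - RtoC x0) = Cpseries (taylor_coef h x1) (z - RtoC x1).
Proof.
  intros HM Hg Hh Hx0 Hx1 Hr.
  set (r := Cmod (z - RtoC x0)%C + Rabs (x1 - x0)) in *.
  assert (Hbetween : forall t, Rmin x0 x1 <= t <= Rmax x0 x1 ->
            I_open t /\ Cmod (z - RtoC t)%C <= r).
  { intros t Ht. split.
    - destruct Hx0, Hx1. revert Ht. unfold Rmin, Rmax.
      destruct (Rle_dec x0 x1); intros; split; lra.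
    - replace (z - RtoC t)%C with ((z - RtoC x0) + RtoC (x0 - t))%C
        by (rewrite RtoC_minus; ring).
      eapply Rle_trans; [apply Cmod_triangle|]. unfold r. apply Rplus_le_compat_l.
      rewrite Cmod_R. revert Ht. unfold Rmin, Rmax, Rabs.
      destruct (Rle_dec x0 x1), (Rcase_abs (x0 - t)), (Rcase_abs (x1 - x0)); lra. }
  assert (Hr0 : 0 <= r) by (apply Rplus_le_le_0_compat; [sign|sign]).
  assert (Hsum : forall t, Rmin x0 x1 <= t <= Rmax x0 x1 ->
     Csummable (fun n => (RtoC (taylor_coef h t n) * (z - RtoC t) ^ n)%C)).
  { intros t Ht. destruct (Hbetween t Ht) as [HtI Htr].
    apply (Cpseries_summable _ M g); auto; try lra.
    - intros n. now apply taylor_coef_bound.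
    - apply Rle_trans with (g * r); [apply Rmult_le_compat_l; lra|lra]. }
  assert (Hin0 : Rmin x0 x1 <= x0 <= Rmax x0 x1) by (split; [apply Rmin_l|apply Rmax_l]).
  assert (Hin1 : Rmin x0 x1 <= x1 <= Rmax x0 x1) by (split; [apply Rmin_r|apply Rmax_r]).
  assert (Hcomp : forall A : nat -> R -> R,
     (forall n t, is_derive (A n) t (- (INR n * A (pred n) t))) ->
     (forall n t, Rabs (A n t) <= Cmod (z - RtoC t)%C ^ n) ->
     forall N, Rabs (sum_f_R0 (fun n => taylor_coef h x1 n * A n x1) N
                     - sum_f_R0 (fun n => taylor_coef h x0 n * A n x0) N)
       <= Rabs (x1 - x0) * (M * g) * (1 / 2) ^ N).
  { intros A HA HAb N.
    destruct (MVT_gen (fun t => sum_f_R0 (fun n => taylor_coef h t n * A n t) N) x0 x1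
      (fun t => Derive_n h (S N) t / INR (fact N) * A N t)) as (c & Hc & Heq).
    { intros t Ht. apply (is_derive_Taylor_center (Derive_n h) A); [|intros; apply HA].
      intros n. apply Derive_correct. apply (proj1 Hh (S n)); [lia|].
      apply Hbetween; lra. }
    { intros t Ht. apply continuity_pt_filterlim.
      apply (ex_derive_continuous_R (fun t => sum_f_R0 (fun n => taylor_coef h t n * A n t) N)).
      eexists. apply (is_derive_Taylor_center (Derive_n h) A); [|intros; apply HA].
      intros n. apply Derive_correct. apply (proj1 Hh (S n)); [lia|]. now apply Hbetween. }
    rewrite Heq, Rabs_mult, (Rmult_comm (Rabs _)), !Rmult_assoc.
    apply Rmult_le_compat_l; [sign|].
    destruct (Hbetween c Hc) as [HcI Hcr].
    assert (Hd : Rabs (Derive_n h (S N) c / INR (fact N)) <= M * g ^ S N * INR (S N)).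
    { unfold Rdiv. pose proof (INR_fact_pos N).
      rewrite Rabs_mult, (Rabs_pos_eq (/ _)) by sign.
      apply (Rmult_le_reg_r (INR (fact N))); [lra|].
      rewrite Rmult_assoc, Rinv_l, Rmult_1_r, Rmult_assoc, <- INR_fact_S by lra.
      apply (proj2 Hh (S N) c HcI). }
    assert (HA2 : Rabs (A N c) <= r ^ N).
    { eapply Rle_trans; [apply HAb|]. apply pow_incr. split; [sign|exact Hcr]. }
    rewrite Rabs_mult.
    apply Rle_trans with (M * g ^ S N * INR (S N) * r ^ N).
    { apply Rmult_le_compat; auto using Rabs_pos. }
    replace (M * g ^ S N * INR (S N) * r ^ N) with (M * g * (INR (S N) * (g * r) ^ N))
      by (rewrite Rpow_mult_distr; simpl; ring).
    replace (M * (g * (1 / 2) ^ N)) with (M * g * (1 / 2) ^ N) by ring.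
    apply Rmult_le_compat_l; [sign|].
    apply Rle_trans with (2 ^ N * (1 / 4) ^ N).
    - assert (0 <= g * r) by sign.
      apply Rmult_le_compat; [sign|sign|apply INR_S_le_pow2|].
      apply pow_incr; lra.
    - right. rewrite <- Rpow_mult_distr. f_equal. field. }
  assert (Hpart : forall pr : C -> R,
     (forall n t, is_derive (fun s => pr ((z - RtoC s) ^ n)%C) t
                    (- (INR n * pr ((z - RtoC t) ^ pred n)%C))) ->
     (forall y, Rabs (pr y) <= Cmod y) -> (forall a y, pr (RtoC a * y)%C = a * pr y) ->
     Series (fun n => pr (RtoC (taylor_coef h x0 n) * (z - RtoC x0) ^ n)%C)
     = Series (fun n => pr (RtoC (taylor_coef h x1 n) * (z - RtoC x1) ^ n)%C)).
  { intros pr Hder Hle Hlin. apply (sum_limit_eq _ _ (Rabs (x1 - x0) * (M * g))).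
    - apply (ex_series_le_R _ _ (fun n => Hle _) (Hsum x0 Hin0)).
    - apply (ex_series_le_R _ _ (fun n => Hle _) (Hsum x1 Hin1)).
    - intros N. rewrite !(sum_eq (fun n => pr _) _ _ (fun n _ => Hlin _ _)).
      apply (Hcomp (fun n t => pr ((z - RtoC t) ^ n)%C) Hder).
      intros n t. rewrite <- Cmod_pow. apply Hle. }
  unfold Cpseries, Cseries. f_equal; apply Hpart.
  - intros n t. apply is_derive_Cpow_center.
  - apply re_le_Cmod.
  - intros a y. unfold Re, RtoC; simpl. ring.
  - intros n t. apply is_derive_Cpow_center.
  - apply Rabs_Im_le_Cmod.
  - intros a y. unfold Im, RtoC; simpl. ring.
Qed.

Lemma Cpseries_at_0 (c : nat -> R) : Cpseries c 0 = RtoC (c 0%nat).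
Proof.
  assert (Hser : forall a : nat -> R, (forall n, a (S n) = 0) -> Series a = a 0%nat).
  { intros a Ha.
    assert (H0 : is_series (fun n => a (S n)) 0).
    { apply (is_series_ext (fun _ => 0)); [intros; now rewrite Ha|apply is_series_zero]. }
    rewrite Series_incr_1.
    - rewrite (is_series_unique _ _ H0). ring.
    - apply (ex_series_incr_1 a). now exists 0. }
  apply (f_equal2 pair).
  - rewrite Hser.
    + simpl. ring.
    + intros n. rewrite Cpow_S. unfold Re, RtoC; simpl. ring.
  - rewrite Hser.
    + simpl. ring.
    + intros n. rewrite Cpow_S. unfold Im, RtoC; simpl. ring.
Qed.

Definition I_neighborhood (d : R) (z : C) : Prop :=
  exists x, I_closed x /\ Cmod (z - RtoC x)%C < d.

Lemma open_I_neighborhood (d : R) : open (I_neighborhood d).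
Proof.
  intros z (x & Hx & Hz).
  assert (He : 0 < (d - Cmod (z - RtoC x)%C) / 2) by lra.
  exists (mkposreal _ He). intros y Hy. exists x. split; [exact Hx|].
  destruct Hy as [Hy1 Hy2].
  change (Rabs (fst y - fst z) < (d - Cmod (z - RtoC x)%C) / 2) in Hy1.
  change (Rabs (snd y - snd z) < (d - Cmod (z - RtoC x)%C) / 2) in Hy2.
  replace (y - RtoC x)%C with (((fst y - fst z)%R, (snd y - snd z)%R) + (z - RtoC x))%C.
  - eapply Rle_lt_trans; [apply Cmod_triangle|].
    pose proof (Cmod_le_abs_sum (fst y - fst z) (snd y - snd z)). lra.
  - apply (f_equal2 pair); simpl; ring.
Qed.

Lemma I_neighborhood_clamp (d : R) (z : C) :
  0 < d < 1 / 2 -> I_neighborhood d z ->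
  Cmod (z - RtoC (clamp d (1 - d) (Re z)))%C <= 3 * d.
Proof.
  intros Hd (x & [Hx0 Hx1] & Hz). destruct z as [a b].
  assert (Ha : Rabs (a - x) < d).
  { eapply Rle_lt_trans; [|exact Hz]. apply (re_le_Cmod ((a, b) - RtoC x)%C). }
  assert (Hb : Rabs b < d).
  { pose proof (Rabs_Im_le_Cmod ((a, b) - RtoC x)%C) as Him.
    replace (Im ((a, b) - RtoC x)%C) with b in Him by (unfold Im; simpl; ring). lra. }
  simpl Re.
  replace ((a, b) - RtoC (clamp d (1 - d) a))%C with ((a - clamp d (1 - d) a, b) : C)
    by (unfold Cminus, Cplus, Copp, RtoC; simpl; f_equal; ring).
  eapply Rle_trans; [apply Cmod_le_abs_sum|].
  apply Rabs_def2 in Ha.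
  assert (Rabs (a - clamp d (1 - d) a) <= 2 * d); [|lra].
  unfold clamp, Rmax, Rmin. destruct (Rle_dec (1 - d) a);
    destruct (Rle_dec d _); apply Rabs_le; lra.
Qed.

(** Near [z] the extension is the Taylor series about the point of the slightly shrunk
    interval that is nearest to [Re z]; freezing that centre exhibits it as one power
    series. *)
Lemma holomorphic_extension (h : R -> R) (M g d : R) :
  0 <= M -> 0 < g -> 0 < d < 1 / 2 -> 36 * (g * d) <= 1 ->
  derivs_bounded h (analytic_bound M g) -> continuous_on I_closed h ->
  exists U : C -> C, holomorphic_on (I_neighborhood d) U /\ extends I_closed U h.
Proof.
  intros HM Hg Hd Hgd Hh Hcont.
  set (cen := fun z => clamp d (1 - d) (Re z)).
  assert (HcenI : forall z, I_open (cen z)).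
  { intros z. pose proof (clamp_in d (1 - d) (Re z) ltac:(lra)). unfold cen; split; lra. }
  set (U := fun z => Cpseries (taylor_coef h (cen z)) (z - RtoC (cen z))).
  assert (Hgd0 : 0 < g * d) by sign.
  assert (HM0 : 0 <= M / (3 * d) ^ 2).
  { sign. }
  assert (Hquad : forall z, I_neighborhood d z -> exists L, forall k, Cmod k <= 3 * d ->
     Cmod (U (z + k) - U z - L * k)%C <= 4 * (M / (3 * d) ^ 2) * Cmod k ^ 2).
  { intros z Hz. pose proof (I_neighborhood_clamp d z Hd Hz) as Hzc.
    destruct (Cpseries_quadratic (taylor_coef h (cen z)) M g (3 * d) (z - RtoC (cen z))%C)
      as [L HL]; try lra; auto.
    { intros n. now apply taylor_coef_bound. }
    exists L. intros k Hk. specialize (HL k Hk).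
    replace (U (z + k)%C)
      with (Cpseries (taylor_coef h (cen z)) (z - RtoC (cen z) + k)%C); [exact HL|].
    unfold U. replace (z - RtoC (cen z) + k)%C with (z + k - RtoC (cen z))%C by ring.
    apply taylor_center_independent with M g; auto.
    assert (H1 : Rabs (cen (z + k)%C - cen z) <= 3 * d).
    { unfold cen. eapply Rle_trans; [apply clamp_lipschitz|].
      replace (Re (z + k) - Re z) with (Re k) by (unfold Re; simpl; ring).
      eapply Rle_trans; [apply re_le_Cmod|exact Hk]. }
    assert (H2 : Cmod (z + k - RtoC (cen z))%C <= 6 * d).
    { replace (z + k - RtoC (cen z))%C with ((z - RtoC (cen z)) + k)%C by ring.
      eapply Rle_trans; [apply Cmod_triangle|]. unfold cen in *. lra. }
    assert (g * (Cmod (z + k - RtoC (cen z))%C + Rabs (cen (z + k)%C - cen z)) <= g * (9 * d))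
      by (apply Rmult_le_compat_l; lra).
    lra. }
  exists U. split.
  - intros z Hz. destruct (Hquad z Hz) as [L HL].
    apply (ex_derive_C_quadratic U z L (4 * (M / (3 * d) ^ 2)) (3 * d)); [lra|exact HL].
  - assert (Hopen : forall x, I_open x -> U (RtoC x) = RtoC (h x)).
    { intros x Hx. unfold U.
      rewrite (taylor_center_independent h M g (cen (RtoC x)) x (RtoC x)); auto.
      - replace (RtoC x - RtoC x)%C with (RtoC 0) by ring. rewrite Cpseries_at_0.
        unfold taylor_coef. simpl. f_equal. field.
      - assert (H1 : Rabs (x - cen (RtoC x)) <= d).
        { unfold cen, clamp, Rmax, Rmin, RtoC, Re; simpl. destruct Hx.
          destruct (Rle_dec (1 - d) x); destruct (Rle_dec d _); apply Rabs_le; lra. }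
        rewrite <- RtoC_minus, Cmod_R.
        assert (g * (Rabs (x - cen (RtoC x)) + Rabs (x - cen (RtoC x))) <= g * (2 * d))
          by (apply Rmult_le_compat_l; lra).
        lra. }
    intros x Hx.
    assert (Hz : I_neighborhood d (RtoC x)).
    { exists x. split; [exact Hx|]. replace (RtoC x - RtoC x)%C with (RtoC 0) by ring.
      rewrite Cmod_0; lra. }
    destruct (Hquad _ Hz) as [L HL].
    set (B := Cmod L + 4 * (M / (3 * d) ^ 2) * (3 * d) + 1).
    assert (HB : 0 < B).
    { unfold B. pose proof (Cmod_ge_0 L).
      assert (0 <= 4 * (M / (3 * d) ^ 2) * (3 * d)) by sign. lra. }
    apply NNPP; intros Hne.
    assert (He : 0 < Cmod (U (RtoC x) - RtoC (h x))%C).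
    { apply Cmod_gt_0. intros H0. apply Hne.
      replace (U (RtoC x)) with ((U (RtoC x) - RtoC (h x)) + RtoC (h x))%C by ring.
      rewrite H0. ring. }
    set (e := Cmod (U (RtoC x) - RtoC (h x))%C) in *.
    assert (He2 : 0 < e / 2) by lra.
    destruct (proj1 (filterlim_locally _ _) (Hcont x Hx) (mkposreal _ He2)) as [d' Hball].
    pose proof (cond_pos d') as Hdp.
    set (q := Rmin (d' / 2) (Rmin d (e / (2 * B)))).
    assert (Hq : 0 < q).
    { unfold q. repeat apply Rmin_glb_lt; try lra. sign. }
    assert (Hq1 : q <= d' / 2) by apply Rmin_l.
    assert (Hq2 : q <= d) by (eapply Rle_trans; [apply Rmin_r|apply Rmin_l]).
    assert (Hq3 : q <= e / (2 * B)) by (eapply Rle_trans; [apply Rmin_r|apply Rmin_r]).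
    assert (exists y, I_open y /\ Rabs (y - x) = q) as (y & Hy & Hyx).
    { destruct Hx as [Hx0 Hx1]. destruct (Rle_dec x (1 / 2)).
      - exists (x + q). split; [split; lra|]. rewrite Rabs_pos_eq; lra.
      - exists (x - q). split; [split; lra|]. rewrite Rabs_left; lra. }
    assert (Hyc : I_closed y) by (destruct Hy; split; lra).
    assert (Hb1 : Rabs (h y - h x) < e / 2).
    { apply (Hball y); [|exact Hyc]. change (Rabs (y - x) < d'). lra. }
    assert (Hk : Cmod (RtoC (y - x)) = q) by now rewrite Cmod_R.
    specialize (HL (RtoC (y - x)) ltac:(lra)).
    replace (RtoC x + RtoC (y - x))%C with (RtoC y) in HL by (rewrite RtoC_minus; ring).
    rewrite Hopen, Hk in HL by exact Hy.
    assert (Hb2 : Cmod (U (RtoC x) - RtoC (h y))%C <= B * q - q).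
    { replace (U (RtoC x) - RtoC (h y))%C
        with (- (RtoC (h y) - U (RtoC x) - L * RtoC (y - x)) + - (L * RtoC (y - x)))%C by ring.
      eapply Rle_trans; [apply Cmod_triangle|]. rewrite !Cmod_opp, Cmod_mult, Hk.
      assert (4 * (M / (3 * d) ^ 2) * q ^ 2 <= 4 * (M / (3 * d) ^ 2) * (3 * d) * q).
      { replace (4 * (M / (3 * d) ^ 2) * q ^ 2) with (4 * (M / (3 * d) ^ 2) * q * q) by ring.
        apply Rmult_le_compat_r; [lra|]. apply Rmult_le_compat_l; lra. }
      unfold B. lra. }
    assert (HBq : B * q <= e / 2).
    { apply Rle_trans with (B * (e / (2 * B))); [apply Rmult_le_compat_l; lra|].
      right; field; lra. }
    assert (e <= Cmod (U (RtoC x) - RtoC (h y))%C + Rabs (h y - h x)); [|lra].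
    unfold e. replace (U (RtoC x) - RtoC (h x))%C
      with ((U (RtoC x) - RtoC (h y)) + RtoC (h y - h x))%C by (rewrite RtoC_minus; ring).
    eapply Rle_trans; [apply Cmod_triangle|]. rewrite Cmod_R. lra.
Qed.

Lemma pow_le_fact_exp (t : R) (n : nat) : 0 <= t -> t ^ n <= INR (fact n) * exp t.
Proof.
  intros Ht. pose proof (INR_fact_pos n).
  apply (Rmult_le_reg_l (/ INR (fact n))); [sign|].
  rewrite <- Rmult_assoc, Rinv_l, Rmult_1_l by lra.
  apply Rle_trans with (sum_f_R0 (fun k => t ^ k / INR (fact k)) n);
    [|now apply exp_ge_taylor].
  assert (Hpos : forall k, 0 <= t ^ k / INR (fact k)).
  { intros k. apply Rmult_le_pos; [sign|].
    sign. }
  rewrite Rmult_comm. destruct n as [|n]; [simpl; lra|]. rewrite tech5.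
  pose proof (cond_pos_sum _ n Hpos). unfold Rdiv in *. lra.
Qed.

(** For fixed [i] and [mu] the polynomial factor is at most a constant times [e^n], and
    [max n (1/mu) ^ n <= n! e^n (1 + e^(1/mu))], so the radius of analyticity depends
    neither on [i] nor on [mu]. *)
Lemma weight_le_analytic_bound (i : nat) (mu gam : R) :
  0 < mu <= 1 -> 0 < gam ->
  exists A, 0 < A /\ forall n, weight i mu gam n <= analytic_bound A (9 * gam) n.
Proof.
  intros Hmu Hg.
  exists (INR (fact i) * exp (INR i + 1) * (1 + exp (/ mu))).
  pose proof (INR_fact_pos i) as Hfi. pose proof (exp_pos (INR i + 1)) as Hei.
  pose proof (exp_pos (/ mu)) as Hem.
  split; [sign|].
  intros n. unfold weight, analytic_bound.
  pose proof (pos_INR i). pose proof (pos_INR n). pose proof (INR_fact_pos n) as Hfn.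
  assert (Hen : 0 < exp (INR n)) by apply exp_pos.
  assert (He1 : 1 <= exp (INR n)).
  { rewrite <- exp_0. destruct (Req_dec (INR n) 0) as [->|]; [lra|].
    left; apply exp_increasing; lra. }
  assert (H1 : ((INR i + INR n) * mu + 1) ^ i <= INR (fact i) * exp (INR i + 1) * exp (INR n)).
  { apply Rle_trans with ((INR i + INR n + 1) ^ i).
    - apply pow_incr. assert (0 <= (INR i + INR n) * mu) by sign.
      assert ((INR i + INR n) * mu <= (INR i + INR n) * 1) by (apply Rmult_le_compat_l; lra).
      lra.
    - replace (INR i + INR n + 1) with ((INR i + 1) + INR n) by ring.
      rewrite Rmult_assoc, <- exp_plus. apply pow_le_fact_exp; lra. }
  assert (H2 : Rmax (INR n) (/ mu) ^ n <= INR (fact n) * (exp (INR n) * (1 + exp (/ mu)))).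
  { assert (0 < / mu) by sign.
    assert (0 <= exp (INR n) * exp (/ mu)) by sign.
    unfold Rmax. destruct (Rle_dec (INR n) (/ mu)).
    - eapply Rle_trans; [apply pow_le_fact_exp; lra|]. apply Rmult_le_compat_l; [lra|].
      rewrite Rmult_plus_distr_l.
      assert (1 * exp (/ mu) <= exp (INR n) * exp (/ mu)) by (apply Rmult_le_compat_r; lra).
      lra.
    - eapply Rle_trans; [apply pow_le_fact_exp; lra|]. apply Rmult_le_compat_l; lra. }
  assert (H3 : exp (INR n) * exp (INR n) <= 9 ^ n).
  { replace 9 with (3 * 3) by ring. rewrite Rpow_mult_distr.
    apply Rmult_le_compat; auto using exp_INR_le_pow3; lra. }
  assert (Hgn : 0 < gam ^ n) by sign.
  set (K := INR (fact i) * exp (INR i + 1)) in *.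
  assert (HK : 0 < K) by sign.
  assert (0 <= (INR i + INR n) * mu) by sign.
  apply Rle_trans with (K * exp (INR n) * gam ^ n *
    (INR (fact n) * (exp (INR n) * (1 + exp (/ mu))))).
  - apply Rmult_le_compat; auto.
    + sign.
    + apply pow_le. left. apply weight_max_pos; lra.
    + apply Rmult_le_compat_r; [lra|exact H1].
  - rewrite Rpow_mult_distr.
    replace (K * exp (INR n) * gam ^ n * (INR (fact n) * (exp (INR n) * (1 + exp (/ mu)))))
      with (K * (1 + exp (/ mu)) * gam ^ n * INR (fact n) * (exp (INR n) * exp (INR n))) by ring.
    replace (K * (1 + exp (/ mu)) * (9 ^ n * gam ^ n) * INR (fact n))
      with (K * (1 + exp (/ mu)) * gam ^ n * INR (fact n) * 9 ^ n) by ring.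
    apply Rmult_le_compat_l; [|exact H3].
    repeat sign.
Qed.

(** * The coupled recursion *)

Lemma derivs_bounded_zero (B : nat -> R) :
  (forall n, 0 <= B n) -> derivs_bounded (fun _ => 0) B.
Proof.
  assert (Hz : forall n x, Derive_n (fun _ => 0) n x = 0).
  { intros [|n] x; [reflexivity|apply Derive_n_const]. }
  intros HB. split.
  - intros n m x _ _. apply ex_derive_ext with (fun _ => 0); [intros; now rewrite Hz|].
    apply ex_derive_const.
  - intros n x _. now rewrite Hz, Rabs_R0.
Qed.

Lemma coercive_a11 (a11 a12 a21 a22 : R -> R) (alpha x : R) :
  coercive a11 a12 a21 a22 alpha -> I_closed x -> alpha ^ 2 <= a11 x.
Proof. intros H Hx. specialize (H x Hx 1 0). simpl in *. lra. Qed.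

(** Testing the form with the first column [(a22, - a21)] of the adjugate matrix gives
    [a22 det A >= alpha^2 a22^2]. *)
Lemma coercive_det (a11 a12 a21 a22 : R -> R) (alpha x : R) :
  0 < alpha -> coercive a11 a12 a21 a22 alpha -> I_closed x ->
  alpha ^ 4 <= a22 x * a11 x - a12 x * a21 x.
Proof.
  intros Ha H Hx.
  assert (H22 : alpha ^ 2 <= a22 x) by (specialize (H x Hx 0 1); simpl in *; lra).
  specialize (H x Hx (a22 x) (- a21 x)).
  assert (Ha2 : 0 < alpha ^ 2) by sign.
  assert (H1 : a22 x * (alpha ^ 2 * a22 x) <= a22 x * (a22 x * a11 x - a12 x * a21 x)).
  { assert (0 <= alpha ^ 2 * a21 x ^ 2) by sign.
    apply Rge_le in H. eapply Rle_trans; [|eapply Rle_trans; [exact H|]]; [|right; ring].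
    replace (a22 x * (alpha ^ 2 * a22 x)) with (alpha ^ 2 * a22 x ^ 2) by ring.
    replace (- a21 x) with (-1 * a21 x) by ring. rewrite Rpow_mult_distr.
    replace ((-1) ^ 2) with 1 by ring. lra. }
  apply Rmult_le_reg_l in H1; [|lra].
  apply Rle_trans with (alpha ^ 2 * a22 x); [|exact H1].
  replace (alpha ^ 4) with (alpha ^ 2 * alpha ^ 2) by ring.
  apply Rmult_le_compat_l; lra.
Qed.

Definition smooth_const (c0 C : R) : R :=
  2 * C * (1 + 2 * C * (reaction_const c0 C * (2 + 2 * C)))
  + reaction_const c0 C * (2 + 2 * C).

Lemma reaction_const_ge_1 (c0 C : R) : 0 < c0 -> 0 < C -> 1 <= reaction_const c0 C.
Proof.
  intros Hc0 HC. unfold reaction_const. pose proof (Rinv_0_lt_compat c0 Hc0).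
  assert (0 <= (8 + C) * (1 + / c0)) by sign. lra.
Qed.

Lemma smooth_const_pos (c0 C : R) : 0 < c0 -> 0 < C -> 0 < smooth_const c0 C.
Proof.
  intros Hc0 HC. pose proof (reaction_const_ge_1 c0 C Hc0 HC). unfold smooth_const.
  assert (0 < reaction_const c0 C * (2 + 2 * C)) by sign.
  assert (0 < 2 * C * (reaction_const c0 C * (2 + 2 * C))) by sign.
  assert (0 < 2 * C * (1 + 2 * C * (reaction_const c0 C * (2 + 2 * C)))) by sign. lra.
Qed.

(** [F] stands for the source [f_i + mu^2 u_(i-2)''] and [q], [r], [b] for [a21 / a11],
    [1 / a11], [a12]; [v] is estimated from its equation, then [u] from the algebraic one. *)
Lemma smooth_step (c q r b : R -> R) (F H u v : R -> R) (c0 C rho mu gam Phi Z : R) (i : nat) :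
  0 < mu <= 1 -> 0 < c0 -> 0 < C -> 0 < rho -> 1 <= gam -> 2 * rho <= gam ->
  2 * C + 1 <= gam ^ 2 -> 0 <= Phi -> 0 <= Z ->
  (forall x, I_open x -> c0 <= c x) ->
  derivs_bounded c (analytic_bound C rho) -> derivs_bounded q (analytic_bound C rho) ->
  derivs_bounded r (analytic_bound C rho) -> derivs_bounded b (analytic_bound C rho) ->
  derivs_bounded F (fun n => Phi * weight i mu gam n) ->
  derivs_bounded H (fun n => Phi * weight i mu gam n) ->
  classical I_open I_closed v ->
  (forall x, I_open x -> - mu ^ 2 * Derive_n v 2 x + c x * v x = H x - q x * F x) ->
  (forall x, I_open x -> u x = r x * (F x - b x * v x)) ->
  Rabs (v 0) <= Z * weight i mu gam 0 -> Rabs (v 1) <= Z * weight i mu gam 0 ->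
  derivs_bounded v (fun n => smooth_const c0 C * (Phi + Z) * weight i mu gam n) /\
  derivs_bounded u (fun n => smooth_const c0 C * (Phi + Z) * weight i mu gam n).
Proof.
  intros Hmu Hc0 HC Hr Hg1 Hg2 Hg3 HPhi HZ Hcl Hc Hq Hrb Hb HF HH Hv Heq Hu Hv0 Hv1.
  assert (HW : forall n, 0 < weight i mu gam n) by (intros; apply weight_pos; lra).
  set (Y := Phi + 2 * C * Phi).
  assert (HCP : 0 <= C * Phi) by sign.
  assert (HY : 0 <= Y) by (unfold Y; lra).
  set (k := reaction_const c0 C).
  assert (Hk : 1 <= k) by now apply reaction_const_ge_1.
  assert (HG : derivs_bounded (fun x => 1 * H x + (-1) * (q x * F x))
                 (fun n => Y * weight i mu gam n)).
  { eapply derivs_bounded_le; [|apply derivs_bounded_lin; [exact HH|]].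
    2: { apply (derivs_bounded_weight_mult q F C rho Phi i mu gam); auto; lra. }
    intros n. simpl. rewrite Rabs_R1, Rabs_left by lra. unfold Y. right; ring. }
  assert (Hvb : derivs_bounded v (fun n => k * (Y + Z) * weight i mu gam n)).
  { apply (reaction_diffusion_bound c v _ c0 C rho mu gam Y Z i) with (12 := HG); auto.
    intros x Hx. rewrite Heq by exact Hx. ring. }
  set (X := k * (2 + 2 * C) * (Phi + Z)).
  assert (HX : k * (Y + Z) <= X).
  { unfold X, Y. rewrite (Rmult_assoc k). apply Rmult_le_compat_l; [lra|].
    assert (0 <= C * Z) by sign. lra. }
  assert (Hvb' : derivs_bounded v (fun n => X * weight i mu gam n)).
  { eapply derivs_bounded_le; [|exact Hvb]. intros n. simpl.
    apply Rmult_le_compat_r; [left; apply HW|exact HX]. }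
  assert (HX0 : 0 <= X).
  { eapply Rle_trans; [|exact HX]. sign. }
  assert (HCX : 0 <= C * X) by sign.
  assert (Hub : derivs_bounded u (fun n => 2 * C * (Phi + 2 * C * X) * weight i mu gam n)).
  { apply derivs_bounded_ext with (fun x => r x * (1 * F x + (-1) * (b x * v x))).
    { intros x Hx. rewrite Hu by exact Hx. ring. }
    apply derivs_bounded_weight_mult with rho; auto; try lra.
    eapply derivs_bounded_le; [|apply derivs_bounded_lin; [exact HF|]].
    2: { apply (derivs_bounded_weight_mult b v C rho X i mu gam); auto; lra. }
    intros n. simpl. rewrite Rabs_R1, Rabs_left by lra. right; ring. }
  assert (HCC : 0 <= 2 * C * (1 + 2 * C * (k * (2 + 2 * C)))).
  { assert (0 <= k * (2 + 2 * C)) by sign.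
    assert (0 <= 2 * C * (k * (2 + 2 * C))) by sign.
    sign. }
  split.
  - eapply derivs_bounded_le; [|exact Hvb']. intros n. simpl.
    apply Rmult_le_compat_r; [left; apply HW|]. unfold smooth_const, X. fold k.
    apply Rmult_le_compat_r; lra.
  - eapply derivs_bounded_le; [|exact Hub]. intros n. simpl.
    apply Rmult_le_compat_r; [left; apply HW|]. unfold smooth_const. fold k.
    apply Rle_trans with (2 * C * (1 + 2 * C * (k * (2 + 2 * C))) * (Phi + Z)).
    + rewrite (Rmult_assoc (2 * C)). apply Rmult_le_compat_l; [lra|].
      unfold X. lra.
    + apply Rmult_le_compat_r; [lra|].
      assert (0 <= k * (2 + 2 * C)) by sign. lra.
Qed.

Lemma analytic_data_geometric (a : R -> R) (B gam C rho : R) :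
  0 < B <= C -> 0 < gam <= rho -> analytic_data a B gam ->
  geometric C rho (taylor_left a) /\ geometric C rho (taylor_right a).
Proof.
  intros HB Hg Ha.
  assert (H : forall k x, I_closed x -> Rabs (Derive_n a k x / INR (fact k)) <= C * rho ^ k).
  { intros k x Hx. pose proof (INR_fact_pos k).
    rewrite Rabs_div, (Rabs_pos_eq (INR _)) by lra. apply Rle_div_l; [lra|].
    eapply Rle_trans; [apply (analytic_data_bound a B gam Ha k x Hx)|].
    now apply analytic_bound_mono. }
  split; intros k.
  - apply H. split; lra.
  - unfold taylor_right, Rdiv. rewrite Rmult_assoc, Rabs_mult, pow_1_abs, Rmult_1_l.
    apply H. split; lra.
Qed.

Lemma layer_rep_at_0 (beta s A : R) (l : nat) (w : R -> R) :
  layer_rep beta s A l w -> Rabs (w 0) <= A.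
Proof.
  intros (p & _ & Hp & Hw). rewrite Hw by lra. unfold layer.
  rewrite epoly_at_0, Rmult_0_r, exp_0, Rmult_1_r. specialize (Hp 0%nat). simpl in Hp. lra.
Qed.

Lemma layer_weight_le (Lam mu : R) (l : nat) :
  0 < Lam -> 0 < mu ->
  layer_weight Lam mu l <= Lam ^ l * (INR (l + 2) * mu + 1) ^ (l + 2).
Proof.
  intros HL Hmu. unfold layer_weight. apply Rmult_le_compat_l; [sign|].
  assert (0 <= INR l * mu) by sign.
  assert (INR l * mu <= INR (l + 2) * mu)
    by (apply Rmult_le_compat_r; [lra|apply le_INR; lia]).
  apply Rle_trans with ((INR (l + 2) * mu + 1) ^ l); [apply pow_incr; lra|].
  apply Rle_pow; [lra|lia].
Qed.

Lemma layer_family_entire (beta s M N Lam mu : R) (b11 b12 b21 b22 : nat -> R)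
    (w : nat -> R) (uh vh : nat -> R -> R) :
  0 < beta -> 0 < s <= 1 -> 0 <= M -> 0 <= N -> 0 < Lam -> 0 < mu ->
  layer_part b11 b12 b21 b22 mu w uh vh ->
  (forall i, layer_rep beta s (M * layer_weight Lam mu i) i (uh i)) ->
  (forall i, layer_rep beta s (N * M * layer_weight Lam mu i) i (vh (i + 2)%nat)) ->
  exists U V : nat -> C -> C,
    (forall i, (entire (U i) /\ extends halfline_closed (U i) (uh i)) /\
               (entire (V i) /\ extends halfline_closed (V i) (vh i))) /\
    (forall z, V 0%nat z = 0%C /\ V 1%nat z = 0%C) /\
    (forall i z,
       Cmod (V (i + 2)%nat z) <= layer_bound (N * M) (6 * Lam) 1 beta mu i z /\
       Cmod (U i z) <= layer_bound M (6 * Lam) 1 beta mu i z).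
Proof.
  intros Hb Hs HM HN HL Hmu [Hv01 _] Hu Hv.
  destruct (functional_choice (fun i F => entire F /\ extends halfline_closed F (uh i) /\
     forall z, Cmod (F z) <= layer_bound M (6 * Lam) 1 beta mu i z)) as [U HU].
  { intros i. apply layer_rep_entire with s; auto. }
  destruct (functional_choice (fun i F => entire F /\ extends halfline_closed F (vh (i + 2)%nat) /\
     forall z, Cmod (F z) <= layer_bound (N * M) (6 * Lam) 1 beta mu i z)) as [V HV].
  { intros i. apply layer_rep_entire with s; auto. now apply Rmult_le_pos. }
  assert (H0 : entire (fun _ => RtoC 0)).
  { intros z _. apply (ex_derive_const (K := C_AbsRing) (V := C_NormedModule)). }
  exists U, (fun i => match i return C -> C with S (S l) => V l | _ => fun _ => RtoC 0 end).
  split; [|split].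
  - intros i. split; [split; apply HU|].
    destruct i as [|[|l]].
    + split; [exact H0|]. intros x Hx. now rewrite (proj1 (Hv01 x Hx)).
    + split; [exact H0|]. intros x Hx. now rewrite (proj2 (Hv01 x Hx)).
    + destruct (HV l) as (HV1 & HV2 & _). rewrite Nat.add_comm in HV2. now split.
  - intros z. now split.
  - intros i z. rewrite Nat.add_comm. split; [apply HV|apply HU].
Qed.

Lemma weight_le_smooth_bound (A K mu gam : R) (i n : nat) :
  0 <= A -> 0 <= K -> 0 < mu -> 0 < gam ->
  A * K ^ i * weight i mu gam n <= smooth_bound A K gam mu i n.
Proof.
  intros HA HK Hmu Hg. unfold smooth_bound, weight.
  pose proof (INR_fact_pos i).
  assert (Hi : 1 <= INR i ^ i / INR (fact i)).
  { apply (Rmult_le_reg_r (INR (fact i))); [lra|].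
    unfold Rdiv. rewrite Rmult_assoc, Rinv_l, Rmult_1_r, Rmult_1_l by lra.
    pose proof (fact_le_pow_fact i i (INR i) ltac:(lia) (Rle_refl _)) as Hf.
    rewrite Nat.sub_diag in Hf. simpl (INR (fact 0)) in Hf. lra. }
  pose proof (weight_base_ge_1 i n mu Hmu). pose proof (weight_max_pos n mu Hmu).
  set (T := A * K ^ i * ((INR i + INR n) * mu + 1) ^ i * (gam ^ n * Rmax (INR n) (/ mu) ^ n)).
  assert (HT : 0 <= T).
  { unfold T. apply Rmult_le_pos; apply Rmult_le_pos; try (apply pow_le; lra).
    apply Rmult_le_pos; [exact HA|sign]. }
  apply Rle_trans with (T * (INR i ^ i / INR (fact i))); [|right; unfold T; ring].
  apply Rle_trans with (T * 1); [right; unfold T; ring|].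
  apply Rmult_le_compat_l; lra.
Qed.

(** The three cases are the data for [i = 0], no source for [i = 1], and afterwards the
    second derivative of the function two orders below. *)
Lemma source_bound (f : R -> R) (u : nat -> R -> R) (C rho mu gam M Lam : R) (i : nat) :
  0 < mu <= 1 -> 0 < C -> 0 < rho -> rho <= gam -> 0 < M -> 0 < Lam ->
  derivs_bounded f (analytic_bound C rho) ->
  (forall l, (l < i)%nat ->
     derivs_bounded (u l) (fun n => M * Lam ^ l * weight l mu gam n)) ->
  derivs_bounded (fun x => datum f i x + mu ^ 2 * d2_prev u i x)
    (fun n => match i with
              | O => C | S O => 0 | S (S l) => 9 * gam ^ 2 * (M * Lam ^ l)
              end * weight i mu gam n).
Proof.
  intros Hmu HC Hr Hrg HM HL Hf IH.
  assert (Hmu2 : 0 < mu ^ 2) by sign.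
  destruct i as [|[|l]].
  - apply derivs_bounded_ext with f; [intros; simpl; ring|].
    eapply derivs_bounded_le; [|exact Hf]. intros n.
    apply analytic_bound_le_weight; lra.
  - apply derivs_bounded_ext with (fun _ => 0); [intros; simpl; ring|].
    apply derivs_bounded_zero. intros; lra.
  - apply derivs_bounded_ext with (fun x => mu ^ 2 * Derive_n (u l) 2 x + 0 * Derive_n (u l) 2 x).
    { intros; simpl; ring. }
    assert (H2 := derivs_bounded_derive2 _ _ (IH l ltac:(lia))).
    eapply derivs_bounded_le; [|apply derivs_bounded_lin; exact H2].
    intros n. simpl. rewrite Rabs_R0, Rmult_0_l, Rplus_0_r, Rabs_pos_eq by (simpl in *; lra).
    pose proof (weight_source l n mu gam ltac:(lra) ltac:(lra)) as Hw.
    replace (l + 2)%nat with (S (S l)) in Hw by lia.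
    assert (HML : 0 < M * Lam ^ l) by sign.
    apply (Rmult_le_compat_l (M * Lam ^ l)) in Hw; [|lra]. simpl in Hw. lra.
Qed.

(** All estimates in one induction on the order [i].  The boundary values of [v_i] come from
    the layer functions of order [i - 2], its source from [u_(i-2)], and both gain the factor
    [Lam^-2]; the layer function [uh_i] takes its boundary value from [u_i] itself, and its
    remaining sources are small for large [Lam]. *)
Lemma recursion_bounds (f g a11 a12 a21 a22 : R -> R)
    (c0 C rho gam alpha s M N Lam mu : R) (u v uL vL uR vR : nat -> R -> R) :
  0 < mu <= 1 -> 0 < c0 -> 0 < C -> 0 < rho -> 1 <= gam -> 2 * rho <= gam ->
  2 * C + 1 <= gam ^ 2 -> 0 < s -> 2 * s <= alpha -> 1 <= Lam -> 0 < M ->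
  smooth_const c0 C * C <= M -> N = 4 * C / s ^ 2 ->
  smooth_const c0 C * (9 * gam ^ 2 + N) <= Lam ^ 2 ->
  2 * rho / (s * Lam) <= 1 / 2 ->
  C * (2 * (2 * rho / (s * Lam)) + 2 * (N / Lam ^ 2)) <= s ^ 2 ->
  2 * (2 * rho / (s * Lam)) + 2 * (N / Lam ^ 2) <= 3 ->
  coercive a11 a12 a21 a22 alpha ->
  derivs_bounded f (analytic_bound C rho) -> derivs_bounded g (analytic_bound C rho) ->
  derivs_bounded (fun x => / a11 x) (analytic_bound C rho) ->
  derivs_bounded (fun x => a21 x / a11 x) (analytic_bound C rho) ->
  derivs_bounded a12 (analytic_bound C rho) ->
  derivs_bounded (fun x => (a22 x * a11 x - a12 x * a21 x) / a11 x) (analytic_bound C rho) ->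
  (forall x, I_open x -> c0 <= (a22 x * a11 x - a12 x * a21 x) / a11 x) ->
  geometric C rho (taylor_left a11) ->
  geometric C rho (taylor_left a12) ->
  geometric C rho (taylor_left a21) ->
  geometric C rho (taylor_left a22) ->
  geometric C rho (taylor_right a11) ->
  geometric C rho (taylor_right a12) ->
  geometric C rho (taylor_right a21) ->
  geometric C rho (taylor_right a22) ->
  recursion f g a11 a12 a21 a22 mu u v uL vL uR vR ->
  forall i,
    (derivs_bounded (v i) (fun n => M * Lam ^ i * weight i mu gam n) /\
     derivs_bounded (u i) (fun n => M * Lam ^ i * weight i mu gam n)) /\
    (layer_rep (sqrt (a11 0)) s (M * layer_weight Lam mu i) i (uL i) /\
     layer_rep (sqrt (a11 0)) s (N * M * layer_weight Lam mu i) i (vL (i + 2)%nat)) /\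
    (layer_rep (sqrt (a11 1)) s (M * layer_weight Lam mu i) i (uR i) /\
     layer_rep (sqrt (a11 1)) s (N * M * layer_weight Lam mu i) i (vR (i + 2)%nat)).
Proof.
  intros Hmu Hc0 HC Hr Hg1 Hg2 Hg3 Hs Hsa HL HM HMC HN HL2 Ht Hc1 Hc2 Hco
    Hf Hg Hinv Hq Ha12 Hc Hcl Hl11 Hl12 Hl21 Hl22 Hr11 Hr12 Hr21 Hr22 [Hsm [HLp HRp]].
  assert (HN0 : 0 < N) by (rewrite HN; apply Rdiv_lt_0_compat; [lra|sign]).
  assert (Hsqrt : forall x, I_closed x -> 2 * s <= sqrt (a11 x) /\ sqrt (a11 x) ^ 2 = a11 x).
  { intros x Hx. pose proof (coercive_a11 _ _ _ _ _ _ Hco Hx) as Ha.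
    pose proof (pow2_ge_0 alpha). split.
    - apply Rle_trans with alpha; [exact Hsa|].
      rewrite <- (sqrt_pow2 alpha) by lra. now apply sqrt_le_1_alt.
    - apply pow2_sqrt. lra. }
  destruct (Hsqrt 0 ltac:(split; lra)) as [HbL HbL2].
  destruct (Hsqrt 1 ltac:(split; lra)) as [HbR HbR2].
  set (K := smooth_const c0 C) in *.
  assert (HK : 0 < K) by now apply smooth_const_pos.
  assert (HL0 : forall l, 0 < Lam ^ l) by (intros; sign).
  induction i as [i IH] using lt_wf_ind.
  destruct (Hsm i) as (Hvcl & Hveq & Hv0 & Hv1 & Hucont & Hueq).
  set (Phi := match i with O => C | S O => 0 | S (S l) => 9 * gam ^ 2 * (M * Lam ^ l) end).
  set (Z := match i with S (S l) => N * (M * Lam ^ l) | _ => 0 end).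
  assert (HMl : forall l, 0 < M * Lam ^ l) by (intros; sign).
  assert (HPhi : 0 <= Phi).
  { unfold Phi. destruct i as [|[|l]]; try lra.
    apply Rmult_le_pos; [sign|left; apply HMl]. }
  assert (HZ : 0 <= Z).
  { unfold Z. destruct i as [|[|l]]; try lra. apply Rmult_le_pos; [lra|left; apply HMl]. }
  assert (HF : derivs_bounded (fun x => datum f i x + mu ^ 2 * d2_prev u i x)
                 (fun n => Phi * weight i mu gam n)).
  { apply source_bound with rho; auto; try lra. intros l Hl. apply (IH l Hl). }
  assert (HG : derivs_bounded (datum g i) (fun n => Phi * weight i mu gam n)).
  { unfold Phi. destruct i as [|l].
    - eapply derivs_bounded_le; [|exact Hg]. intros n. apply analytic_bound_le_weight; lra.
    - apply derivs_bounded_zero. intros n.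
      apply Rmult_le_pos; [exact HPhi|left; apply weight_pos; lra]. }
  assert (Hbd : forall (vh : nat -> R -> R) beta,
     (vh 0%nat 0 = 0 /\ vh 1%nat 0 = 0) ->
     (forall l, (l < i)%nat ->
        layer_rep beta s (N * M * layer_weight Lam mu l) l (vh (l + 2)%nat)) ->
     Rabs (- vh i 0) <= Z * weight i mu gam 0).
  { intros vh beta [Hz0 Hz1] Hrep. rewrite Rabs_Ropp, weight_0. unfold Z.
    destruct i as [|[|l]].
    - rewrite Hz0, Rabs_R0. lra.
    - rewrite Hz1, Rabs_R0. lra.
    - specialize (Hrep l ltac:(lia)). apply layer_rep_at_0 in Hrep.
      replace (l + 2)%nat with (S (S l)) in Hrep by lia.
      eapply Rle_trans; [exact Hrep|].
      pose proof (layer_weight_le Lam mu l ltac:(lra) ltac:(lra)) as Hw.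
      replace (l + 2)%nat with (S (S l)) in Hw by lia.
      apply (Rmult_le_compat_l (N * M)) in Hw; [|sign].
      eapply Rle_trans; [exact Hw|]. right; ring. }
  assert (Hh0 : halfline_closed 0) by (unfold halfline_closed; lra).
  destruct (smooth_step _ _ _ _ _ _ (u i) (v i) c0 C rho mu gam Phi Z i
    ltac:(lra) Hc0 HC Hr Hg1 Hg2 Hg3 HPhi HZ Hcl Hc Hq Hinv Ha12 HF HG Hvcl Hveq Hueq)
    as [Hvb Hub].
  { rewrite Hv0. apply (Hbd vL (sqrt (a11 0))).
    - exact (proj1 HLp 0 Hh0).
    - intros l Hl. apply (IH l Hl). }
  { rewrite Hv1. apply (Hbd vR (sqrt (a11 1))).
    - exact (proj1 HRp 0 Hh0).
    - intros l Hl. apply (IH l Hl). }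
  (* the constants close the induction: the gain of two orders is [Lam^2] *)
  assert (Hclose : smooth_const c0 C * (Phi + Z) <= M * Lam ^ i).
  { fold K. unfold Phi, Z. destruct i as [|[|l]].
    - simpl. lra.
    - rewrite Rplus_0_r, Rmult_0_r. left; apply HMl.
    - replace (9 * gam ^ 2 * (M * Lam ^ l) + N * (M * Lam ^ l))
        with ((9 * gam ^ 2 + N) * (M * Lam ^ l)) by ring.
      replace (M * Lam ^ S (S l)) with (Lam ^ 2 * (M * Lam ^ l)) by (simpl; ring).
      rewrite <- Rmult_assoc. apply Rmult_le_compat_r; [left; apply HMl|exact HL2]. }
  assert (Hvb' : derivs_bounded (v i) (fun n => M * Lam ^ i * weight i mu gam n)).
  { eapply derivs_bounded_le; [|exact Hvb]. intros n.
    apply Rmult_le_compat_r; [left; apply weight_pos; lra|exact Hclose]. }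
  assert (Hub' : derivs_bounded (u i) (fun n => M * Lam ^ i * weight i mu gam n)).
  { eapply derivs_bounded_le; [|exact Hub]. intros n.
    apply Rmult_le_compat_r; [left; apply weight_pos; lra|exact Hclose]. }
  assert (Hw : forall x, I_closed x -> Rabs (u i x) <= M * layer_weight Lam mu i).
  { intros x Hx. apply (continuous_on_endpoint_bound (u i)); auto.
    intros y Hy. eapply Rle_trans; [apply (proj2 Hub' 0%nat y Hy)|].
    rewrite weight_0. unfold layer_weight. right; ring. }
  split; [now split|]. split.
  - apply (layer_step (taylor_left a11) (taylor_left a12) (taylor_left a21) (taylor_left a22)
      mu (sqrt (a11 0)) s Lam C rho M N (fun i => u i 0)); auto; try lra.
    + rewrite HbL2. unfold taylor_left. simpl. field.
    + intros l Hl. apply (IH l Hl).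
    + apply Hw. split; lra.
  - apply (layer_step (taylor_right a11) (taylor_right a12) (taylor_right a21) (taylor_right a22)
      mu (sqrt (a11 1)) s Lam C rho M N (fun i => u i 1)); auto; try lra.
    + rewrite HbR2. unfold taylor_right. simpl. field.
    + intros l Hl. apply (IH l Hl).
    + apply Hw. split; lra.
Qed.

Lemma coefficient_bounds (f g a11 a12 a21 a22 : R -> R)
    (Cf gamf Cg gamg Ca gama alpha : R) :
  0 < Cf -> 0 < gamf -> 0 < Cg -> 0 < gamg -> 0 < Ca -> 0 < gama -> 0 < alpha ->
  analytic_data f Cf gamf -> analytic_data g Cg gamg ->
  analytic_data a11 Ca gama -> analytic_data a12 Ca gama ->
  analytic_data a21 Ca gama -> analytic_data a22 Ca gama ->
  coercive a11 a12 a21 a22 alpha ->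
  exists C rho, Ca <= C /\ gama <= rho /\
    derivs_bounded f (analytic_bound C rho) /\ derivs_bounded g (analytic_bound C rho) /\
    derivs_bounded (fun x => / a11 x) (analytic_bound C rho) /\
    derivs_bounded (fun x => a21 x / a11 x) (analytic_bound C rho) /\
    derivs_bounded a12 (analytic_bound C rho) /\
    derivs_bounded (fun x => (a22 x * a11 x - a12 x * a21 x) / a11 x) (analytic_bound C rho).
Proof.
  intros HCf Hgf HCg Hgg HCa Hga Hal Hf Hg H11 H12 H21 H22 Hco.
  pose proof (analytic_bounded_data _ _ _ HCf Hgf Hf) as Bf.
  pose proof (analytic_bounded_data _ _ _ HCg Hgg Hg) as Bg.
  pose proof (analytic_bounded_data _ _ _ HCa Hga H11) as B11.
  pose proof (analytic_bounded_data _ _ _ HCa Hga H12) as B12.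
  pose proof (analytic_bounded_data _ _ _ HCa Hga H21) as B21.
  pose proof (analytic_bounded_data _ _ _ HCa Hga H22) as B22.
  assert (Binv : analytic_bounded (fun x => / a11 x)).
  { apply analytic_bounded_inv with (alpha ^ 2); auto; [sign|].
    intros x [Hx0 Hx1]. apply (coercive_a11 _ _ _ _ _ _ Hco). split; lra. }
  assert (Bq : analytic_bounded (fun x => a21 x / a11 x))
    by (apply (analytic_bounded_mult a21 (fun x => / a11 x)); auto).
  assert (Bc : analytic_bounded (fun x => (a22 x * a11 x - a12 x * a21 x) / a11 x)).
  { apply (analytic_bounded_mult (fun x => a22 x * a11 x - a12 x * a21 x) (fun x => / a11 x));
      auto.
    apply analytic_bounded_ext with (fun x => 1 * (a22 x * a11 x) + (-1) * (a12 x * a21 x)).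
    { intros; ring. }
    apply analytic_bounded_lin; now apply analytic_bounded_mult. }
  destruct Bf as (C1 & r1 & HC1 & Hr1 & Bf), Bg as (C2 & r2 & HC2 & Hr2 & Bg),
    Binv as (C3 & r3 & HC3 & Hr3 & Binv), Bq as (C4 & r4 & HC4 & Hr4 & Bq),
    B12 as (C5 & r5 & HC5 & Hr5 & B12), Bc as (C6 & r6 & HC6 & Hr6 & Bc).
  exists (C1 + C2 + C3 + C4 + C5 + C6 + Ca), (r1 + r2 + r3 + r4 + r5 + r6 + gama).
  split; [lra|]. split; [lra|].
  repeat split; try (eapply derivs_bounded_le; [|eassumption]; intros n;
    apply analytic_bound_mono; lra);
    try (intros n; first [apply Bf|apply Bg|apply Binv|apply Bq|apply B12|apply Bc]).
Qed.

Theorem theorem5p5 (f g a11 a12 a21 a22 : R -> R)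
    (Cf gamf Cg gamg Ca gama alpha : R)
    (Cf_pos : 0 < Cf) (gamf_pos : 0 < gamf)
    (Cg_pos : 0 < Cg) (gamg_pos : 0 < gamg)
    (Ca_pos : 0 < Ca) (gama_pos : 0 < gama)
    (f_an : analytic_data f Cf gamf)
    (g_an : analytic_data g Cg gamg)
    (a11_an : analytic_data a11 Ca gama)
    (a12_an : analytic_data a12 Ca gama)
    (a21_an : analytic_data a21 Ca gama)
    (a22_an : analytic_data a22 Ca gama)
    (alpha_pos : 0 < alpha)
    (a_coercive : coercive a11 a12 a21 a22 alpha) :
  exists (gam Cu Cv C1 C2 C3 C4 K1 K2 K3 K4 : R) (G : C -> Prop),
    (0 < gam /\ 0 < Cu /\ 0 < Cv) /\
    (0 < C1 /\ 0 < C2 /\ 0 < C3 /\ 0 < C4) /\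
    (0 < K1 /\ 0 < K2 /\ 0 < K3 /\ 0 < K4) /\
    (open G /\ forall x : R, I_closed x -> G (RtoC x)) /\
    forall eps mu : R, 0 < eps -> eps <= mu -> mu <= 1 ->
    forall u v uL vL uR vR : nat -> R -> R,
    recursion f g a11 a12 a21 a22 mu u v uL vL uR vR ->
    (exists UL VL UR VR : nat -> C -> C,
       (forall i : nat,
          (entire (UL i) /\ extends halfline_closed (UL i) (uL i)) /\
          (entire (VL i) /\ extends halfline_closed (VL i) (vL i)) /\
          (entire (UR i) /\ extends halfline_closed (UR i) (uR i)) /\
          (entire (VR i) /\ extends halfline_closed (VR i) (vR i))) /\
       (forall z : C, VL 0%nat z = 0%C /\ VL 1%nat z = 0%C /\
                      VR 0%nat z = 0%C /\ VR 1%nat z = 0%C) /\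
       (forall (i : nat) (z : C),
          Cmod (VL (i + 2)%nat z) <= layer_bound C1 K1 Cv (sqrt (a11 0)) mu i z /\
          Cmod (UL i z) <= layer_bound C2 K2 Cu (sqrt (a11 0)) mu i z /\
          Cmod (VR (i + 2)%nat z) <= layer_bound C1 K1 Cv (sqrt (a11 1)) mu i z /\
          Cmod (UR i z) <= layer_bound C2 K2 Cu (sqrt (a11 1)) mu i z)) /\
    (forall i : nat,
       (exists U : C -> C, holomorphic_on G U /\ extends I_closed U (u i)) /\
       (exists V : C -> C, holomorphic_on G V /\ extends I_closed V (v i))) /\
    (forall i n : nat,
       Rbar_le (Linf_norm (Derive_n (u i) n)) (smooth_bound C3 K3 gam mu i n) /\
       Rbar_le (Linf_norm (Derive_n (v i) n)) (smooth_bound C4 K4 gam mu i n)).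
Proof.
  destruct (coefficient_bounds f g a11 a12 a21 a22 Cf gamf Cg gamg Ca gama alpha)
    as (C & rho & HCa & Hrho & Bf & Bg & Binv & Bq & B12 & Bc); auto.
  assert (HC : 0 < C) by lra. assert (Hr : 0 < rho) by lra.
  set (c0 := alpha ^ 4 / Ca).
  assert (Hc0 : 0 < c0) by sign.
  assert (Hc0le : forall x, I_open x -> c0 <= (a22 x * a11 x - a12 x * a21 x) / a11 x).
  { intros x [Hx0 Hx1]. assert (Hx : I_closed x) by (split; lra).
    pose proof (coercive_det _ _ _ _ _ _ alpha_pos a_coercive Hx) as Hdet.
    pose proof (coercive_a11 _ _ _ _ _ _ a_coercive Hx) as Ha.
    assert (Ha2 : 0 < alpha ^ 2) by sign.
    destruct (analytic_data_bound _ _ _ a11_an 0 x Hx) as [_ Hle]. simpl in Hle.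
    pose proof (Rle_abs (a11 x)).
    unfold c0, Rdiv. apply Rmult_le_compat; auto.
    - sign.
    - sign.
    - apply Rinv_le_contravar; lra. }
  set (gam := 2 * rho + 2 * C + 1).
  assert (Hgam2 : 2 * C + 1 <= gam ^ 2).
  { apply Rle_trans with (gam * 1); [unfold gam; lra|].
    replace (gam ^ 2) with (gam * gam) by ring. apply Rmult_le_compat_l; unfold gam; lra. }
  set (s := Rmin 1 alpha / 2).
  assert (Hs : 0 < s) by (unfold s; pose proof (Rmin_glb_lt 1 alpha 0 ltac:(lra) alpha_pos); lra).
  assert (Hs1 : s <= 1) by (unfold s; pose proof (Rmin_l 1 alpha); lra).
  assert (Hsa : 2 * s <= alpha) by (unfold s; pose proof (Rmin_r 1 alpha); lra).
  assert (Hs2 : 0 < s ^ 2) by sign.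
  set (N := 4 * C / s ^ 2).
  assert (HN : 0 < N) by sign.
  set (K := smooth_const c0 C).
  assert (HK : 0 < K) by now apply smooth_const_pos.
  set (M := K * C). assert (HM : 0 < M) by sign.
  (* [h / Lam] bounds the relative size of the lower-order layer terms *)
  set (h := 4 * rho / s + 2 * N).
  assert (Hrs : 0 < 4 * rho / s) by sign.
  assert (Hh : 0 < h) by (unfold h; lra).
  assert (HhC : 0 < h * (C / s ^ 2)).
  { sign. }
  assert (HKg : 0 < K * (9 * gam ^ 2 + N)).
  { apply Rmult_lt_0_compat; [exact HK|]. pose proof (pow2_ge_0 gam). lra. }
  set (Lam := 1 + K * (9 * gam ^ 2 + N) + h + h * (C / s ^ 2)).
  assert (HL1 : 1 <= Lam) by (unfold Lam; lra).
  assert (HLL : Lam <= Lam ^ 2).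
  { apply Rle_trans with (Lam * 1); [lra|].
    replace (Lam ^ 2) with (Lam * Lam) by ring. apply Rmult_le_compat_l; lra. }
  assert (HLK : K * (9 * gam ^ 2 + N) <= Lam ^ 2)
    by (eapply Rle_trans; [|exact HLL]; unfold Lam; lra).
  assert (Ht : 2 * rho / (s * Lam) = 4 * rho / s / 2 / Lam) by (field; lra).
  assert (Hsmall : 2 * (2 * rho / (s * Lam)) + 2 * (N / Lam ^ 2) <= h / Lam).
  { rewrite Ht. replace (h / Lam) with (2 * (4 * rho / s / 2 / Lam) + 2 * (N / Lam))
      by (unfold h; field; lra).
    apply Rplus_le_compat_l, Rmult_le_compat_l; [lra|].
    apply Rmult_le_compat_l; [lra|]. apply Rinv_le_contravar; lra. }
  assert (Hh1 : h / Lam <= 1).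
  { apply (Rmult_le_reg_r Lam); [lra|]. unfold Rdiv.
    rewrite Rmult_assoc, Rinv_l by lra. unfold Lam; lra. }
  assert (Hh2 : C * (h / Lam) <= s ^ 2).
  { apply (Rmult_le_reg_r (Lam / s ^ 2)); [sign|].
    replace (C * (h / Lam) * (Lam / s ^ 2)) with (h * (C / s ^ 2)) by (field; lra).
    replace (s ^ 2 * (Lam / s ^ 2)) with Lam by (field; lra).
    unfold Lam; lra. }
  assert (Hth : 2 * rho / (s * Lam) <= 1 / 2).
  { assert (0 < N / Lam ^ 2) by sign. lra. }
  assert (HG := fun a => analytic_data_geometric a Ca gama C rho (conj Ca_pos HCa)
                           (conj gama_pos Hrho)).
  pose proof (HG _ a11_an) as G11. pose proof (HG _ a12_an) as G12.
  pose proof (HG _ a21_an) as G21. pose proof (HG _ a22_an) as G22.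
  set (d := / (324 * gam)).
  assert (Hgam : 1 <= gam) by (unfold gam; lra).
  assert (Hd : 0 < d < 1 / 2).
  { unfold d. split; [sign|].
    apply Rle_lt_trans with (/ 324); [apply Rinv_le_contravar; lra|lra]. }
  exists gam, 1, 1, (N * M), M, M, M, (6 * Lam), (6 * Lam), Lam, Lam, (I_neighborhood d).
  split; [lra|]. split; [repeat split; auto; sign|].
  split; [lra|].
  split.
  { split; [apply open_I_neighborhood|]. intros x Hx. exists x. split; [exact Hx|].
    replace (RtoC x - RtoC x)%C with (RtoC 0) by ring. rewrite Cmod_0; lra. }
  intros eps mu Heps Hepsmu Hmu1 u v uL vL uR vR Hrec.
  assert (Hmu : 0 < mu <= 1) by lra.
  assert (Hb := recursion_bounds f g a11 a12 a21 a22 c0 C rho gam alpha s M N Lam mu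
    u v uL vL uR vR Hmu Hc0 HC Hr Hgam ltac:(unfold gam; lra) Hgam2 Hs Hsa HL1 HM
    (Rle_refl _) eq_refl HLK Hth
    ltac:(eapply Rle_trans; [apply Rmult_le_compat_l; [lra|exact Hsmall]|exact Hh2])
    ltac:(lra) a_coercive Bf Bg Binv Bq B12 Bc Hc0le
    (proj1 G11) (proj1 G12) (proj1 G21) (proj1 G22)
    (proj2 G11) (proj2 G12) (proj2 G21) (proj2 G22) Hrec).
  assert (Hbeta : forall x, I_closed x -> 0 < sqrt (a11 x)).
  { intros x Hx. apply sqrt_lt_R0. pose proof (coercive_a11 _ _ _ _ _ _ a_coercive Hx).
    pose proof (pow_lt alpha 2 alpha_pos). lra. }
  destruct Hrec as [Hsm [HLp HRp]].
  split; [|split].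
  - destruct (layer_family_entire (sqrt (a11 0)) s M N Lam mu _ _ _ _ _ uL vL
      (Hbeta 0 ltac:(split; lra)) (conj Hs Hs1) ltac:(lra) ltac:(lra) ltac:(lra) ltac:(lra) HLp
      ltac:(intros i; apply (Hb i)) ltac:(intros i; apply (Hb i)))
      as (UL & VL & HL1' & HL2' & HL3').
    destruct (layer_family_entire (sqrt (a11 1)) s M N Lam mu _ _ _ _ _ uR vR
      (Hbeta 1 ltac:(split; lra)) (conj Hs Hs1) ltac:(lra) ltac:(lra) ltac:(lra) ltac:(lra) HRp
      ltac:(intros i; apply (Hb i)) ltac:(intros i; apply (Hb i)))
      as (UR & VR & HR1' & HR2' & HR3').
    exists UL, VL, UR, VR. split; [|split].
    + intros i. destruct (HL1' i), (HR1' i). auto.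
    + intros z. destruct (HL2' z), (HR2' z). auto.
    + intros i z. destruct (HL3' i z), (HR3' i z). auto.
  - intros i. destruct (Hsm i) as (Hvcl & _ & _ & _ & Hucont & _).
    destruct (weight_le_analytic_bound i mu gam Hmu ltac:(lra)) as (A & HA & HAb).
    assert (HMA : 0 <= M * Lam ^ i * A).
    { sign. }
    assert (Han : forall w, derivs_bounded w (fun n => M * Lam ^ i * weight i mu gam n) ->
              derivs_bounded w (analytic_bound (M * Lam ^ i * A) (9 * gam))).
    { intros w. apply derivs_bounded_le. intros n.
      replace (analytic_bound (M * Lam ^ i * A) (9 * gam) n)
        with (M * Lam ^ i * analytic_bound A (9 * gam) n) by (unfold analytic_bound; ring).
      apply Rmult_le_compat_l; [|apply HAb]. sign. }
    assert (Hgd : 36 * (9 * gam * d) <= 1) by (right; unfold d; field; lra).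
    split.
    + apply (holomorphic_extension (u i) (M * Lam ^ i * A) (9 * gam) d); auto; try lra.
      apply Han, (Hb i).
    + apply (holomorphic_extension (v i) (M * Lam ^ i * A) (9 * gam) d); auto; try lra.
      * apply Han, (Hb i).
      * apply Hvcl.
  - intros i n. destruct (Hb i) as [[Hv Hu] _].
    split; apply Linf_norm_le; intros x Hx.
    + eapply Rle_trans; [apply (proj2 Hu n x Hx)|]. apply weight_le_smooth_bound; lra.
    + eapply Rle_trans; [apply (proj2 Hv n x Hx)|]. apply weight_le_smooth_bound; lra.
Qed.
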